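(* Let $\mathcal{I}=\{f\in QC: f^{-1}\in QC\}$ with the topology given by $\|\cdot\|_\infty$, and let $\mathcal{F}$ be the set of Fredholm operators on $H^2$ that belong to $\mathfrak{I}(QC)$, with the operator norm topology. Then $\mathcal{I}$ and $\mathcal{F}$ both have uncountably many path-connected components.
   Context: $\mathbb{T}$ is the unit circle with Lebesgue measure (functions equal a.e. are identified), $\chi_n(t)=e^{int}$ for $n\in\mathbb{Z}$, and $C(\mathbb{T})$ is the set of continuous functions on $\mathbb{T}$. For $p=2,\infty$, $H^p=\{f\in L^p(\mathbb{T}):\int_0^{2\pi}f(t)\chi_n(t)\,dt=0\text{ for all }n>0\}$. $QC=[H^\infty+C(\mathbb{T})]\cap\overline{[H^\infty+C(\mathbb{T})]}$, where the bar denotes the set of complex conjugates; $QC$ is a commutative Banach subalgebra of $L^\infty(\mathbb{T})$. $P$ is the orthogonal projection of $L^2(\mathbb{T})$ onto $H^2$, and for $f\in L^\infty(\mathbb{T})$ the Toeplitz operator $T_f$ on $H^2$ is $T_f(g)=P(fg)$. $\mathfrak{I}(QC)$ is the $C^*$-algebra of bounded operators on $H^2$ generated by $\{T_\phi:\phi\in QC\}$. *)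

(* Defs.v *)
From HB Require Import structures.
From mathcomp Require Import all_boot all_order all_algebra.
From mathcomp Require Import generic_quotient ring_quotient complex.
From mathcomp Require Import all_classical all_reals all_analysis.
From mathcomp Require Import homotopy measurable_realfun ess_sup_inf.

Set Implicit Arguments.
Unset Strict Implicit.
Unset Printing Implicit Defensive.

Import Order.TTheory GRing.Theory Num.Theory.
Import numFieldNormedType.Exports.

Local Open Scope classical_set_scope.
Local Open Scope ring_scope.
Local Open Scope complex_scope.

Definition unit_interval (R : realType) : Type := set_type (`[0, 1]%classic : set R).

Section UnitInterval.
Variable R : realType.
HB.instance Definition _ := Topological.on (unit_interval R).
Let zeroI : (0 : R) \in `[0, 1]%classic.
Proof. by apply/mem_set; rewrite /= in_itv /= lexx ler01. Qed.
Let oneI : (1 : R) \in `[0, 1]%classic.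
Proof. by apply/mem_set; rewrite /= in_itv /= lexx ler01. Qed.
Let zero_neq_one :
  exist _ 0 zeroI != exist _ 1 oneI :> unit_interval R.
Proof. by apply/eqP => /(congr1 (@proj1_sig _ _))/= /esym/eqP; rewrite oner_eq0. Qed.
HB.instance Definition _ := isBiPointed.Build (unit_interval R) zero_neq_one.
End UnitInterval.

Definition path_component (R : realType) (X : topologicalType) (x : X) : set X :=
  [set y | inhabited {path (unit_interval R) from x to y}].

Definition path_components (R : realType) (X : topologicalType) : set (set X) :=
  range (@path_component R X).
Arguments path_components : clear implicits.

Section Circle.
Variable R : realType.

(* Functions on the unit circle are represented by functions of the angle
   t : R, and only their values on [0, 2 * pi] matter: the measure below ignores
   everything outside of that interval. It is not normalised. *)
Definition circle_measure : set (measurableTypeR R) -> \bar R :=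
  mrestr (@lebesgue_measure R) (@measurable_itv R `[0, 2 * pi]).
HB.instance Definition _ := Measure.on circle_measure.

Lemma circle_measure_fin : fin_num_fun circle_measure.
Proof.
move=> A mA; rewrite ge0_fin_numE; last exact: measure_ge0.
rewrite /circle_measure /mrestr.
apply: (@le_lt_trans _ _ (lebesgue_measure (`[0, 2 * pi]%classic : set R))).
  by apply: le_measure; rewrite ?inE//; apply: measurableI.
by rewrite lebesgue_measure_itv /=; case: ifP => _; rewrite ltry.
Qed.
HB.instance Definition _ :=
  @Measure_isFinite.Build _ _ _ circle_measure circle_measure_fin.

Lemma circle_measureT_gt0 : (0 < circle_measure setT)%E.
Proof.
rewrite /circle_measure /mrestr setTI lebesgue_measure_itv /=.
by rewrite lte_fin mulr_gt0 ?pi_gt0// -EFinD lte_fin subr0 mulr_gt0 ?pi_gt0.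
Qed.

Notation T := (measurableTypeR R).
Notation C := R[i].

Definition cmeasurable_fun (f : T -> C) : Prop :=
  measurable_fun setT (fun t => complex.Re (f t)) /\
  measurable_fun setT (fun t => complex.Im (f t)).

Definition cmfun : {pred T -> C} := mem [set f | cmeasurable_fun f].

Lemma cmfunP (f : T -> C) : f \in cmfun <-> cmeasurable_fun f.
Proof. by split => [/set_mem|/mem_set]. Qed.

Lemma ReB (x y : C) : complex.Re (x - y) = complex.Re x - complex.Re y.
Proof. by case: x; case: y. Qed.
Lemma ImB (x y : C) : complex.Im (x - y) = complex.Im x - complex.Im y.
Proof. by case: x; case: y. Qed.
Lemma ReM (x y : C) :
  complex.Re (x * y) = complex.Re x * complex.Re y - complex.Im x * complex.Im y.
Proof. by case: x; case: y. Qed.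
Lemma ImM (x y : C) :
  complex.Im (x * y) = complex.Re x * complex.Im y + complex.Im x * complex.Re y.
Proof. by case: x => a b; case: y => c d /=; rewrite addrC. Qed.

Lemma cmfun_subring : subring_closed cmfun.
Proof.
split.
- by apply/cmfunP; split; exact: measurable_cst.
- move=> f g /cmfunP[f1 f2] /cmfunP[g1 g2]; apply/cmfunP; split.
    under eq_fun do rewrite ReB; exact: measurable_funB.
  under eq_fun do rewrite ImB; exact: measurable_funB.
- move=> f g /cmfunP[f1 f2] /cmfunP[g1 g2]; apply/cmfunP; split.
    under eq_fun do rewrite ReM; apply: measurable_funB; exact: measurable_funM.
  under eq_fun do rewrite ImM; apply: measurable_funD; exact: measurable_funM.
Qed.
HB.instance Definition _ :=
  GRing.isSubringClosed.Build (T -> C) cmfun cmfun_subring.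

Record cmfunType := CMFun { cmfun_val :> T -> C; _ : cmfun_val \in cmfun }.
HB.instance Definition _ := [isSub for cmfun_val].
HB.instance Definition _ := [Choice of cmfunType by <:].
HB.instance Definition _ := [SubChoice_isSubComNzRing of cmfunType by <:].

Definition aezero : {pred cmfunType} :=
  mem [set f : cmfunType | {ae circle_measure, forall t, f t = 0}].

Lemma aezero_idealr : idealr_closed aezero.
Proof.
split.
- by apply/mem_set; exact: aeW.
- apply/negP => /set_mem /= [N [mN N0 sN]].
  have NT : N = setT.
    by apply/seteqP; split=> // t _; apply: sN => /= /eqP; rewrite oner_eq0.
  by move: N0 circle_measureT_gt0; rewrite NT => ->; rewrite ltxx.
- move=> a u v /set_mem u0 /set_mem v0; apply/mem_set => /=.
  apply: filterS2 u0 v0 => t ut vt.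
  by rewrite -[LHS]/(a t * u t + v t) ut vt mulr0 addr0.
Qed.
HB.instance Definition _ := isIdealr.Build cmfunType aezero aezero_idealr.

(* Complex measurable functions modulo equality almost everywhere on the
   circle: the ring of measurable functions quotiented by the ideal of those
   that vanish almost everywhere. *)
Definition L0 : Type := {ideal_quot aezero}.
HB.instance Definition _ := GRing.ComNzRing.on L0.
HB.instance Definition _ := EqQuotient.on L0.

Definition L0_fun (f : L0) : T -> C := repr f.
Coercion L0_fun : L0 >-> Funclass.

Local Open Scope quotient_scope.
Definition mkL0 (f : cmfunType) : L0 := \pi_L0 f.

Lemma mkL0E f : {ae circle_measure, forall t, mkL0 f t = f t}.
Proof.
have : mkL0 f = \pi_L0 (repr (mkL0 f)) by rewrite reprK.
move=> /esym/eqP; rewrite /mkL0 eqmodE => /set_mem /=; apply: filterS => t.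
rewrite -[X in X = 0]/(_ t - _ t).
by move/eqP; rewrite subr_eq0 => /eqP.
Qed.

Lemma mkL0_eq (f g : cmfunType) :
  {ae circle_measure, forall t, f t = g t} -> mkL0 f = mkL0 g.
Proof.
move=> fg; apply/eqP; rewrite /mkL0 eqmodE; apply/mem_set => /=.
by apply: filterS fg => t ft; rewrite -[LHS]/(f t - g t) ft subrr.
Qed.

Lemma L0K (f : L0) : mkL0 (repr f) = f. Proof. exact: reprK. Qed.

Lemma L0P (f g : L0) : f = g <-> {ae circle_measure, forall t, f t = g t}.
Proof.
split=> [->|fg]; first exact: aeW.
by rewrite -(L0K f) -(L0K g); exact: mkL0_eq.
Qed.

Lemma L0_DE (f g : L0) : {ae circle_measure, forall t, (f + g : L0) t = f t + g t}.
Proof.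
have -> : f + g = mkL0 (repr f + repr g).
  by rewrite -[in LHS](L0K f) -[in LHS](L0K g) /mkL0 [RHS]rmorphD.
exact: mkL0E.
Qed.

Lemma L0_ME (f g : L0) : {ae circle_measure, forall t, (f * g : L0) t = f t * g t}.
Proof.
have -> : f * g = mkL0 (repr f * repr g).
  by rewrite -[in LHS](L0K f) -[in LHS](L0K g) /mkL0 [RHS]rmorphM.
exact: mkL0E.
Qed.

Lemma L0_0E : {ae circle_measure, forall t, (0 : L0) t = 0}.
Proof. by have -> : 0 = mkL0 0; [rewrite /mkL0 rmorph0|exact: mkL0E]. Qed.

Lemma L0_1E : {ae circle_measure, forall t, (1 : L0) t = 1}.
Proof. by have -> : 1 = mkL0 1; [rewrite /mkL0 rmorph1|exact: mkL0E]. Qed.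

Lemma cst_cmfun (a : C) : (fun _ => a) \in cmfun.
Proof. by apply/cmfunP; split; exact: measurable_cst. Qed.
Definition cstL0 (a : C) : L0 := mkL0 (CMFun (cst_cmfun a)).
Lemma cstL0E a : {ae circle_measure, forall t, cstL0 a t = a}.
Proof. exact: mkL0E. Qed.

Lemma cstL0_D : {morph cstL0 : a b / a + b}.
Proof.
move=> a b; rewrite -[RHS]rmorphD; apply: mkL0_eq; exact: aeW.
Qed.

Lemma cstL0_M : {morph cstL0 : a b / a * b}.
Proof. by move=> a b; rewrite -[RHS]rmorphM; apply: mkL0_eq; exact: aeW. Qed.

Lemma cstL0_1 : cstL0 1 = 1.
Proof. by rewrite -[RHS](rmorph1 (\pi_L0)); apply: mkL0_eq; exact: aeW. Qed.

Definition scaleL0 (a : C) (f : L0) : L0 := cstL0 a * f.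

Lemma scaleL0A a b v : scaleL0 a (scaleL0 b v) = scaleL0 (a * b) v.
Proof. by rewrite /scaleL0 cstL0_M mulrA. Qed.
Lemma scaleL01 : left_id 1 scaleL0.
Proof. by move=> v; rewrite /scaleL0 cstL0_1 mul1r. Qed.
Lemma scaleL0Dr : right_distributive scaleL0 +%R.
Proof. by move=> a u v; rewrite /scaleL0 mulrDr. Qed.
Lemma scaleL0Dl v : {morph scaleL0^~ v : a b / a + b}.
Proof. by move=> a b; rewrite /scaleL0 cstL0_D mulrDl. Qed.

HB.instance Definition _ :=
  GRing.Zmodule_isLmodule.Build C L0 scaleL0A scaleL01 scaleL0Dr scaleL0Dl.

Lemma L0_ZE (a : C) (f : L0) :
  {ae circle_measure, forall t, (a *: f : L0) t = a * f t}.
Proof.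
apply: filterS2 (cstL0E a) (L0_ME (cstL0 a) f) => t at_.
by rewrite at_ => <-.
Qed.

Lemma L0_meas (f : L0) : cmeasurable_fun f.
Proof. by apply/cmfunP; rewrite /L0_fun; case: (repr f). Qed.

Lemma conj_cmfun (f : L0) : (fun t => (f t)^*) \in cmfun.
Proof.
case: (L0_meas f) => mr mi; apply/cmfunP; split => /=.
  rewrite (_ : (fun _ => _) = (fun t => complex.Re (f t)))//.
  by apply/funext => t; case: (f t).
rewrite (_ : (fun _ => _) = (fun t => - complex.Im (f t))).
  exact: measurable_funN.
by apply/funext => t; case: (f t).
Qed.

Definition conjL0 (f : L0) : L0 := mkL0 (CMFun (conj_cmfun f)).

Definition cabs (f : T -> C) (t : T) : R := Normc.normc (f t).

Lemma cabs_ge0 (f : T -> C) t : 0 <= cabs f t.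
Proof. by rewrite /cabs; case: (f t) => a b; exact: sqrtr_ge0. Qed.

Lemma measurable_cabs (f : T -> C) :
  cmeasurable_fun f -> measurable_fun setT (cabs f).
Proof.
move=> [mr mi]; rewrite /cabs.
rewrite (_ : (fun _ => _) = (fun t =>
    Num.sqrt ((complex.Re (f t)) ^+ 2 + (complex.Im (f t)) ^+ 2))); last first.
  by apply/funext => t; case: (f t).
have ms : measurable_fun setT (@Num.sqrt R).
  by apply: (@continuous_measurable_fun R (@Num.sqrt R)) => x; exact: sqrt_continuous.
apply: (measurableT_comp ms).
by apply: measurable_funD; exact: measurable_funX.
Qed.

Local Open Scope ereal_scope.

Definition Lpnorm (p : \bar R) (f : T -> C) : \bar R :=
  'N[circle_measure]_p[EFin \o cabs f].

Lemma le_ae_Lnorm (p : \bar R) (f g : T -> R) : 1 <= p ->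
  measurable_fun setT f -> measurable_fun setT g ->
  {ae circle_measure, forall t, (`|f t| <= `|g t|)%R} ->
  'N[circle_measure]_p[EFin \o f] <= 'N[circle_measure]_p[EFin \o g].
Proof.
rewrite unlock; case: p => [r|_|//]; last first.
  move=> mf mg fg; case: ifPn => // _; apply: le_ess_sup.
  by apply: filterS fg => t; rewrite /= lee_fin.
rewrite lee_fin => r1 mf mg fg /=.
have r0 : (0 < r)%R by rewrite (lt_le_trans ltr01).
have mp (h : T -> R) : measurable_fun setT h ->
    measurable_fun setT (fun x => `|(EFin \o h) x| `^ r).
  move=> mh; apply: (measurableT_comp (measurable_poweR _)) => //.
  by apply: measurableT_comp => //; exact/measurable_EFinP.
have I0 (h : T -> R) : 0 <= \int[circle_measure]_x (`|(EFin \o h) x| `^ r).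
  by apply: integral_ge0 => x _; exact: poweR_ge0.
apply: gt0_ler_poweR.
- by rewrite invr_ge0 ltW.
- by rewrite in_itv /= leey I0.
- by rewrite in_itv /= leey I0.
apply: ae_ge0_le_integral => //.
- exact: mp.
- exact: mp.
apply: filterS fg => t fgt _ /=.
by rewrite lee_fin; apply: ge0_ler_powR; rewrite ?nnegrE ?(ltW r0).
Qed.

Lemma eq_ae_Lnorm (p : \bar R) (f g : T -> R) : 1 <= p ->
  measurable_fun setT f -> measurable_fun setT g ->
  {ae circle_measure, forall t, f t = g t} ->
  'N[circle_measure]_p[EFin \o f] = 'N[circle_measure]_p[EFin \o g].
Proof.
move=> p1 mf mg fg; apply/eqP; rewrite eq_le.
by rewrite !le_ae_Lnorm//; apply: filterS fg => t ->.
Qed.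

Lemma LpnormD p (f g : L0) : 1 <= p ->
  Lpnorm p (f + g : L0)%R <= Lpnorm p f + Lpnorm p g.
Proof.
move=> p1.
have mf := measurable_cabs (L0_meas f); have mg := measurable_cabs (L0_meas g).
apply: le_trans (eminkowski _ mf mg p1).
apply: le_ae_Lnorm => //; first exact: measurable_cabs (L0_meas _).
  exact: measurable_funD.
apply: filterS (L0_DE f g) => t fgt /=.
rewrite !ger0_norm ?addr_ge0 ?cabs_ge0 //.
by rewrite /cabs fgt; exact: le_normcD.
Qed.

Lemma LpnormZ p (a : C) (f : L0) : 1 <= p -> Lpnorm p f < +oo ->
  Lpnorm p (a *: f : L0)%R = (Normc.normc a)%:E * Lpnorm p f.
Proof.
move=> p1 fp; have mf := measurable_cabs (L0_meas f).
have F : cabs f \in Lfun circle_measure p.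
  by rewrite inE; apply/andP; split; rewrite inE.
have na0 : (0 <= Normc.normc a)%R by case: a => x y; exact: sqrtr_ge0.
rewrite -[X in X%:E](ger0_norm na0) -(LnormZ (Lfun_Sub p1 F)).
apply: eq_ae_Lnorm => //.
- exact: measurable_cabs (L0_meas _).
- exact: measurable_funM.
- by apply: filterS (L0_ZE a f) => t aft; rewrite /cabs aft Normc.normcM.
Qed.

Lemma Lpnorm_ge0 p f : 0 <= Lpnorm p f. Proof. exact: Lnorm_ge0. Qed.

Lemma Lpnorm_eq0 p (f : L0) : 1 <= p -> Lpnorm p f = 0 -> f = 0%R.
Proof.
move=> p1 /Lnorm_eq0_eq0 h; apply/L0P.
have {}h : cabs f = \0 %[ae circle_measure].
  have : EFin \o cabs f = \0 %[ae circle_measure].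
    apply: h; last exact: lt_le_trans p1.
    by apply/measurable_EFinP; exact: measurable_cabs (L0_meas _).
  by apply: filterS => t /[apply] -[].
apply: filterS2 h L0_0E => t ft ->.
exact: Normc.eq0_normc (ft I).
Qed.

Lemma Lpnorm0 p : 1 <= p -> Lpnorm p (0%R : L0) = 0.
Proof.
move=> p1; have p0 : p != 0 by rewrite gt_eqF// (lt_le_trans lte01 p1).
rewrite -(Lnorm0 circle_measure p0).
apply: (@eq_ae_Lnorm p _ (cst 0%R)) => //.
  exact: measurable_cabs (L0_meas _).
by apply: filterS L0_0E => t t0; rewrite /cabs t0 Normc.normc0.
Qed.

Definition Lp (p : \bar R) : set L0 := [set f | Lpnorm p f < +oo].

Local Close Scope ereal_scope.

Section LpSpace.
Variables (p : \bar R) (p1 : (1 <= p)%E).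

(* The unused proof argument lets inLp p1 carry its linear structure. *)
Definition inLp of (1 <= p)%E : {pred L0} := mem (Lp p).

Lemma inLp_submod : submod_closed (inLp p1).
Proof.
split; first by apply/mem_set; rewrite /Lp /= Lpnorm0.
move=> a f g /set_mem fp /set_mem gp; apply/mem_set.
apply: le_lt_trans (LpnormD _ _ p1) _.
rewrite lte_add_pinfty// LpnormZ// lte_mul_pinfty// lee_fin.
by case: a => x y; exact: sqrtr_ge0.
Qed.
HB.instance Definition _ := GRing.isSubmodClosed.Build C L0 (inLp p1) inLp_submod.

Record LpType := MkLp { Lp_val :> L0; _ : Lp_val \in inLp p1 }.
HB.instance Definition _ := [isSub for Lp_val].
HB.instance Definition _ := [Choice of LpType by <:].
HB.instance Definition _ := [SubChoice_isSubLmodule of LpType by <:].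

Lemma LpP (f : LpType) : (Lpnorm p f < +oo)%E.
Proof. exact: set_mem (valP f). Qed.

Lemma Lpnorm_fineK (f : LpType) : (fine (Lpnorm p f))%:E = Lpnorm p f.
Proof. by rewrite fineK// ge0_fin_numE ?Lpnorm_ge0// LpP. Qed.

(* The scalars being R[i], a norm takes its values in R[i]. *)
Definition norm_Lp (f : LpType) : C := (fine (Lpnorm p f))%:C.

Lemma norm_LpD f g : norm_Lp (f + g) <= norm_Lp f + norm_Lp g.
Proof.
rewrite /norm_Lp -rmorphD lecR -lee_fin EFinD !Lpnorm_fineK.
exact: LpnormD.
Qed.

Lemma norm_LpZ (a : C) f : norm_Lp (a *: f) = `|a| * norm_Lp f.
Proof.
rewrite /norm_Lp -[`|a|]/((Normc.normc a)%:C) -rmorphM; congr (_%:C).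
by apply: EFin_inj; rewrite EFinM !Lpnorm_fineK; apply: LpnormZ => //; exact: LpP.
Qed.

Lemma norm_Lp_eq0 f : norm_Lp f = 0 -> f = 0.
Proof.
move=> /(congr1 (@complex.Re R)) /= f0; apply: val_inj; apply: (Lpnorm_eq0 p1).
by rewrite -Lpnorm_fineK f0.
Qed.

HB.instance Definition _ :=
  Lmodule_isNormed.Build C LpType norm_LpD norm_LpZ norm_Lp_eq0.
End LpSpace.

Lemma le1oo : (1 <= +oo :> \bar R)%E. Proof. exact: leey. Qed.
Lemma le12 : (1 <= 2%:E :> \bar R)%E. Proof. by rewrite lee_fin ler1n. Qed.

Local Notation Linf := (LpType le1oo).
Local Notation L2 := (LpType le12).

Definition cintegral (f : T -> C) : C :=
  Complex (\int[circle_measure]_t complex.Re (f t))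
          (\int[circle_measure]_t complex.Im (f t)).

Definition chi (n : int) (t : R) : C :=
  Complex (cos (n%:~R * t)) (sin (n%:~R * t)).

Definition Hp (p : \bar R) : set L0 :=
  [set f | Lp p f /\ forall n : int, 0 < n -> cintegral (fun t => f t * chi n t) = 0].

(* Continuous functions on the circle are continuous 2 * pi-periodic functions
   of the angle. *)
Definition CT : set L0 :=
  [set f | exists2 g : R -> C, continuous (g : R -> C^o) /\ (forall t, g (t + 2 * pi) = g t)
     & {ae circle_measure, forall t, f t = g t}].

Definition cintegrable (f : T -> C) : Prop :=
  circle_measure.-integrable setT (EFin \o (fun t => complex.Re (f t))) /\
  circle_measure.-integrable setT (EFin \o (fun t => complex.Im (f t))).

Lemma Re_le_cabs (f : T -> C) t : `|complex.Re (f t)| <= cabs f t.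
Proof.
rewrite /cabs; case: (f t) => a b /=.
by rewrite -sqrtr_sqr ler_sqrt ?addr_ge0 ?sqr_ge0// lerDl sqr_ge0.
Qed.

Lemma Im_le_cabs (f : T -> C) t : `|complex.Im (f t)| <= cabs f t.
Proof.
rewrite /cabs; case: (f t) => a b /=.
by rewrite -sqrtr_sqr ler_sqrt ?addr_ge0 ?sqr_ge0// lerDr sqr_ge0.
Qed.

Lemma cabs_chi n t : cabs (chi n) t = 1.
Proof. by rewrite /cabs /chi /= cos2Dsin2 sqrtr1. Qed.

Lemma chi_meas n : cmeasurable_fun (chi n).
Proof.
split=> /=.
  apply: (@continuous_measurable_fun R) => x.
  apply: continuous_comp; last exact: continuous_cos.
  by apply: cvgM; [exact: cvg_cst|exact: cvg_id].
apply: (@continuous_measurable_fun R) => x.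
apply: continuous_comp; last exact: continuous_sin.
by apply: cvgM; [exact: cvg_cst|exact: cvg_id].
Qed.

Lemma chiM_integrable (f : L0) n :
  Lp 2%:E f -> cintegrable (fun t => f t * chi n t).
Proof.
move=> f2.
have mf := L0_meas f; have mc := chi_meas n.
have : (fun t => f t * chi n t) \in cmfun.
  have fP : (f : T -> C) \in cmfun by apply/cmfunP.
  have cP : (chi n : T -> C) \in cmfun by apply/cmfunP.
  exact: (rpredM fP cP).
move=> /cmfunP[mr mi].
have i1 : circle_measure.-integrable setT (EFin \o cabs f).
  apply/Lfun1_integrable.
  apply: (@Lfun_subset _ _ _ circle_measure 1 2%:E) => //.
  - exact: le12.
  - exact: fin_num_measure.
  - exact: le12.
  - rewrite inE; apply/andP; split; rewrite inE //.
    exact: measurable_cabs.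
have e t : cabs (fun t => f t * chi n t) t = cabs f t.
  by rewrite /cabs Normc.normcM -/(cabs (chi n) t) cabs_chi mulr1.
split; (apply: le_integrable i1 => //; first exact/measurable_EFinP);
  move=> t _; rewrite /= lee_fin [leRHS]ger0_norm ?cabs_ge0// -e.
- exact: Re_le_cabs (fun t => f t * chi n t) t.
- exact: Im_le_cabs (fun t => f t * chi n t) t.
Qed.

Lemma Rintegral_ae_eq (u v : T -> R) :
  measurable_fun setT u -> measurable_fun setT v ->
  {ae circle_measure, forall t, u t = v t} ->
  \int[circle_measure]_t u t = \int[circle_measure]_t v t.
Proof.
move=> mu_ mv uv; congr fine; apply: ae_eq_integral => //.
- exact/measurable_EFinP.
- exact/measurable_EFinP.
- by apply: filterS uv => t ->.
Qed.

Lemma cintegral_linear (a : C) (u v w : T -> C) :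
  cintegrable u -> cintegrable v -> cmeasurable_fun w ->
  {ae circle_measure, forall t, w t = a * u t + v t} ->
  cintegral w = a * cintegral u + cintegral v.
Proof.
move=> [ur ui] [vr vi] [wr wi] wE.
have i2 (b c : R) (f g h : T -> R) : circle_measure.-integrable setT (EFin \o f) ->
    circle_measure.-integrable setT (EFin \o g) ->
    circle_measure.-integrable setT (EFin \o h) ->
    measurable_fun setT (fun t => b * f t + c * g t + h t) /\
    \int[circle_measure]_t (b * f t + c * g t + h t) =
    b * \int[circle_measure]_t f t + c * \int[circle_measure]_t g t
      + \int[circle_measure]_t h t.
  move=> fi gi hi.
  have bf : circle_measure.-integrable setT (EFin \o (fun t => b * f t)).
    exact: (integrableZl measurableT b fi).
  have cg : circle_measure.-integrable setT (EFin \o (fun t => c * g t)).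
    exact: (integrableZl measurableT c gi).
  have bc : circle_measure.-integrable setT (EFin \o (fun t => b * f t + c * g t)).
    exact: (integrableD measurableT bf cg).
  split.
    apply/measurable_EFinP.
    exact: (measurable_int circle_measure (integrableD measurableT bc hi)).
  have eD := @RintegralD _ _ _ circle_measure setT.
  have eZ := @RintegralZl _ _ _ circle_measure setT.
  apply: etrans (eD (fun t => b * f t + c * g t) h measurableT bc hi) _.
  congr (_ + _).
  apply: etrans (eD (fun t => b * f t) (fun t => c * g t) measurableT bf cg) _.
  by rewrite (eZ f b measurableT fi) (eZ g c measurableT gi).
case: (a) wE => b c wE.
have [m1 e1] := i2 b (- c) _ _ _ ur ui vr.
have [m2 e2] := i2 b c _ _ _ ui ur vi.
rewrite /cintegral (Rintegral_ae_eq wr m1); last first.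
  apply: filterS wE => t ->; case: (u t) => ? ?; case: (v t) => ? ? /=.
  by rewrite mulNr.
rewrite (Rintegral_ae_eq wi m2); last first.
  apply: filterS wE => t ->; case: (u t) => ? ?; case: (v t) => ? ? //=.
by rewrite e1 e2 /= mulNr.
Qed.

Definition inH2 : {pred L2} := mem [set f : L2 | Hp 2%:E f].

Lemma inH2_submod : submod_closed inH2.
Proof.
have cc0 n : cintegral (fun t => (0 : L0) t * chi n t) = 0.
  have [m1 m2] : cmeasurable_fun (fun t => (0 : L0) t * chi n t).
    apply/cmfunP.
    have fP : ((0 : L0) : T -> C) \in cmfun by apply/cmfunP; exact: L0_meas.
    have cP : (chi n : T -> C) \in cmfun by apply/cmfunP; exact: chi_meas.
    exact: (rpredM fP cP).
  rewrite /cintegral.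
  rewrite (@Rintegral_ae_eq _ (cst 0) m1); last 2 first.
  - exact: measurable_cst.
  - by apply: filterS L0_0E => t ->; rewrite mul0r.
  rewrite (@Rintegral_ae_eq _ (cst 0) m2); last 2 first.
  - exact: measurable_cst.
  - by apply: filterS L0_0E => t ->; rewrite mul0r.
  by rewrite Rintegral_cst// mul0r.
split.
  by apply/mem_set; split; [exact: LpP|move=> n _; exact: cc0].
move=> a f g /set_mem [f2 fH] /set_mem [g2 gH]; apply/mem_set; split.
  exact: LpP.
move=> n n0; rewrite (@cintegral_linear a (fun t => f t * chi n t) (fun t => g t * chi n t)).
- by rewrite fH// gH// mulr0 addr0.
- exact: chiM_integrable.
- exact: chiM_integrable.
- apply/cmfunP.
  have fP : ((a *: f + g : L2) : T -> C) \in cmfun by apply/cmfunP; exact: L0_meas.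
  have cP : (chi n : T -> C) \in cmfun by apply/cmfunP; exact: chi_meas.
  exact: (rpredM fP cP).
- apply: filterS2 (L0_DE (a *: (f : L0)) g) (L0_ZE a f) => t e1 e2.
  by rewrite -[X in X * _ = _]/((a *: (f : L0) + (g : L0) : L0) t) e1 e2 mulrDl mulrA.
Qed.
HB.instance Definition _ := GRing.isSubmodClosed.Build C L2 inH2 inH2_submod.

Record H2 := MkH2 { H2_val :> L2; _ : H2_val \in inH2 }.
HB.instance Definition _ := [isSub for H2_val].
HB.instance Definition _ := [Choice of H2 by <:].
HB.instance Definition _ := [SubChoice_isSubLmodule of H2 by <:].

Definition norm_H2 (f : H2) : C := `|H2_val f|.
Lemma norm_H2D f g : norm_H2 (f + g) <= norm_H2 f + norm_H2 g.
Proof. exact: (ler_normD (H2_val f) (H2_val g)). Qed.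
Lemma norm_H2Z (a : C) f : norm_H2 (a *: f) = `|a| * norm_H2 f.
Proof. exact: (normrZ a (H2_val f)). Qed.
Lemma norm_H2_eq0 f : norm_H2 f = 0 -> f = 0.
Proof. by move=> /normr0_eq0 f0; apply: val_inj. Qed.
HB.instance Definition _ :=
  Lmodule_isNormed.Build C H2 norm_H2D norm_H2Z norm_H2_eq0.

Lemma mul_LinfL2_subproof (f : Linf) (g : L2) : (f : L0) * (g : L0) \in inLp le12.
Proof.
apply/mem_set.
have M0 : 0 <= fine (Lpnorm +oo f) by rewrite fine_ge0// Lpnorm_ge0.
apply: (@le_lt_trans _ _ (Lpnorm 2%:E ((fine (Lpnorm +oo f))%:C *: (g : L0) : L0))); last first.
  rewrite LpnormZ//; [|exact: le12|exact: LpP].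
  rewrite lte_mul_pinfty ?lee_fin//; [exact: sqrtr_ge0|exact: LpP].
apply: le_ae_Lnorm; [exact: le12| exact: measurable_cabs (L0_meas _)..|].
have fle : {ae circle_measure, forall t, cabs f t <= fine (Lpnorm +oo f)}.
  have E : Lpnorm +oo f = ess_sup circle_measure (abse \o (EFin \o cabs f)).
    by rewrite /Lpnorm unlock circle_measureT_gt0.
  apply: filterS (ess_sup_ge circle_measure (abse \o (EFin \o cabs f))) => t.
  by rewrite -E -Lpnorm_fineK /= lee_fin ger0_norm ?cabs_ge0.
apply: filterS3 fle (L0_ME f g) (L0_ZE (fine (Lpnorm +oo f))%:C g) => t h1 h2 h3.
rewrite !ger0_norm ?cabs_ge0// /cabs h2 h3 !Normc.normcM ler_wpM2r//.
  exact: (cabs_ge0 g t).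
by rewrite /= expr0n addr0 sqrtr_sqr ger0_norm.
Qed.

Definition mul_LinfL2 (f : Linf) (g : L2) : L2 := MkLp (mul_LinfL2_subproof f g).

Definition H_plus_C : set L0 := [set f + g | f in Hp +oo%E & g in CT].

Definition QC : set L0 := H_plus_C `&` (conjL0 @` H_plus_C).

(* Elements of QC are essentially bounded, so that ranging over L^oo loses
   nothing; it provides the sup norm topology. *)
Definition QC_invertible : set Linf :=
  [set f | QC f /\ exists2 g, QC g & (f : L0) * g = 1].

Definition inner (f g : L0) : C := cintegral (fun t => f t * (g t)^*).

(* The orthogonal projection of u is the unique h in H^2 such that u - h is
   orthogonal to H^2; the default value 0 is never used as H^2 is a closed
   subspace of the Hilbert space L^2. *)
Definition hardy_proj (u : L2) : H2 :=
  xget 0 [set h : H2 | forall k : H2, inner (u - H2_val h : L2) k = 0].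

Definition toeplitz (f : Linf) (g : H2) : H2 := hardy_proj (mul_LinfL2 f g).
End Circle.

Notation Linf R := (LpType (@le1oo R)).
Notation L2 R := (LpType (@le12 R)).

Section BoundedOperators.
Variables (R : realType) (V : normedModType R[i]).
Notation C := R[i].

Definition bounded_op : {pred V -> V} := mem [set F : V -> V |
  linear F /\ exists M : C, forall x, `|F x| <= M * `|x| ].

Let rn (x : V) : R := complex.Re `|x|.
Let rnE x : `|x| = (rn x)%:C. Proof. by rewrite /rn RRe_real// normr_real. Qed.
Let rn_ge0 x : 0 <= rn x. Proof. by rewrite -lecR -rnE normr_ge0. Qed.
Let rnD x y : rn (x + y) <= rn x + rn y.
Proof. by rewrite -lecR rmorphD /= -!rnE ler_normD. Qed.
Let rnZ (a : C) x : rn (a *: x) = Normc.normc a * rn x.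
Proof. by apply: complexI; rewrite rmorphM /= -!rnE normrZ. Qed.
Let rn0 : rn 0 = 0. Proof. by rewrite /rn normr0. Qed.

Lemma bounded_opP F : F \in bounded_op -> exists2 M : R, 0 <= M & forall x, rn (F x) <= M * rn x.
Proof.
move=> /set_mem [_ [M FM]]; exists `|complex.Re M| => // x.
have : rn (F x) <= complex.Re M * rn x.
  have := FM x; rewrite !rnE lecE => /andP[_] /=.
  by case: (M) => a b /=; rewrite mulr0 subr0.
by move=> /le_trans; apply; rewrite ler_wpM2r ?rn_ge0// ler_norm.
Qed.

Lemma bounded_op_submod : submod_closed bounded_op.
Proof.
split.
  apply/mem_set; split; first by move=> a x y; rewrite -!/(0 : V) scaler0 addr0.
  by exists 0 => x; rewrite normr0 mul0r.
move=> a F G Fb Gb; have [M M0 FM] := bounded_opP Fb; have [N N0 GN] := bounded_opP Gb.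
move: Fb Gb => /set_mem [lF _] /set_mem [lG _]; apply/mem_set; split.
  move=> b x y; rewrite -![(a *: F + G) _]/(a *: F _ + G _) lF lG.
  by rewrite !scalerDr !scalerA [a * b]mulrC addrACA.
exists (Normc.normc a * M + N)%:C => x; rewrite !rnE -rmorphM lecR.
apply: le_trans (rnD _ _) _; rewrite mulrDl lerD// -[X in rn X]/(a *: F x) rnZ -mulrA.
by rewrite ler_wpM2l//; case: (a) => *; exact: sqrtr_ge0.
Qed.
HB.instance Definition _ := GRing.isSubmodClosed.Build C (V -> V) bounded_op bounded_op_submod.

Record BL := MkBL { BL_val :> V -> V; _ : BL_val \in bounded_op }.
HB.instance Definition _ := [isSub for BL_val].
HB.instance Definition _ := [Choice of BL by <:].
HB.instance Definition _ := [SubChoice_isSubLmodule of BL by <:].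

Definition opnorm (F : BL) : R := sup [set complex.Re `|F x| | x in [set x : V | `|x| <= 1]].

Lemma opnorm_has_sup (F : BL) : has_sup [set rn (F x) | x in [set x : V | `|x| <= 1]].
Proof.
split; first by exists (rn (F 0)); exists 0 => //=; rewrite normr0.
have [M M0 FM] := bounded_opP (valP F); exists M => _ [x /= x1 <-].
apply: le_trans (FM x) _; rewrite -[leRHS]mulr1 ler_wpM2l//.
by move: x1; rewrite rnE -[1]/(1%:C) lecR.
Qed.

Lemma opnorm_le (F : BL) (M : R) :
  (forall x, `|x| <= 1 -> rn (F x) <= M) -> opnorm F <= M.
Proof.
move=> FM; apply: ge_sup; last by move=> _ [x /= x1 <-]; exact: FM.
by case: (opnorm_has_sup F).
Qed.

Lemma opnorm_ub (F : BL) x : `|x| <= 1 -> rn (F x) <= opnorm F.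
Proof.
move=> x1; apply: ub_le_sup; first by case: (opnorm_has_sup F).
by exists x.
Qed.

Lemma opnorm_ge0 F : 0 <= opnorm F.
Proof. by apply: le_trans (@opnorm_ub F 0 _); rewrite ?rn_ge0 ?normr0 ?ler01. Qed.

Lemma BL_linear (F : BL) : linear F. Proof. by case/set_mem: (valP F). Qed.

Lemma opnormD F G : opnorm (F + G) <= opnorm F + opnorm G.
Proof.
apply: opnorm_le => x x1.
by apply: le_trans (rnD (F x) (G x)) _; apply: lerD; exact: opnorm_ub.
Qed.

Lemma opnormZ_le (a : C) F : opnorm (a *: F) <= Normc.normc a * opnorm F.
Proof.
apply: opnorm_le => x x1; rewrite -[X in rn X]/(a *: F x) rnZ ler_wpM2l ?opnorm_ub//.
by case: (a) => *; exact: sqrtr_ge0.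
Qed.

Lemma opnorm0 : opnorm 0 = 0.
Proof.
apply/eqP; rewrite eq_le opnorm_ge0 andbT; apply: opnorm_le => x _.
by rewrite -[X in rn X]/(0 : V) rn0.
Qed.

Lemma opnorm_eq0 F : opnorm F = 0 -> F = 0.
Proof.
move=> F0; apply: val_inj; apply/funext => x; rewrite -[RHS]/(0 : V).
have F1 y : `|y| <= 1 -> F y = 0.
  move=> /(@opnorm_ub F); rewrite F0 => h.
  by apply: normr0_eq0; rewrite rnE; congr (_%:C); apply/eqP; rewrite eq_le h rn_ge0.
have [->|x0] := eqVneq x 0; first by apply: F1; rewrite normr0 ler01.
have nx : `|x| != 0 by rewrite normr_eq0.
have FZ a y : F (a *: y) = a *: F y.
  have FF0 : F 0 = 0 by apply: F1; rewrite normr0 ler01.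
  by have := BL_linear F a y 0; rewrite FF0 !addr0.
have : F (`|x|^-1 *: x) = 0 by apply: F1; rewrite normfZV.
by rewrite FZ => /eqP; rewrite scaler_eq0 invr_eq0 (negbTE nx) => /eqP.
Qed.

Definition norm_BL (F : BL) : C := (opnorm F)%:C.

Lemma norm_BLD F G : norm_BL (F + G) <= norm_BL F + norm_BL G.
Proof. by rewrite /norm_BL -rmorphD lecR opnormD. Qed.

Lemma norm_BLZ (a : C) F : norm_BL (a *: F) = `|a| * norm_BL F.
Proof.
rewrite /norm_BL -[`|a|]/((Normc.normc a)%:C) -rmorphM; congr (_%:C).
apply/eqP; rewrite eq_le opnormZ_le /=.
have [->|a0] := eqVneq a 0; first by rewrite Normc.normc0 mul0r opnorm_ge0.
have na0 : 0 < Normc.normc a.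
  rewrite lt_neqAle; apply/andP; split; last by case: (a) => *; exact: sqrtr_ge0.
  by apply/eqP => /esym /Normc.eq0_normc /eqP; rewrite (negbTE a0).
rewrite -ler_pdivlMl// -Normc.normcV.
by rewrite -[in leLHS](scale1r F) -(mulVf a0) -scalerA opnormZ_le.
Qed.

Lemma norm_BL_eq0 F : norm_BL F = 0 -> F = 0.
Proof. by move=> /(congr1 (@complex.Re R)) /= /opnorm_eq0. Qed.

HB.instance Definition _ :=
  Lmodule_isNormed.Build C BL norm_BLD norm_BLZ norm_BL_eq0.

Lemma BL_comp_subproof (F G : BL) : (F \o G : V -> V) \in bounded_op.
Proof.
have [M M0 FM] := bounded_opP (valP F); have [N N0 GN] := bounded_opP (valP G).
apply/mem_set; split.
  by move=> a x y /=; rewrite (BL_linear G) (BL_linear F).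
exists (M * N)%:C => x; rewrite !rnE -rmorphM lecR /=.
by apply: le_trans (FM _) _; rewrite -mulrA ler_wpM2l.
Qed.
Definition BL_comp (F G : BL) : BL := MkBL (BL_comp_subproof F G).

Definition finite_dim (A : set V) : Prop :=
  exists (n : nat) (e : 'I_n -> V), forall x, A x ->
    exists c : 'I_n -> C, x = \sum_(i < n) c i *: e i.

(* The quotient of V by the subspace A is finite-dimensional: A + W = V for some
   W lying in a finite-dimensional subspace. *)
Definition finite_codim (A : set V) : Prop :=
  exists2 W : set V, finite_dim W &
    forall y, exists2 x, A x & W (y - x).

Definition fredholm (F : BL) : Prop :=
  [/\ finite_dim [set x | F x = 0], closed (range F) & finite_codim (range F)].

End BoundedOperators.

Section ToeplitzAlgebra.
Variable R : realType.

Definition is_adjoint (S S' : BL (H2 R)) : Prop :=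
  forall f g : H2 R, inner (S f) g = inner f (S' g).

(* Every bounded operator has a unique adjoint, hence quantifying over the
   adjoints S' of S is the same as talking about the adjoint of S. *)
Definition cstar_subalgebra (A : set (BL (H2 R))) : Prop :=
  [/\ A 0 /\ (forall (a : R[i]) S S', A S -> A S' -> A (a *: S + S')),
      forall S S', A S -> A S' -> A (BL_comp S S'),
      forall S S', A S -> is_adjoint S S' -> A S' &
      closed A].

Definition toeplitz_algebra : set (BL (H2 R)) :=
  smallest cstar_subalgebra
    [set S : BL (H2 R) | exists2 f : Linf R, QC f & forall g, S g = toeplitz f g].

Definition toeplitz_fredholm : set (BL (H2 R)) :=
  [set S | toeplitz_algebra S /\ fredholm S].
End ToeplitzAlgebra.

Arguments Lp : clear implicits.
Arguments Hp : clear implicits.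
Arguments CT : clear implicits.
Arguments H_plus_C : clear implicits.
Arguments QC : clear implicits.
Arguments QC_invertible : clear implicits.
Arguments toeplitz_algebra : clear implicits.
Arguments toeplitz_fredholm : clear implicits.

(* Main.v *)
(* Let k_n be the normalised Szego kernel at the point 1 - 2^-n of the disc.
   For f in QC the vector k_n is asymptotically an eigenvector of both T_f and
   its adjoint, because functions of H^oo have k_n as an eigenvector of the
   adjoint, and continuous functions are nearly constant where k_n lives. This
   property defines a C*-algebra of operators, so it holds on the whole
   Toeplitz algebra. As k_n and k_(n+1) are not almost orthogonal, the diagonal
   values <S k_n, k_n> vary slowly with n, and they stay away from 0 if S is
   Fredholm, or if S is the multiplication by an invertible element of QC.
   The argument of <S k_n, k_n> is then defined with steps tending to 0, up to
   a bounded function, and its class modulo bounded functions is locally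
   constant in S, hence constant along paths.

   Let F = sum_k phi_(2^k) / (k + 1) with phi_A(z) = 1 / (1 + A (1 - z)). The
   imaginary part of F is continuous on the circle whereas F is unbounded. For
   real al, g_al = exp (i al F) is in H^oo with inverse g_(-al), and its
   conjugate differs from g_(-al) by a continuous function, so that g_al is
   in QC. As <g_al k_n, k_n> = exp (i al F(1 - 2^-n)) with F(1 - 2^-n) tending to
   infinity by steps at most 1, distinct al in ]0, 1[ give symbols, and
   Toeplitz operators, in distinct path components. *)
Require Import Defs.
From HB Require Import structures.
From mathcomp Require Import all_boot all_order all_algebra.
From mathcomp Require Import complex.
From mathcomp Require Import all_classical all_reals all_analysis.
From mathcomp Require Import measurable_realfun ess_sup_inf homotopy.
From mathcomp Require Import ring lra.

Set Implicit Arguments.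
Unset Strict Implicit.
Unset Printing Implicit Defensive.

Import Order.TTheory GRing.Theory Num.Theory.
Import numFieldNormedType.Exports.

Local Open Scope classical_set_scope.
Local Open Scope ring_scope.
Local Open Scope complex_scope.

(** The Fredholm index and the winding number take countably many values, so they cannot separate
    uncountably many components; the growth of an argument, known only up to bounded functions,
    does. Working modulo bounded functions is what makes the relation stable: the quotient of two
    close sequences staying away from 0 remains in a half-plane, so its turn is an arctangent, and
    bounds add up under composition.

    The coefficients 1 / (k + 1) are a compromise. They tend to 0, so the tails of the imaginary
    part, controlled by a telescoping sum, are uniformly small; their sum diverges, so the real part
    is unbounded. The radii 1 - 2^-n match the poles of the phi_(2^k), at distance 2^-k from 1:
    about n terms are of order 1 at the n-th point, and one more at each step. Two parameters in ]0,
    1[ differ by less than 1, so the turn between consecutive points stays below 2 pi and no full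
    turn goes unseen.

    Functions live on the circle only: values in the disc are integrals against kernels, and
    exponentials are limits of the powers (1 + f / n)^n. *)

Local Notation nc := Normc.normc.
Local Notation mu := (@circle_measure _).
Local Notation I f := (cintegral (L0_fun f)).
Local Arguments cintegral : simpl never.

(** * Complex measurable functions modulo null sets *)

Section Modulus.
Variable R : realType.
Implicit Types z w : R[i].

Lemma nc_ge0 z : 0 <= nc z.
Proof. by case: z => a b; exact: sqrtr_ge0. Qed.

Lemma ncD z w : nc (z + w) <= nc z + nc w.
Proof. exact: le_normcD. Qed.

Lemma ncN z : nc (- z) = nc z. Proof. exact: (@normcN R z). Qed.

Lemma ncB z w : nc (z - w) <= nc z + nc w.
Proof. by rewrite -(ncN w); exact: ncD. Qed.

Lemma nc_distC z w : nc (z - w) = nc (w - z).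
Proof. by rewrite -ncN opprB. Qed.

Lemma nc_real (a : R) : nc a%:C = `|a|.
Proof. by rewrite /= expr0n addr0 sqrtr_sqr. Qed.

Lemma ncJ z : nc z^* = nc z.
Proof. by case: z => a b /=; rewrite sqrrN. Qed.

Lemma nc_eq0 z : (nc z == 0) = (z == 0).
Proof.
by apply/eqP/eqP => [/Normc.eq0_normc//|->]; rewrite Normc.normc0.
Qed.

Lemma ncX z n : nc (z ^+ n) = nc z ^+ n.
Proof.
elim: n => [|n ih]; first by rewrite !expr0 Normc.normc1.
by rewrite !exprS Normc.normcM ih.
Qed.

Lemma mulcJ z : z * conjc z = (nc z ^+ 2)%:C.
Proof.
case: z => a b; rewrite [nc _]/= sqr_sqrtr ?addr_ge0 ?sqr_ge0//.
by apply/eqP; rewrite eq_complex /=; apply/andP; split; apply/eqP; ring.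
Qed.

Lemma Re_le_nc z : `|complex.Re z| <= nc z.
Proof. exact: (@Re_le_cabs R (fun=> z) 0). Qed.

Lemma Im_le_nc z : `|complex.Im z| <= nc z.
Proof. exact: (@Im_le_cabs R (fun=> z) 0). Qed.

Lemma nc_leD z : nc z <= `|complex.Re z| + `|complex.Im z|.
Proof.
rewrite -(@ger0_norm _ (_ + _)) ?addr_ge0// -sqrtr_sqr; case: z => a b /=.
rewrite ler_sqrt ?sqr_ge0// sqrrD !real_normK ?num_real//.
by rewrite lerD2r lerDl mulrn_wge0// mulr_ge0.
Qed.

Lemma nc_sqr z : nc z ^+ 2 = complex.Re z ^+ 2 + complex.Im z ^+ 2.
Proof. by case: z => a b /=; rewrite sqr_sqrtr// addr_ge0 ?sqr_ge0. Qed.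

Lemma ReZ (a : R) z : complex.Re (a%:C * z) = a * complex.Re z.
Proof. by case: z => b c /=; rewrite mul0r subr0. Qed.

Lemma ReD z w : complex.Re (z + w) = complex.Re z + complex.Re w.
Proof. by case: z; case: w. Qed.

Lemma ImD z w : complex.Im (z + w) = complex.Im z + complex.Im w.
Proof. by case: z; case: w. Qed.

Lemma nc_lip z w : `|nc z - nc w| <= nc (z - w).
Proof.
have := ncD (w - z) z; have := ncD (z - w) w.
by rewrite !subrK (nc_distC w) ler_norml; lra.
Qed.
End Modulus.

Section L0Algebra.
Variable R : realType.
Implicit Types f g : L0 R.

Lemma cmfunM (f g : measurableTypeR R -> R[i]) :
  cmeasurable_fun f -> cmeasurable_fun g -> cmeasurable_fun (fun t => f t * g t).
Proof.
move=> /cmfunP fP /cmfunP gP; apply/cmfunP; exact: (rpredM fP gP).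
Qed.

Lemma scaleL0_mul (a : R[i]) f g : a *: (f * g) = (a *: f) * g :> L0 R.
Proof. by rewrite -![_ *: _]/(cstL0 a * _) mulrA. Qed.
HB.instance Definition _ :=
  GRing.Lmodule_isLalgebra.Build R[i] (L0 R) scaleL0_mul.
Lemma scaleL0_mulr (a : R[i]) f g : a *: (f * g) = f * (a *: g) :> L0 R.
Proof. by rewrite mulrC scaleL0_mul mulrC. Qed.
HB.instance Definition _ :=
  GRing.Lalgebra_isAlgebra.Build R[i] (L0 R) scaleL0_mulr.

Lemma cstL0A (a : R[i]) : cstL0 a = a%:A :> L0 R.
Proof. by rewrite -[RHS]/(cstL0 a * 1) mulr1. Qed.

Lemma L0_algE (a : R[i]) : {ae mu, forall t, (a%:A : L0 R) t = a}.
Proof. by rewrite -cstL0A; exact: cstL0E. Qed.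

Lemma L0_NE f : {ae mu, forall t, (- f : L0 R) t = - f t}.
Proof.
rewrite -scaleN1r; apply: filterS (L0_ZE (-1) f) => t ->; exact: mulN1r.
Qed.

Lemma L0_BE f g : {ae mu, forall t, (f - g : L0 R) t = f t - g t}.
Proof. by apply: filterS2 (L0_DE f (- g)) (L0_NE g) => t -> ->. Qed.

Lemma conjL0E f : {ae mu, forall t, conjL0 f t = (f t)^*}.
Proof. exact: mkL0E. Qed.

Lemma conjL0_is_additive : zmod_morphism (@conjL0 R).
Proof.
move=> f g; apply/L0P; apply: filterS3 (conjL0E (f - g)) (L0_BE f g)
  (filterI (L0_BE (conjL0 f) (conjL0 g)) (filterI (conjL0E f) (conjL0E g))).
by move=> t -> -> [-> [-> ->]]; rewrite rmorphB.
Qed.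
HB.instance Definition _ :=
  GRing.isZmodMorphism.Build (L0 R) (L0 R) (@conjL0 R) conjL0_is_additive.

Lemma conjL0_is_multiplicative : monoid_morphism (@conjL0 R).
Proof.
split.
  apply/L0P; apply: filterS2 (conjL0E 1) (L0_1E R) => t -> e.
  by rewrite e conjc1.
move=> f g; apply/L0P; apply: filterS3 (conjL0E (f * g)) (L0_ME f g)
  (filterI (L0_ME (conjL0 f) (conjL0 g)) (filterI (conjL0E f) (conjL0E g))).
by move=> t -> -> [-> [-> ->]]; rewrite rmorphM.
Qed.
HB.instance Definition _ :=
  GRing.isMonoidMorphism.Build (L0 R) (L0 R) (@conjL0 R) conjL0_is_multiplicative.

Lemma conjL0K : involutive (@conjL0 R).
Proof.
move=> f; apply/L0P; apply: filterS2 (conjL0E (conjL0 f)) (conjL0E f) => t -> ->.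
exact: conjcK.
Qed.

Lemma conjL0Z (a : R[i]) f : conjL0 (a *: f) = conjc a *: conjL0 f.
Proof.
apply/L0P; apply: filterS3 (conjL0E (a *: f)) (L0_ZE a f)
  (filterI (L0_ZE (conjc a) (conjL0 f)) (conjL0E f)).
by move=> t -> -> [-> ->]; rewrite rmorphM.
Qed.
End L0Algebra.

Section Integral.
Variable R : realType.
Local Notation T := (measurableTypeR R).
Implicit Types (f g : L0 R) (u v : T -> R[i]).

Lemma cintegrableP u : cmeasurable_fun u ->
  cintegrable u <-> mu.-integrable setT (EFin \o cabs u).
Proof.
move=> mu_; have mc := measurable_cabs mu_; case: (mu_) => mr mi; split.
  move=> [ir ii].
  have ir' := integrable_norm ir; have ii' := integrable_norm ii.
  apply: (le_integrable measurableT _ _ (integrableD measurableT ir' ii')).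
    exact/measurable_EFinP.
  move=> t _ /=; rewrite lee_fin ger0_norm ?cabs_ge0// ger0_norm ?addr_ge0//.
  exact: nc_leD.
move=> ic; split; (apply: (le_integrable measurableT _ _ ic); first exact/measurable_EFinP);
  move=> t _ /=; rewrite lee_fin (ger0_norm (cabs_ge0 _ _)).
- exact: Re_le_cabs.
- exact: Im_le_cabs.
Qed.

Lemma cintegral_ae u v : cmeasurable_fun u -> cmeasurable_fun v ->
  {ae mu, forall t, u t = v t} -> cintegral u = cintegral v.
Proof.
move=> [ur ui] [vr vi] uv; congr Complex; apply: Rintegral_ae_eq => //;
  by apply: filterS uv => t ->.
Qed.

Lemma cintegralZ (a : R[i]) u : cintegrable u -> cmeasurable_fun u ->
  cintegral (fun t => a * u t) = a * cintegral u.
Proof.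
move=> iu mu_; have i0 : cintegrable (cst 0 : T -> R[i]).
  by split; apply: (finite_measure_integrable_cst _ 0).
rewrite (cintegral_linear (a := a) iu i0).
- rewrite /cintegral /= Rintegral_cst//= mul0r.
  by rewrite -[Complex 0 0]/(0 : R[i]) addr0.
- by apply: cmfunM => //; split; exact: measurable_cst.
- by apply: aeW => t; rewrite addr0.
Qed.

(* The modulus of the integral is the real part of a rotated integral. *)
Lemma nc_cintegral_le u : cintegrable u -> cmeasurable_fun u ->
  nc (cintegral u) <= \int[mu]_t cabs u t.
Proof.
move=> iu mu_; set z := cintegral u.
have [->|z0] := eqVneq z 0.
  by rewrite Normc.normc0 Rintegral_ge0// => t _; exact: cabs_ge0.
pose c : R[i] := ((nc z)^-1)%:C * conjc z.
have nz0 : nc z != 0 by rewrite nc_eq0.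
have cE : c * z = (nc z)%:C.
  by rewrite /c -mulrA [conjc z * z]mulrC mulcJ -rmorphM/= expr2 mulrA mulVf// mul1r.
have nc1 : nc c = 1.
  by rewrite /c Normc.normcM nc_real ncJ ger0_norm ?invr_ge0 ?nc_ge0// mulVf.
have mcu : cmeasurable_fun (fun t => c * u t).
  by apply: cmfunM => //; split; exact: measurable_cst.
have ccu t : cabs (fun t => c * u t) t = cabs u t.
  by rewrite /cabs Normc.normcM nc1 mul1r.
have /cintegrableP ic := iu; have {}ic := ic mu_.
have icu : cintegrable (fun t => c * u t).
  apply/cintegrableP => //; rewrite (_ : cabs _ = cabs u)//; exact/funext.
have -> : nc z = complex.Re (cintegral (fun t => c * u t)).
  by rewrite cintegralZ// -/z cE.
rewrite /cintegral/=; apply: le_Rintegral => //; first by case: icu.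
by move=> t _; apply: le_trans (ler_norm _) _; rewrite -ccu; exact: Re_le_cabs.
Qed.

Lemma Lp1P f : Lp R 1%E f <-> mu.-integrable setT (EFin \o cabs f).
Proof.
have mf := measurable_cabs (L0_meas f).
rewrite /Lp/= /Lpnorm Lnorm1; split => [h|/integrableP[]//].
by apply/integrableP; split => //; exact/measurable_EFinP.
Qed.

Lemma Lp1_cintegrable f : Lp R 1%E f <-> cintegrable f.
Proof.
by rewrite Lp1P; split => /cintegrableP; apply; exact: L0_meas.
Qed.

Lemma I_lin (a : R[i]) f g : Lp R 1%E f -> Lp R 1%E g ->
  I (a *: f + g) = a * I f + I g.
Proof.
move=> /Lp1_cintegrable fi /Lp1_cintegrable gi; apply: cintegral_linear => //.
  exact: L0_meas.
by apply: filterS2 (L0_DE (a *: f) g) (L0_ZE a f) => t -> ->.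
Qed.

Lemma Lp_0 p : (1 <= p)%E -> Lp R p 0.
Proof. by move=> p1; rewrite /Lp/= Lpnorm0. Qed.

Lemma I0 : I (0 : L0 R) = 0.
Proof.
have h := Lp_0 (lexx 1%E); have := I_lin 1 h h.
by rewrite scale1r addr0 mul1r => /esym/eqP; rewrite -subr_eq0 addrK => /eqP.
Qed.

Lemma IZ (a : R[i]) f : Lp R 1%E f -> I (a *: f) = a * I f.
Proof. by move=> h; rewrite -[a *: f]addr0 I_lin ?I0 ?addr0//; exact: Lp_0. Qed.

Lemma ID f g : Lp R 1%E f -> Lp R 1%E g -> I (f + g) = I f + I g.
Proof. by move=> hf hg; rewrite -[f in LHS]scale1r I_lin// mul1r. Qed.

Lemma Lp_lin p (a : R[i]) f g : (1 <= p)%E -> Lp R p f -> Lp R p g ->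
  Lp R p (a *: f + g).
Proof.
move=> p1 hf hg; have [_ H] := @inLp_submod R p p1.
by apply: set_mem (H a f g _ _); exact/mem_set.
Qed.

Lemma Lp_D p f g : (1 <= p)%E -> Lp R p f -> Lp R p g -> Lp R p (f + g).
Proof. by move=> p1 hf hg; rewrite -[f]scale1r; exact: Lp_lin. Qed.

Lemma Lp_Z p (a : R[i]) f : (1 <= p)%E -> Lp R p f -> Lp R p (a *: f).
Proof.
by move=> p1 hf; rewrite -[_ *: _]addr0; apply: Lp_lin => //; exact: Lp_0.
Qed.

Lemma Lp_N p f : (1 <= p)%E -> Lp R p f -> Lp R p (- f).
Proof. by move=> p1 hf; rewrite -scaleN1r; exact: Lp_Z. Qed.

Lemma Lp_B p f g : (1 <= p)%E -> Lp R p f -> Lp R p g -> Lp R p (f - g).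
Proof. by move=> p1 hf hg; apply: Lp_D => //; exact: Lp_N. Qed.

Lemma IN f : Lp R 1%E f -> I (- f) = - I f.
Proof. by move=> h; rewrite -scaleN1r IZ// mulN1r. Qed.

Lemma IB f g : Lp R 1%E f -> Lp R 1%E g -> I (f - g) = I f - I g.
Proof. by move=> hf hg; rewrite ID ?IN//; exact: Lp_N. Qed.

Lemma le_Lp p f g : (1 <= p)%E -> {ae mu, forall t, nc (f t) <= nc (g t)} ->
  (Lpnorm p f <= Lpnorm p g)%E.
Proof.
move=> p1 fg; apply: le_ae_Lnorm => //; [exact: measurable_cabs (L0_meas _)..|].
by apply: filterS fg => t; rewrite !ger0_norm// cabs_ge0.
Qed.

Lemma Lp_le p f g : (1 <= p)%E -> {ae mu, forall t, nc (f t) <= nc (g t)} ->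
  Lp R p g -> Lp R p f.
Proof. by move=> p1 fg; apply: le_lt_trans; exact: le_Lp. Qed.

Lemma Lp_conj p f : (1 <= p)%E -> Lp R p f -> Lp R p (conjL0 f).
Proof.
by move=> p1; apply: Lp_le => //; apply: filterS (conjL0E f) => t ->; rewrite ncJ.
Qed.

Lemma LooE f : Lpnorm +oo f = ess_sup mu (abse \o (EFin \o cabs f)).
Proof. by rewrite /Lpnorm unlock circle_measureT_gt0. Qed.

Lemma Loo_le f : Lp R +oo%E f ->
  {ae mu, forall t, nc (f t) <= fine (Lpnorm +oo f)}.
Proof.
move=> foo; have ff : (fine (Lpnorm +oo f))%:E = Lpnorm +oo f.
  by rewrite fineK// ge0_fin_numE ?Lpnorm_ge0.
apply: filterS (ess_sup_ge mu (abse \o (EFin \o cabs f))) => t.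
by rewrite -LooE -ff /= lee_fin ger0_norm ?cabs_ge0.
Qed.

Lemma LooP f : Lp R +oo%E f <->
  exists2 M : R, 0 <= M & {ae mu, forall t, nc (f t) <= M}.
Proof.
split => [foo|[M M0 fM]].
  exists (fine (Lpnorm +oo f)); last exact: Loo_le.
  by rewrite fine_ge0// Lpnorm_ge0.
rewrite /Lp/= LooE; apply: (@le_lt_trans _ _ M%:E); last exact: ltry.
apply/ess_supP; apply: filterS fM => t; rewrite /= lee_fin ger0_norm//.
exact: cabs_ge0.
Qed.

Lemma Loo_Lp p f g : (1 <= p)%E -> Lp R +oo%E f -> Lp R p g -> Lp R p (f * g).
Proof.
move=> p1 /LooP[M M0 fM] gp; apply: Lp_le (Lp_Z M%:C p1 gp) => //.
apply: filterS3 fM (L0_ME f g) (L0_ZE M%:C g) => t fM -> ->.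
by rewrite !Normc.normcM nc_real ger0_norm// ler_wpM2r ?nc_ge0.
Qed.

Lemma Loo_alg (a : R[i]) : Lp R +oo%E (a%:A).
Proof.
by apply/LooP; exists (nc a); [exact: nc_ge0|apply: filterS (L0_algE a) => t ->].
Qed.

Lemma Loo1 : Lp R +oo%E 1.
Proof. by rewrite -(scale1r 1); exact: Loo_alg. Qed.

Lemma sub_Loo p f : (1 <= p)%E -> p != +oo%E -> Lp R +oo%E f -> Lp R p f.
Proof.
move=> p1 poo foo; rewrite -[f]mulr1; apply: Loo_Lp => //.
case: p p1 poo => // p p1 _; rewrite /Lp/= /Lpnorm.
apply: (@le_lt_trans _ _ (('N[mu]_p%:E[EFin \o (cst 1%R : T -> R)])%E)).
  apply: le_ae_Lnorm => //; first exact: measurable_cabs (L0_meas _).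
  apply: filterS (L0_1E R) => t t1 /=.
  by rewrite /cabs t1 Normc.normc1.
have : (cst 1%R : T -> R) \in Lfun mu p%:E.
  by apply: Lfun_cst; exact: fin_num_measure.
by rewrite inE => /andP[_]; rewrite inE.
Qed.
End Integral.

(** * Square integrable functions *)

Section Hilbert.
Variable R : realType.
Local Notation T := (measurableTypeR R).
Implicit Types (f g : L0 R).
Local Notation L2 := (Lp R 2%:E).
Local Notation L1 := (Lp R 1%E).
Local Notation Loo := (Lp R +oo%E).

Definition N2 f : R := fine (Lpnorm 2%:E f).

Lemma N2_ge0 f : 0 <= N2 f. Proof. by rewrite fine_ge0// Lpnorm_ge0. Qed.

Lemma N2K f : L2 f -> (N2 f)%:E = Lpnorm 2%:E f.
Proof. by move=> h; rewrite fineK// ge0_fin_numE ?Lpnorm_ge0. Qed.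

Lemma Lpnorm2_sqr f :
  (Lpnorm 2%:E f `^ 2 = \int[mu]_t (cabs f t ^+ 2)%:E)%E.
Proof.
rewrite /Lpnorm powR_Lnorm//; apply: eq_integral => t _ /=.
by rewrite ger0_norm ?cabs_ge0// -powR_mulrn ?cabs_ge0.
Qed.

Lemma L2P f : L2 f <-> mu.-integrable setT (EFin \o (fun t => cabs f t ^+ 2)).
Proof.
have mf := measurable_cabs (L0_meas f).
have i0 : (0 <= \int[mu]_t (cabs f t ^+ 2)%:E)%E.
  by apply: integral_ge0 => t _; rewrite lee_fin sqr_ge0.
have iE : (\int[mu]_t `|(cabs f t ^+ 2)%:E| = \int[mu]_t (cabs f t ^+ 2)%:E)%E.
  by apply: eq_integral => t _; rewrite gee0_abs// lee_fin sqr_ge0.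
split=> [h|/integrableP[_]].
  apply/integrableP; split; first exact/measurable_EFinP/measurable_funX.
  by rewrite iE -Lpnorm2_sqr; exact: poweR_lty.
rewrite iE -Lpnorm2_sqr => h; apply: (@lty_poweRy _ _ 2) => //.
Qed.

Lemma N2_sqr f : L2 f -> N2 f ^+ 2 = \int[mu]_t (cabs f t ^+ 2).
Proof.
move=> h; rewrite /Rintegral -Lpnorm2_sqr -N2K// poweR_EFin/=.
by rewrite -powR_mulrn// N2_ge0.
Qed.

Lemma L1_fine f : L1 f -> \int[mu]_t cabs f t = fine (Lpnorm 1 f).
Proof.
move=> h; rewrite /Lpnorm Lnorm1; congr fine; apply: eq_integral => t _ /=.
by rewrite ger0_norm ?cabs_ge0.
Qed.

Lemma nc_I_le f : L1 f -> nc (I f) <= \int[mu]_t cabs f t.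
Proof.
by move=> /Lp1_cintegrable h; apply: nc_cintegral_le => //; exact: L0_meas.
Qed.

Lemma Lpnorm_hoelder f g :
  (Lpnorm 1 (L0_fun (f * g)%R) <= Lpnorm 2%:E f * Lpnorm 2%:E g)%E.
Proof.
have mf := measurable_cabs (L0_meas f); have mg := measurable_cabs (L0_meas g).
have h2 : (2^-1 + 2^-1 = 1 :> R)%R by rewrite [RHS]splitr !div1r.
apply: le_trans (@hoelder _ _ _ mu _ _ 2 2 mf mg _ _ h2) => //.
apply: le_ae_Lnorm => //; first exact: measurable_cabs (L0_meas _).
  exact: measurable_funM.
by apply: filterS (L0_ME f g) => t fg; rewrite /cabs fg Normc.normcM.
Qed.

Lemma L2M f g : L2 f -> L2 g -> L1 (f * g).
Proof.
move=> hf hg; apply: le_lt_trans (Lpnorm_hoelder f g) _.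
by rewrite -(N2K hf) -(N2K hg) -EFinM ltry.
Qed.

Lemma L1norm_hoelder f g : L2 f -> L2 g ->
  \int[mu]_t cabs (L0_fun (f * g)) t <= N2 f * N2 g.
Proof.
move=> hf hg; rewrite L1_fine; last exact: L2M.
rewrite -lee_fin fineK; last by rewrite ge0_fin_numE ?Lpnorm_ge0//; exact: L2M.
by rewrite EFinM !N2K//; exact: Lpnorm_hoelder.
Qed.

Lemma cauchy_schwarz f g : L2 f -> L2 g -> nc (I (f * g)) <= N2 f * N2 g.
Proof.
move=> hf hg; apply: le_trans (L1norm_hoelder hf hg).
exact/nc_I_le/L2M.
Qed.

Let p2 : (1 <= 2%:E :> \bar R)%E := le12 R.

Lemma Loo_L2 f : Loo f -> L2 f. Proof. by move=> h; apply: sub_Loo. Qed.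

Lemma L2_L1 f : L2 f -> L1 f.
Proof. by move=> h; rewrite -[f]mulr1; apply: L2M => //; exact/Loo_L2/Loo1. Qed.

Lemma Loo_L1 f : Loo f -> L1 f. Proof. by move=> /Loo_L2/L2_L1. Qed.

Lemma N2D f g : L2 f -> L2 g -> N2 (f + g) <= N2 f + N2 g.
Proof.
move=> hf hg; rewrite -lee_fin EFinD !N2K//; last exact: Lp_D.
exact: LpnormD.
Qed.

Lemma N2Z (a : R[i]) f : L2 f -> N2 (a *: f) = nc a * N2 f.
Proof.
move=> hf; apply: EFin_inj; rewrite EFinM !N2K//; last exact: Lp_Z.
exact: LpnormZ.
Qed.

Lemma N2N f : L2 f -> N2 (- f) = N2 f.
Proof. by move=> hf; rewrite -scaleN1r N2Z// ncN Normc.normc1 mul1r. Qed.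

Lemma N2B f g : L2 f -> L2 g -> N2 (f - g) <= N2 f + N2 g.
Proof. by move=> hf hg; rewrite -(N2N hg); apply: N2D => //; exact: Lp_N. Qed.

Lemma N2_0 : N2 0 = 0. Proof. by rewrite /N2 Lpnorm0. Qed.

Lemma N2_eq0 f : L2 f -> N2 f = 0 -> f = 0.
Proof. by move=> hf f0; apply: (Lpnorm_eq0 p2); rewrite -N2K// f0. Qed.

Lemma N2_le f g : L2 g -> {ae mu, forall t, nc (f t) <= nc (g t)} -> N2 f <= N2 g.
Proof.
move=> hg fg; have hf := Lp_le p2 fg hg; rewrite -lee_fin !N2K//.
exact: le_Lp.
Qed.

Lemma N2_Loo (M : R) f g : L2 g -> {ae mu, forall t, nc (f t) <= M} ->
  N2 (f * g) <= M * N2 g.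
Proof.
move=> hg fM; have M0 : 0 <= M.
  (* The circle has positive measure, so a property true almost everywhere has a witness; this
     forces the bound to be nonnegative. *)
  have [t ft] := @filter_ex _ _ (ae_properfilter_algebraOfSetsType (circle_measureT_gt0 R)) _ fM.
  exact: le_trans (nc_ge0 _) ft.
have -> : M * N2 g = N2 (M%:C *: g) by rewrite N2Z// nc_real ger0_norm.
apply: N2_le; first exact: Lp_Z.
apply: filterS3 fM (L0_ME f g) (L0_ZE M%:C g) => t fM -> ->.
by rewrite !Normc.normcM nc_real ger0_norm// ler_wpM2r ?nc_ge0.
Qed.

Lemma innerE f g : inner f g = I (f * conjL0 g).
Proof.
apply: cintegral_ae.
- apply: cmfunM; first exact: L0_meas.
  by have /cmfunP := conj_cmfun g.
- exact: L0_meas.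
- by apply: filterS2 (L0_ME f (conjL0 g)) (conjL0E g) => t -> ->.
Qed.

Lemma L2_conj f : L2 f -> L2 (conjL0 f). Proof. exact: Lp_conj. Qed.

Lemma N2_conj f : L2 f -> N2 (conjL0 f) = N2 f.
Proof.
move=> hf; apply/eqP; rewrite eq_le; apply/andP; split; apply: N2_le => //.
- by apply: filterS (conjL0E f) => t ->; rewrite ncJ.
- exact: L2_conj.
- by apply: filterS (conjL0E f) => t ->; rewrite ncJ.
Qed.

Lemma inner_sqr f : L2 f -> I (f * conjL0 f) = (N2 f ^+ 2)%:C.
Proof.
move=> hf; rewrite N2_sqr//; have /L2P i2 := hf.
have m2 : measurable_fun setT (fun t => cabs f t ^+ 2).
  by apply: measurable_funX; exact: measurable_cabs (L0_meas _).
rewrite (@cintegral_ae _ _ (fun t => (cabs f t ^+ 2)%:C)).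
- by rewrite /cintegral/= Rintegral_cst//= mul0r.
- exact: L0_meas.
- by split => //; exact: measurable_cst.
- apply: filterS2 (L0_ME f (conjL0 f)) (conjL0E f) => t -> ->.
  exact: mulcJ.
Qed.

Lemma I_conj f : L1 f -> I (conjL0 f) = (I f)^*.
Proof.
move=> /Lp1_cintegrable[fr fi]; rewrite (@cintegral_ae _ _ (fun t => (f t)^*)); first last.
- exact: conjL0E.
- by have /cmfunP := conj_cmfun f.
- exact: L0_meas.
rewrite /cintegral /=; congr Complex.
  by apply: eq_Rintegral => t _; case: (f t).
rewrite -mulN1r -RintegralZl//.
by apply: eq_Rintegral => t _; rewrite mulN1r; case: (f t).
Qed.

Lemma L0_mk (a b : T -> R) : measurable_fun setT a -> measurable_fun setT b ->
  exists f, {ae mu, forall t, f t = Complex (a t) (b t)}.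
Proof.
move=> ma mb; have h : (fun t => Complex (a t) (b t)) \in @cmfun R.
  by apply/cmfunP; split.
by exists (mkL0 (CMFun h)); exact: mkL0E.
Qed.

(** Convergence in [R[i]] is expressed throughout by the real modulus of the difference tending to
    0, so that squeezing and limit comparison take place in [R]. *)
Lemma nc_cvg {S : Type} {FF : set_system S} {PF : Filter FF} (u : S -> R[i]) (l : R[i]) :
  (fun n => complex.Re (u n)) @ FF --> complex.Re l ->
  (fun n => complex.Im (u n)) @ FF --> complex.Im l ->
  (fun n => nc (u n - l)) @ FF --> (0 : R).
Proof.
move=> hr hi.
apply: (squeeze_cvgr (f := cst 0) (h := fun n =>
    `|complex.Re (u n) - complex.Re l| + `|complex.Im (u n) - complex.Im l|)).
- apply: nearW => n; rewrite nc_ge0/=; apply: le_trans (nc_leD _) _.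
  by rewrite ReB ImB.
- exact: cvg_cst.
- rewrite -[X in _ --> X]addr0; apply: cvgD.
    by rewrite -(normr0 R) -(subrr (complex.Re l)); apply: cvg_norm; apply: cvgB => //; exact: cvg_cst.
  by rewrite -(normr0 R) -(subrr (complex.Im l)); apply: cvg_norm; apply: cvgB => //; exact: cvg_cst.
Qed.

Lemma cvg_nc_Re {S : Type} {FF : set_system S} {PF : Filter FF} (u : S -> R[i]) (l : R[i]) :
  (fun n => nc (u n - l)) @ FF --> (0 : R) ->
  (fun n => complex.Re (u n)) @ FF --> complex.Re l.
Proof.
move=> /cvgr0Pnorm_le h; apply/cvgrPdist_le => e /h; apply: filterS => n.
rewrite ger0_norm ?nc_ge0// distrC -ReB; apply: le_trans; exact: Re_le_nc.
Qed.

Lemma cvg_nc_Im {S : Type} {FF : set_system S} {PF : Filter FF} (u : S -> R[i]) (l : R[i]) :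
  (fun n => nc (u n - l)) @ FF --> (0 : R) ->
  (fun n => complex.Im (u n)) @ FF --> complex.Im l.
Proof.
move=> /cvgr0Pnorm_le h; apply/cvgrPdist_le => e /h; apply: filterS => n.
rewrite ger0_norm ?nc_ge0// distrC -ImB; apply: le_trans; exact: Im_le_nc.
Qed.

Lemma cvg_nc_norm {S : Type} {FF : set_system S} {PF : Filter FF} (u : S -> R[i]) (l : R[i]) :
  (fun n => nc (u n - l)) @ FF --> (0 : R) ->
  (fun n => nc (u n)) @ FF --> nc l.
Proof.
move=> /cvgr0Pnorm_le h; apply/cvgrPdist_le => e /h; apply: filterS => n.
rewrite ger0_norm ?nc_ge0// distrC; apply: le_trans; exact: nc_lip.
Qed.

(** Multiplying by the indicator of the complement of a null set makes the sequences converge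
    everywhere, and a pointwise limit of measurable functions is measurable. *)
Lemma L0_lim (F : nat -> L0 R) :
  {ae mu, forall t, cvgn (fun n => complex.Re (F n t)) /\ cvgn (fun n => complex.Im (F n t))} ->
  exists f, {ae mu, forall t, (fun n => nc (F n t - f t)) @ \oo --> (0 : R)}.
Proof.
move=> [N [mN N0 sN]].
pose a n t := complex.Re (F n t) * \1_(~` N) t : R.
pose b n t := complex.Im (F n t) * \1_(~` N) t : R.
have m1 : measurable_fun setT (\1_(~` N) : T -> R).
  exact/measurable_indicP/measurableC.
have ma n : measurable_fun setT (a n) by apply: measurable_funM => //; case: (L0_meas (F n)).
have mb n : measurable_fun setT (b n) by apply: measurable_funM => //; case: (L0_meas (F n)).
have cab t : cvgn (a^~ t) /\ cvgn (b^~ t).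
  have [tN|tN] := pselect (N t).
    have z : \1_(~` N) t = 0 :> R by rewrite indicE memNset//; exact.
    by rewrite /a /b z; split; under eq_fun do rewrite mulr0; exact: is_cvg_cst.
  have z : \1_(~` N) t = 1 :> R by rewrite indicE mem_set.
  rewrite /a /b z; under eq_fun do rewrite mulr1.
  under [X in _ /\ cvgn X]eq_fun do rewrite mulr1.
  by apply: contrapT => h; apply: tN; exact: sN.
have [||f fE] := @L0_mk (fun t => limn (a^~ t)) (fun t => limn (b^~ t)).
- by apply: (measurable_fun_cvg ma) => t _; case: (cab t).
- by apply: (measurable_fun_cvg mb) => t _; case: (cab t).
have aN : {ae mu, forall t, ~ N t} by exists N; split => // t /= /contrapT.
exists f; apply: filterS2 fE aN => t -> tN.
have z : \1_(~` N) t = 1 :> R by rewrite indicE mem_set.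
have aE : a^~ t = (fun n => complex.Re (F n t)) by apply/funext => n; rewrite /a z mulr1.
have bE : b^~ t = (fun n => complex.Im (F n t)) by apply/funext => n; rewrite /b z mulr1.
have [ca cb] := cab t.
by apply: nc_cvg => /=; [rewrite -aE|rewrite -bE].
Qed.
End Hilbert.

(** * Limit theorems for almost everywhere convergence *)

Section Convergence.
Variable R : realType.
Local Notation T := (measurableTypeR R).
Implicit Types (f g : L0 R).
Local Notation L2 := (Lp R 2%:E).
Local Notation L1 := (Lp R 1%E).
Local Notation Loo := (Lp R +oo%E).
Let p2 : (1 <= 2%:E :> \bar R)%E := le12 R.

Definition ae_cvg (F : nat -> L0 R) f :=
  {ae mu, forall t, (fun n => nc (F n t - f t)) @ \oo --> (0 : R)}.

Lemma cvg_ext {S : Type} {FF : set_system S} {PF : Filter FF} (u v : S -> R) (l : R) :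
  (forall n, u n = v n) -> u @ FF --> l -> v @ FF --> l.
Proof. by move=> /funext ->. Qed.

Lemma ae_all (P : nat -> T -> Prop) : (forall n, {ae @circle_measure R, forall t, P n t}) ->
  {ae @circle_measure R, forall t, forall n, P n t}.
Proof. by move=> h; apply: ae_foralln. Qed.

Lemma bounded_cvg_le (F : nat -> L0 R) f (M : R) :
  (forall n, {ae mu, forall t, nc (F n t) <= M}) -> ae_cvg F f ->
  {ae mu, forall t, nc (f t) <= M}.
Proof.
move=> /ae_all FM; apply: filterS2 FM => t FM /cvg_nc_norm h.
have <- : limn (fun n => nc (F n t)) = nc (f t) by apply/cvg_lim.
apply: limr_le; first by apply/cvg_ex; exists (nc (f t)).
exact: nearW.
Qed.

(** Dominated convergence, with 2 M |G| as the dominating function. *)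
Lemma bounded_cvg (G : L0 R) (F : nat -> L0 R) f (M : R) : L1 G ->
  (forall n, {ae mu, forall t, nc (F n t) <= M}) -> ae_cvg F f ->
  (fun n => nc (I (G * F n) - I (G * f))) @ \oo --> (0 : R).
Proof.
move=> G1 FM Ff; have fM := bounded_cvg_le FM Ff.
have M0 : 0 <= M.
  have [t ft] := @filter_ex _ _ (ae_properfilter_algebraOfSetsType (circle_measureT_gt0 R)) _ fM.
  exact: le_trans (nc_ge0 _) ft.
have Foo n : Loo (F n) by apply/LooP; exists M.
have foo : Loo f by apply/LooP; exists M.
have GF n : L1 (G * F n) by rewrite mulrC; exact: Loo_Lp.
have Gf : L1 (G * f) by rewrite mulrC; exact: Loo_Lp.
pose d n := (fun t => (cabs (L0_fun (G * F n - G * f)) t)%:E) : T -> \bar R.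
have md n : measurable_fun setT (d n).
  by apply/measurable_EFinP; exact: measurable_cabs (L0_meas _).
have dE : {ae mu, forall t n, cabs (L0_fun (G * F n - G * f)) t = nc (G t) * nc (F n t - f t)}.
  apply: ae_all => n; rewrite -mulrBr.
  by apply: filterS2 (L0_ME G (F n - f)) (L0_BE (F n) f) => t; rewrite /cabs => -> ->; rewrite Normc.normcM.
have [|||||_ + _] := @dominated_convergence _ _ _ mu setT measurableT d (cst 0%E) (fun t => (2 * M * cabs G t)%:E).
- exact: md.
- exact: measurable_cst.
- apply: filterS2 dE Ff => t dE Ff _; rewrite /d; apply: cvg_EFin; first exact: nearW.
  apply: (cvg_ext (u := fun n => nc (G t) * nc (F n t - f t))) => [n|].
    by rewrite -dE.
  by rewrite -(mulr0 (nc (G t))); apply: cvgM => //; exact: cvg_cst.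
- exact: (integrableZl measurableT (2 * M) ((Lp1P G).1 G1)).
- apply: filterS3 dE (ae_all FM) fM => t dE FMt fMt n _.
  rewrite /d gee0_abs ?lee_fin ?cabs_ge0// dE mulrC ler_wpM2r ?nc_ge0//.
  by apply: le_trans (ncB _ _) _; rewrite mulr_natl mulr2n lerD.
move=> /fine_cvg h.
apply: (squeeze_cvgr (f := cst 0) (h := fun n => \int[mu]_t cabs (L0_fun (G * F n - G * f)) t)).
- apply: nearW => n; apply/andP; split; first exact: nc_ge0.
  by rewrite -IB//; apply: nc_I_le; exact: Lp_B.
- exact: cvg_cst.
- apply: cvg_trans h; apply: near_eq_cvg; apply: nearW => n /=; congr fine.
  by apply: eq_integral => t _; rewrite subr0 ger0_norm ?cabs_ge0.
Qed.

(** Fatou's lemma for the squared moduli. It turns a Cauchy estimate between terms of a sequence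
    into an estimate of the distance to its limit. *)
Lemma L2_fatou (F : nat -> L0 R) f (M : R) : 0 <= M ->
  (\forall n \near \oo, L2 (F n) /\ N2 (F n) <= M) -> ae_cvg F f ->
  L2 f /\ N2 f <= M.
Proof.
move=> M0 [n0 _ FM] Ff.
pose d n := (fun t => (cabs (F (n0 + n)%N) t ^+ 2)%:E) : T -> \bar R.
have md n : measurable_fun setT (d n).
  by apply/measurable_EFinP; apply: measurable_funX; exact: measurable_cabs (L0_meas _).
have dM n : (\int[mu]_t d n t <= (M ^+ 2)%:E)%E.
  have [F2 FnM] := FM (n0 + n)%N (leq_addr _ _).
  rewrite /d -Lpnorm2_sqr -N2K// poweR_EFin lee_fin -powR_mulrn//.
  by apply: ge0_ler_powR => //; rewrite nnegrE ?N2_ge0.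
have h : (\int[mu]_t (cabs f t ^+ 2)%:E <= (M ^+ 2)%:E)%E.
  apply: (@le_trans _ _ (limn_einf (fun n => \int[mu]_t d n t))%E); last first.
    rewrite limn_einf_lim; apply: lime_le; first exact: is_cvg_einfs.
    apply: nearW => n; apply: le_trans (dM n); apply: ereal_inf_lbound.
    by exists n => /=.
  apply: le_trans (fatou mu measurableT md _); last first.
    by move=> n t _; rewrite lee_fin sqr_ge0.
  apply: ae_ge0_le_integral => //.
  - by move=> t _; rewrite lee_fin sqr_ge0.
  - by apply/measurable_EFinP; apply: measurable_funX; exact: measurable_cabs (L0_meas _).
  - move=> t _; rewrite limn_einf_lim; apply: lime_ge; first exact: is_cvg_einfs.
    apply: nearW => n; apply: le_ereal_inf_tmp => _ [m /= nm <-].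
    by rewrite lee_fin sqr_ge0.
  - rewrite (_ : (fun x => _) = (fun x => - limn_esup (-%E \o d ^~ x)))%E//.
    apply: measurableT_comp => //; apply: (@measurable_fun_limn_esup _ _ _ setT (fun n x => - d n x)%E) => n.
    exact: measurableT_comp.
  - apply: filterS Ff => t /cvg_nc_norm Ft _.
    suff : d^~ t @ \oo --> (cabs f t ^+ 2)%:E by move/cvg_limn_einf_sup => [->].
    apply: cvg_EFin; first exact: nearW.
    have Ft' : (fun n => nc (F (n0 + n)%N t)) @ \oo --> nc (f t).
      rewrite -(cvg_shiftn n0) in Ft.
      by apply: cvg_ext Ft => n; rewrite addnC.
    exact: (cvgM Ft' Ft').
have f2 : L2 f.
  rewrite /Lp/=; apply: (@lty_poweRy _ _ 2) => //.
  by rewrite Lpnorm2_sqr; apply: le_lt_trans h _; exact: ltry.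
split=> //; move: h; rewrite -Lpnorm2_sqr -N2K// poweR_EFin lee_fin -powR_mulrn//.
move=> h; rewrite leNgt; apply/negP => MN; move: h; apply/negP; rewrite -ltNge.
by apply: gt0_ltr_powR => //; rewrite nnegrE ?N2_ge0.
Qed.
End Convergence.

(** * Completeness of L^2 *)

Section Completeness.
Variable R : realType.
Local Notation T := (measurableTypeR R).
Implicit Types (f g : L0 R).
Local Notation L2 := (Lp R 2%:E).
Local Notation L1 := (Lp R 1%E).
Local Notation Loo := (Lp R +oo%E).
Let p2 : (1 <= 2%:E :> \bar R)%E := le12 R.

Lemma summable_telescope_cvg (u D : R^nat) (S : R) :
  (forall n, `|u n.+1 - u n| <= D n) -> (forall n, \sum_(0 <= k < n) D k <= S) ->
  cvgn u.
Proof.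
move=> uD DS; have D0 n : 0 <= D n by exact: le_trans (uD n).
have cs : cvgn (series (fun n => u n.+1 - u n)).
  apply: normed_cvg; apply: (@series_le_cvg _ _ D) => [n|//|n|]; [exact: normr_ge0|exact: uD|].
  apply: nondecreasing_is_cvgn.
    by apply/nondecreasing_seqP => n; rewrite /series/= big_nat_recr//= lerDl.
  by exists S => _ [n _ <-]; exact: DS.
rewrite (_ : u = (fun n => series (fun n => u n.+1 - u n) n + u 0%N)).
  by apply: is_cvgD => //; exact: is_cvg_cst.
by apply/funext => n; rewrite /series/= telescope_sumr// subrK.
Qed.

(** The L^2 norm controls the L^1 norm on a finite measure, so the sum of the |u (n+1) - u n| has a
    finite integral. It is therefore finite almost everywhere, and there the telescoping series
    converges absolutely. *)
Lemma ae_cvg_summable (u : nat -> L0 R) :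
  (forall n, L2 (u n)) -> (forall n, N2 (u n.+1 - u n) <= 2^-1 ^+ n) ->
  exists f, ae_cvg u f.
Proof.
move=> u2 uN.
pose D n := (fun t => (cabs (L0_fun (u n.+1 - u n)) t)%:E) : T -> \bar R.
have D0 n t : (0 <= D n t)%E by rewrite lee_fin cabs_ge0.
have mD n : measurable_fun setT (D n).
  by apply/measurable_EFinP; exact: measurable_cabs (L0_meas _).
have dL2 n : L2 (u n.+1 - u n) by exact: Lp_B.
have dL1 n : L1 (u n.+1 - u n) by exact: L2_L1.
have L21 : L2 1 by exact/Loo_L2/Loo1.
have ID n : (\int[mu]_t D n t <= (N2 1 * 2^-1 ^+ n)%:E)%E.
  have -> : (\int[mu]_t D n t = (\int[mu]_t cabs (L0_fun (u n.+1 - u n)) t)%:E)%E.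
    rewrite /Rintegral fineK//; apply: integrable_fin_num => //.
    exact/Lp1P.
  rewrite lee_fin mulrC -[u n.+1 - u n]mulr1.
  apply: le_trans (L1norm_hoelder _ _) _ => //.
  by rewrite ler_wpM2r ?N2_ge0.
have sD : (\int[mu]_t \sum_(n <oo) D n t < +oo)%E.
  rewrite integral_nneseries//.
  apply: (@le_lt_trans _ _ (N2 1 * 2)%:E); last exact: ltry.
  apply: lime_le; first by apply: is_cvg_nneseries => n _ _; exact: integral_ge0.
  apply: nearW => n.
  apply: (@le_trans _ _ (\sum_(0 <= k < n) (N2 1 * 2^-1 ^+ k)%:E)%E).
    by apply: lee_sum => k _; exact: ID.
  rewrite sumEFin lee_fin -mulr_sumr ler_wpM2l ?N2_ge0//.
  have -> : \sum_(0 <= k < n) 2^-1 ^+ k = series (geometric 1 (2^-1 : R)) n.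
    by apply: eq_bigr => k _; rewrite -[LHS]mul1r.
  rewrite geometric_seriesE; last by rewrite lt_eqF// invf_lt1// ltr1n.
  have -> : 1 - 2^-1 = 2^-1 :> R by lra.
  by rewrite /= invrK mul1r ler_piMl// gerBl exprn_ge0.
have iS : mu.-integrable setT (fun t => \sum_(n <oo) D n t)%E.
  apply/integrableP; split.
    apply: (@ge0_emeasurable_sum _ _ _ setT D xpredT) => // n t _ _; exact: D0.
  by under eq_integral do rewrite gee0_abs ?nneseries_ge0//.
apply: L0_lim.
have aeD : {ae mu, forall t n, cabs (L0_fun (u n.+1 - u n)) t = nc (u n.+1 t - u n t)}.
  by apply: ae_all => n; apply: filterS (L0_BE (u n.+1) (u n)) => t; rewrite /cabs => ->.
apply: filterS2 aeD (integrable_ae measurableT iS) => t aeD /(_ Logic.I) fS.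
have bD n : \sum_(0 <= k < n) nc (u k.+1 t - u k t) <= fine (\sum_(n <oo) D n t)%E.
  rewrite -lee_fin fineK// -sumEFin; apply: le_trans (nneseries_lim_ge n _) => //.
  by apply: lee_sum => k _; rewrite /D aeD.
split.
  apply: (summable_telescope_cvg _ bD) => n.
  by rewrite -ReB; exact: Re_le_nc.
apply: (summable_telescope_cvg _ bD) => n.
by rewrite -ImB; exact: Im_le_nc.
Qed.

(** Riesz-Fischer: a rapidly converging subsequence has an almost everywhere limit, and [L2_fatou]
    along this subsequence bounds the distance from every late term to that limit. *)
Lemma L2_complete (u : nat -> L0 R) : (forall n, L2 (u n)) ->
  (forall e : R, 0 < e -> exists N, forall m n, (N <= m)%N -> (N <= n)%N ->
     N2 (u m - u n) <= e) ->
  exists2 f, L2 f & (fun n => N2 (u n - f)) @ \oo --> (0 : R).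
Proof.
move=> u2 uC.
have /choice[N NP] : forall k, exists N, forall m n, (N <= m)%N -> (N <= n)%N ->
    N2 (u m - u n) <= 2^-1 ^+ k by move=> k; apply: uC; rewrite exprn_gt0.
(* [K k] exceeds every [N j] with j <= k, which gives the summable steps, and also k itself, so that
   late indices k give late terms [u (K k)]. *)
pose K k := (k + \max_(j < k.+1) N j)%N.
have NK j k : (j <= k)%N -> (N j <= K k)%N.
  by move=> jk; rewrite -ltnS in jk; apply: leq_trans (leq_addl _ _); exact: (@leq_bigmax _ (fun i : 'I_k.+1 => N i) (Ordinal jk)).
have [|k|f uf] := @ae_cvg_summable (u \o K); first by move=> n; exact: u2.
  by apply: NP; exact: NK.
have key (e : R) n0 : 0 <= e -> (forall m n, (n0 <= m)%N -> (n0 <= n)%N -> N2 (u m - u n) <= e) ->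
    forall n, (n0 <= n)%N -> L2 (u n - f) /\ N2 (u n - f) <= e.
  move=> e0 ue n nn; apply: (@L2_fatou _ (fun k => u n - u (K k))) => //.
    exists n0 => // k /= n0k; split; first exact: Lp_B.
    by apply: ue => //; apply: leq_trans n0k _; exact: leq_addr.
  apply: filterS3 (ae_all (fun k => L0_BE (u n) (u (K k)))) (L0_BE (u n) f) uf.
  move=> t unk unf; apply: cvg_ext => k.
  rewrite unk unf /= nc_distC; congr nc; by ring.
have f2 : L2 f.
  have [N0 NN] := uC 1 ltr01; have [h _] := key _ _ ler01 NN N0 (leqnn _).
  by rewrite -(subKr (u N0) f); apply: Lp_B.
exists f => //; apply/cvgr0Pnorm_le => e e0; have [N0 NN] := uC e e0.
exists N0 => // n /= nn; rewrite ger0_norm ?N2_ge0//.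
by have [] := key _ _ (ltW e0) NN n nn.
Qed.
End Completeness.

(** * Fourier coefficients *)

Section Fourier.
Variable R : realType.
Local Notation T := (measurableTypeR R).
Implicit Types (f g : L0 R).
Local Notation L2 := (Lp R 2%:E).
Local Notation L1 := (Lp R 1%E).
Local Notation Loo := (Lp R +oo%E).
Let p2 : (1 <= 2%:E :> \bar R)%E := le12 R.

Lemma ae_circle (P : T -> Prop) : (forall t, 0 <= t <= 2 * pi -> P t) ->
  {ae @circle_measure R, forall t, P t}.
Proof.
move=> h; exists (~` `[0, 2 * pi]); split.
- exact: measurableC.
- by rewrite /circle_measure /mrestr setICl measure0.
- by move=> t /= nP; apply: contra_not nP => /=; rewrite in_itv/=; exact: h.
Qed.

Lemma circle_set1 (x : R) : {ae @circle_measure R, forall t : T, t <> x}.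
Proof.
exists [set x]; split => //; last by move=> t /= /contrapT.
rewrite /circle_measure /mrestr; apply/eqP; rewrite -measure_le0.
rewrite -(@lebesgue_measure_set1 R x); apply: le_measure; rewrite ?inE//.
exact: measurableI.
Qed.

Lemma circle_FTC (f F : R -> R) : continuous f -> (forall x : R, is_derive x (1 : R) F (f x)) ->
  \int[mu]_t (f t : R) = F (2 * pi) - F 0.
Proof.
move=> cf dF; have pi2 : 0 < 2 * pi :> R by rewrite mulr_gt0 ?pi_gt0.
have mf : measurable_fun setT (f : T -> R) by exact: continuous_measurable_fun.
have dDF x : derivable F x 1 by case: (dF x).
have mD : measurable (`[0, 2 * pi]%classic : set T) by exact: measurable_itv.
rewrite /Rintegral.
have -> : (\int[@circle_measure R]_t (f t)%:E = \int[mu]_(t in `[0%R, (2 * pi)%R]) (f t)%:E)%E.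
  rewrite [RHS]integral_mkcond; apply: ae_eq_integral => //.
  - exact/measurable_EFinP.
  - apply: (measurable_restrictT (EFin \o (f : T -> R)) mD).1.
    by apply: (measurable_funS measurableT) => //; exact/measurable_EFinP.
  - have h := @ae_circle (fun t => (f t)%:E = ((fun t => (f t)%:E) \_ `[0, 2 * pi]) t).
    apply: filterS (h _) => // t t01; rewrite patchE mem_set//=.
have -> : (\int[@circle_measure R]_(t in `[0%R, (2 * pi)%R]) (f t)%:E =
    \int[lebesgue_measure]_(t in `[0%R, (2 * pi)%R]) (f t)%:E)%E.
  apply: eq_measure_integral => A mA AD.
  by rewrite /= /circle_measure /mrestr /= setIidl.
rewrite (continuous_FTC2 (F := F))//.
- exact: continuous_subspaceT.
- split => //.
  + by apply: cvg_at_right_filter; apply: differentiable_continuous; exact/derivable1_diffP.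
  + by apply: cvg_at_left_filter; apply: differentiable_continuous; exact/derivable1_diffP.
- by move=> x _; rewrite derive1E; apply: derive_val.
Qed.

Lemma chi_in n : (chi n : T -> R[i]) \in @cmfun R.
Proof. by apply/cmfunP; exact: chi_meas. Qed.
Definition chiL n : L0 R := mkL0 (CMFun (chi_in n)).
Lemma chiLE n : {ae mu, forall t, chiL n t = chi n t}.
Proof. exact: mkL0E. Qed.

Lemma chiD m n (t : R) : chi (m + n) t = chi m t * chi n t.
Proof.
rewrite /chi intrD mulrDl cosD sinD; apply/eqP; rewrite eq_complex/=.
by rewrite eqxx addrC [X in X + _]mulrC eqxx.
Qed.

Lemma chiN n (t : R) : chi (- n) t = (chi n t)^*.
Proof. by rewrite /chi /= mulrNz mulNr cosN sinN. Qed.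

Lemma nc_chi n (t : R) : nc (chi n t) = 1.
Proof. exact: (@cabs_chi R n t). Qed.

Lemma chi0 (t : R) : chi 0 t = 1.
Proof. by rewrite /chi mul0r cos0 sin0. Qed.

Lemma chiL0 : chiL 0 = 1.
Proof.
by apply/L0P; apply: filterS2 (chiLE 0) (L0_1E R) => t -> ->; rewrite chi0.
Qed.

Lemma chiLD m n : chiL (m + n) = chiL m * chiL n.
Proof.
apply/L0P; apply: filterS3 (chiLE (m + n)) (L0_ME (chiL m) (chiL n))
  (filterI (chiLE m) (chiLE n)).
by move=> t -> -> [-> ->]; rewrite chiD.
Qed.

Lemma chiLJ n : conjL0 (chiL n) = chiL (- n).
Proof.
apply/L0P; apply: filterS3 (conjL0E (chiL n)) (chiLE n) (chiLE (- n)).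
by move=> t -> -> ->; rewrite chiN.
Qed.

Lemma chiL_Loo n : Loo (chiL n).
Proof. by apply/LooP; exists 1 => //; apply: filterS (chiLE n) => t ->; rewrite nc_chi. Qed.

Lemma I1 : I (1 : L0 R) = (2 * pi)%:C.
Proof.
rewrite (@cintegral_ae _ _ (cst 1)); [|exact: L0_meas|by split; exact: measurable_cst|exact: L0_1E].
rewrite /cintegral (@circle_FTC (cst 1) id)//; last by move=> x; exact: cvg_cst.
by rewrite (@circle_FTC (cst 0) (cst 0))//; [rewrite subrr subr0|by move=> x; exact: cvg_cst].
Qed.

Lemma cosM2pi (n : int) : cos (n%:~R * (2 * pi)) = 1 :> R.
Proof.
have hn (k : nat) : cos (k%:R * (2 * pi)) = 1 :> R.
  have -> : k%:R * (2 * pi) = 0 + (pi *+ 2) *+ k :> R by rewrite add0r -[RHS]mulr_natl -[pi *+ 2]mulr_natl.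
  by rewrite (periodicn (@cosD2pi R)) cos0.
case: n => k; first exact: hn.
by rewrite NegzE mulrNz mulNr cosN; exact: hn.
Qed.

Lemma sinM2pi (n : int) : sin (n%:~R * (2 * pi)) = 0 :> R.
Proof.
have hn (k : nat) : sin (k%:R * (2 * pi)) = 0 :> R.
  have -> : k%:R * (2 * pi) = 0 + (pi *+ 2) *+ k :> R by rewrite add0r -[RHS]mulr_natl -[pi *+ 2]mulr_natl.
  by rewrite (periodicn (@sinD2pi R)) sin0.
case: n => k; first exact: hn.
by rewrite NegzE mulrNz mulNr sinN hn oppr0.
Qed.

Lemma I_chi n : n != 0 -> I (chiL n) = 0.
Proof.
move=> n0; have n0' : (n%:~R : R) != 0 by rewrite intr_eq0.
rewrite (@cintegral_ae _ _ (chi n)); [|exact: L0_meas|exact: chi_meas|exact: chiLE].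
rewrite /cintegral /chi /=.
have cM : continuous (fun t : R => n%:~R * t).
  by move=> x; apply: cvgM; [exact: cvg_cst|exact: cvg_id].
have dM (x : R) : is_derive x (1 : R) (fun t => n%:~R * t) n%:~R.
  have := is_deriveZ (f := id) (n%:~R : R) (is_derive_id x (1 : R)).
  by rewrite /GRing.scale/= mulr1.
have dS (x : R) : is_derive x (1 : R) (fun t => n%:~R^-1 * sin (n%:~R * t)) (cos (n%:~R * x)).
  have := is_deriveZ (f := sin \o (fun t => n%:~R * t)) (n%:~R^-1 : R)
    (is_derive1_comp (is_derive_sin _) (dM x)).
  by rewrite /GRing.scale/= mulrCA mulVf// mulr1.
have dC (x : R) : is_derive x (1 : R) (fun t => - n%:~R^-1 * cos (n%:~R * t)) (sin (n%:~R * x)).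
  have := is_deriveZ (f := cos \o (fun t => n%:~R * t)) (- n%:~R^-1 : R)
    (is_derive1_comp (is_derive_cos _) (dM x)).
  by move=> h; apply: is_derive_eq h _; rewrite /GRing.scale/=; field.
have -> := circle_FTC _ dS; last first.
  by move=> x; apply: continuous_comp; [exact: cM|exact: continuous_cos].
have -> := circle_FTC _ dC; last first.
  by move=> x; apply: continuous_comp; [exact: cM|exact: continuous_sin].
by rewrite cosM2pi sinM2pi !mulr0 cos0 sin0 subrr mulr0 subrr.
Qed.
End Fourier.

(** * The complex exponential as a limit of powers *)

Section ComplexExponential.
Variable R : realType.
Implicit Types z w : R[i].

Definition cexp z : R[i] :=
  (expR (complex.Re z))%:C * Complex (cos (complex.Im z)) (sin (complex.Im z)).

Lemma cexp0 : cexp 0 = 1.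
Proof. by rewrite /cexp /= expR0 cos0 sin0 mul1r. Qed.

Lemma cexpD z w : cexp (z + w) = cexp z * cexp w.
Proof.
rewrite /cexp ReD ImD expRD cosD sinD; apply/eqP; rewrite eq_complex/=.
by apply/andP; split; apply/eqP; ring.
Qed.

Lemma nc_cexp z : nc (cexp z) = expR (complex.Re z).
Proof.
rewrite /cexp Normc.normcM nc_real ger0_norm ?expR_ge0//=.
by rewrite cos2Dsin2 sqrtr1 mulr1.
Qed.

Lemma cexpJ z : (cexp z)^* = cexp z^*.
Proof.
rewrite /cexp; case: z => a b /=; rewrite cosN sinN.
by apply/eqP; rewrite eq_complex/= !mul0r !subr0 !addr0 mulrN eqxx /=.
Qed.

Lemma cexp_real (a : R) : cexp a%:C = (expR a)%:C.
Proof. by rewrite /cexp /= cos0 sin0 mulr1. Qed.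

Lemma cexpX z n : cexp z ^+ n = cexp (n%:R%:C * z).
Proof.
elim: n => [|n ih]; first by rewrite mul0r cexp0 expr0.
by rewrite exprS ih -cexpD -natr1 rmorphD mulrDl mul1r addrC.
Qed.

Lemma harmonic_nbhs0 : @harmonic R @ \oo --> (0 : R)^'.
Proof.
move=> A [e /= e0 eA]; have /cvgrPdist_lt/(_ e e0) := @cvg_harmonic R.
apply: filterS => n h; apply: eA => //=.
Qed.

(** The derivative at 0 of t |-> exp (t z), sampled along t = 1 / (n + 1); real and imaginary parts
    are differentiated separately. *)
Lemma cexp_deriv z :
  (fun n => nc (n.+1%:R%:C * (cexp (n.+1%:R^-1%:C * z) - 1) - z)) @ \oo --> (0 : R).
Proof.
case: z => x y.
have dm (c s : R) : is_derive s (1 : R) (fun t => t * c) c.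
  have := is_deriveM (is_derive_id s (1 : R)) (is_derive_cst c s (1 : R)).
  by rewrite /GRing.scale/= mulr0 add0r mulr1.
have h (f : R -> R) (d : R) : is_derive (0 : R) (1 : R) f d ->
    (fun n => n.+1%:R * (f n.+1%:R^-1 - f 0)) @ \oo --> d.
  move=> [df <-]; have := cvg_comp _ _ harmonic_nbhs0 df.
  apply: cvg_trans; apply: near_eq_cvg; apply: nearW => n /=.
  by rewrite invrK /GRing.scale/= mulr1 addr0.
have dE (s : R) : is_derive s (1 : R) (fun t => expR (t * x)) (expR (s * x) * x).
  exact: (is_derive1_comp (is_derive_expR _) (dm x s)).
have dC (s : R) : is_derive s (1 : R) (fun t => cos (t * y)) (- sin (s * y) * y).
  exact: (is_derive1_comp (is_derive_cos _) (dm y s)).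
have dS (s : R) : is_derive s (1 : R) (fun t => sin (t * y)) (cos (s * y) * y).
  exact: (is_derive1_comp (is_derive_sin _) (dm y s)).
have dr : is_derive (0 : R) (1 : R) (fun t => expR (t * x) * cos (t * y)) x.
  apply: is_derive_eq (is_deriveM (dE 0) (dC 0)) _.
  by rewrite /GRing.scale/= !mul0r expR0 cos0 sin0; ring.
have di : is_derive (0 : R) (1 : R) (fun t => expR (t * x) * sin (t * y)) y.
  apply: is_derive_eq (is_deriveM (dE 0) (dS 0)) _.
  by rewrite /GRing.scale/= !mul0r expR0 cos0 sin0; ring.
have hr := h _ _ dr; have hi := h _ _ di.
apply: nc_cvg.
  by apply: cvg_ext hr => n /=; rewrite !(mul0r, oppr0, addr0, subr0) expR0 cos0; ring.
by apply: cvg_ext hi => n /=; rewrite !(mul0r, oppr0, addr0, subr0) expR0 sin0; ring.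
Qed.

Lemma nc_expr_sub_le (a b : R[i]) (K : R) n : 1 <= K -> nc a <= K -> nc b <= K ->
  nc (a ^+ n - b ^+ n) <= n%:R * K ^+ n * nc (a - b).
Proof.
move=> K1 aK bK; elim: n => [|n ih].
  by rewrite !expr0 subrr Normc.normc0 mul0r mul0r.
have -> : a ^+ n.+1 - b ^+ n.+1 = a * (a ^+ n - b ^+ n) + (a - b) * b ^+ n.
  by rewrite !exprS; ring.
apply: le_trans (ncD _ _) _; rewrite !Normc.normcM ncX.
have K0 : 0 <= K by exact: le_trans K1.
have Kn : 0 <= K ^+ n by rewrite exprn_ge0.
have ab0 := nc_ge0 (a - b).
have h1 : nc a * nc (a ^+ n - b ^+ n) <= K * (n%:R * K ^+ n * nc (a - b)).
  by apply: ler_pM => //; exact: nc_ge0.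
have h2 : nc (a - b) * nc b ^+ n <= nc (a - b) * K ^+ n.+1.
  apply: ler_wpM2l => //; apply: (@le_trans _ _ (K ^+ n)).
    by apply: lerXn2r; rewrite ?nnegrE// nc_ge0.
  by rewrite exprS ler_peMl.
apply: le_trans (lerD h1 h2) _; rewrite exprS -natr1 le_eqVlt; apply/orP; left.
by apply/eqP; ring.
Qed.

Lemma nc_1Dexp_le (z : R[i]) n : nc ((1 + n.+1%:R^-1%:C * z) ^+ n.+1) <= expR (nc z).
Proof.
rewrite ncX; have h : nc (1 + n.+1%:R^-1%:C * z) <= expR (n.+1%:R^-1 * nc z).
  apply: le_trans (ncD _ _) _; rewrite Normc.normc1 Normc.normcM nc_real.
  by rewrite ger0_norm ?invr_ge0// expR_ge1Dx.
apply: le_trans (lerXn2r _ _ _ h) _; rewrite ?nnegrE ?nc_ge0 ?expR_ge0//.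
by rewrite -expRM_natl mulrA mulfV ?pnatr_eq0// mul1r.
Qed.

(** With w = z / (n + 1), the powers of 1 + w and of exp w are compared by [nc_expr_sub_le] with K =
    exp |w|: then K^(n+1) = exp |z| does not depend on n, and (n + 1) |1 + w - exp w| tends to 0 by
    [cexp_deriv]. *)
Lemma cexp_lim z :
  (fun n => nc ((1 + n.+1%:R^-1%:C * z) ^+ n.+1 - cexp z)) @ \oo --> (0 : R).
Proof.
apply: (squeeze_cvgr (f := cst 0) (h := fun n => expR (nc z) *
    nc (n.+1%:R%:C * (cexp (n.+1%:R^-1%:C * z) - 1) - z))); last 2 first.
- exact: cvg_cst.
- by rewrite -(mulr0 (expR (nc z))); apply: cvgM; [exact: cvg_cst|exact: cexp_deriv].
apply: nearW => n; rewrite nc_ge0 /=.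
have n0 : n.+1%:R != 0 :> R by rewrite pnatr_eq0.
set w := n.+1%:R^-1%:C * z.
have wz : n.+1%:R%:C * w = z by rewrite /w mulrA -rmorphM/= mulfV// mul1r.
have -> : cexp z = cexp w ^+ n.+1 by rewrite cexpX wz.
have ncw : nc w = n.+1%:R^-1 * nc z.
  by rewrite Normc.normcM nc_real ger0_norm// invr_ge0.
have K1 : 1 <= expR (nc w) by rewrite -expR0 ler_expR nc_ge0.
have h1 : nc (1 + w) <= expR (nc w).
  by apply: le_trans (ncD _ _) _; rewrite Normc.normc1 expR_ge1Dx.
have h2 : nc (cexp w) <= expR (nc w).
  by rewrite nc_cexp ler_expR; apply: le_trans (ler_norm _) _; exact: Re_le_nc.
apply: le_trans (nc_expr_sub_le _ K1 h1 h2) _.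
have -> : expR (nc w) ^+ n.+1 = expR (nc z).
  by rewrite -expRM_natl ncw mulrA mulfV// mul1r.
rewrite mulrAC mulrC ler_wpM2l ?expR_ge0//.
have -> : n.+1%:R * nc (1 + w - cexp w) = nc (n.+1%:R%:C * (1 + w - cexp w)).
  by rewrite Normc.normcM nc_real ger0_norm.
rewrite -[X in _ <= nc (_ - X)]wz nc_distC.
by rewrite (_ : n.+1%:R%:C * w - n.+1%:R%:C * (cexp w - 1) = n.+1%:R%:C * (1 + w - cexp w))//; ring.
Qed.
End ComplexExponential.

Section BoundedlyClosed.
Variable R : realType.
Implicit Types (f g : L0 R).
Local Notation Loo := (Lp R +oo%E).

(** Unital algebras stable under bounded almost everywhere convergence. H^oo is one, and so is the
    class [testfun] used for the uniqueness of Fourier coefficients; both need exponentials of their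
    elements. *)
Definition bounded_closed (P : L0 R -> Prop) : Prop :=
  [/\ forall a : R[i], P a%:A, forall f g, P f -> P g -> P (f + g),
    forall f g, P f -> P g -> P (f * g) &
    forall (F : nat -> L0 R) f (M : R), (forall n, P (F n)) ->
      (forall n, {ae mu, forall t, nc (F n t) <= M}) -> ae_cvg F f -> P f].

Variables (P : L0 R -> Prop) (Pc : bounded_closed P).

Lemma bounded_closedZ (a : R[i]) f : P f -> P (a *: f).
Proof. by case: Pc => c _ m _ Pf; rewrite -mulr_algl; exact: m. Qed.

Lemma bounded_closedX f n : P f -> P (f ^+ n).
Proof.
case: Pc => c _ m _ Pf; elim: n => [|n ih]; last by rewrite exprS; exact: m.
by rewrite expr0 -(scale1r 1).
Qed.

Lemma L0_XE f n : {ae mu, forall t, (f ^+ n : L0 R) t = f t ^+ n}.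
Proof.
elim: n => [|n ih].
  by rewrite expr0; apply: filterS (L0_1E R) => t ->; rewrite expr0.
by rewrite exprS; apply: filterS2 ih (L0_ME f (f ^+ n)) => t ih ->; rewrite ih exprS.
Qed.

Lemma L0_1DexpE f n : {ae mu, forall t,
  ((1 + n.+1%:R^-1%:C *: f) ^+ n.+1 : L0 R) t = (1 + n.+1%:R^-1%:C * f t) ^+ n.+1}.
Proof.
apply: filterS3 (L0_XE (1 + n.+1%:R^-1%:C *: f) n.+1) (L0_DE 1 (n.+1%:R^-1%:C *: f))
  (filterI (L0_1E R) (L0_ZE n.+1%:R^-1%:C f)).
by move=> t -> -> [-> ->].
Qed.

(** The powers (1 + f / (n + 1))^(n+1) belong to the algebra and are bounded by exp M, where M
    bounds |f|. *)
Lemma bounded_closed_cexp f g : P f -> Loo f ->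
  {ae mu, forall t, g t = cexp (f t)} -> P g.
Proof.
case: (Pc) => c d m l Pf /LooP[M M0 fM] ge.
apply: (l (fun n => (1 + n.+1%:R^-1%:C *: f) ^+ n.+1) g (expR M)).
- by move=> n; apply: bounded_closedX; apply: d; [rewrite -(scale1r 1)|exact: bounded_closedZ].
- move=> n; apply: filterS2 fM (L0_1DexpE f n) => t fM ->.
  by apply: le_trans (nc_1Dexp_le _ _) _; rewrite ler_expR.
- apply: filterS2 ge (ae_all (L0_1DexpE f)) => t -> ge.
  by apply: cvg_ext (cexp_lim (f t)) => n; rewrite -ge.
Qed.
End BoundedlyClosed.

(** * Uniqueness of Fourier coefficients *)

Section Uniqueness.
Variable R : realType.
Local Notation T := (measurableTypeR R).
Implicit Types (f g : L0 R).
Local Notation L2 := (Lp R 2%:E).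
Local Notation L1 := (Lp R 1%E).
Local Notation Loo := (Lp R +oo%E).

Lemma LooD f g : Loo f -> Loo g -> Loo (f + g).
Proof. exact/Lp_D/le1oo. Qed.

Lemma LooM f g : Loo f -> Loo g -> Loo (f * g).
Proof. exact/Loo_Lp/le1oo. Qed.

Lemma LooZ (a : R[i]) f : Loo f -> Loo (a *: f).
Proof. exact/Lp_Z/le1oo. Qed.

Lemma LooN f : Loo f -> Loo (- f).
Proof. exact/Lp_N/le1oo. Qed.

Definition annihilates_chi (G : L0 R) := L1 G /\ forall n, I (G * chiL R n) = 0.

(** The bounded part of the double annihilator of the characters. Once it contains all indicators,
    an integrable function with zero Fourier coefficients has zero integral on every measurable
    set. *)
Definition testfun f := Loo f /\ forall G, annihilates_chi G -> I (G * f) = 0.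

Lemma L1_Loo f g : L1 f -> Loo g -> L1 (f * g).
Proof. by move=> hf hg; rewrite mulrC; exact: Loo_Lp. Qed.

Lemma testfun_chi n : testfun (chiL R n).
Proof. by split; [exact: chiL_Loo|move=> G []]. Qed.

(** For products: if G annihilates the characters and f is a test function, then G f annihilates
    them too, because G chi_n annihilates them and is therefore orthogonal to f. Limits pass through
    [bounded_cvg]. *)
Lemma testfun_closed : bounded_closed testfun.
Proof.
split.
- move=> a; split; first exact: Loo_alg.
  move=> G [G1 /(_ 0)]; rewrite chiL0 mulr1 => G0.
  by rewrite mulr_algr IZ// G0 mulr0.
- move=> f g [foo fG] [goo gG]; split; first exact: LooD.
  move=> G aG; have [G1 _] := aG.
  by rewrite mulrDr ID ?fG ?gG ?addr0//; exact: L1_Loo.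
- move=> f g [foo fG] [goo gG]; split; first exact: LooM.
  move=> G aG; have [G1 G0] := aG; rewrite mulrA gG//; split; first exact: L1_Loo.
  move=> n; rewrite mulrAC fG//; split; first exact/L1_Loo/chiL_Loo.
  by move=> m; rewrite -mulrA -chiLD.
- move=> F f M FP FM Ff; have fM := bounded_cvg_le FM Ff; split.
    apply/LooP; exists M => //.
    have [t ft] := @filter_ex _ _ (ae_properfilter_algebraOfSetsType (circle_measureT_gt0 R)) _ fM.
    exact: le_trans (nc_ge0 _) ft.
  move=> G aG; have [G1 _] := aG; have := bounded_cvg G1 FM Ff.
  move=> h; apply: Normc.eq0_normc.
  have : (fun n => nc (I (G * F n) - I (G * f))) @ \oo --> nc (I (G * f)).
    rewrite (_ : (fun n => _) = cst (nc (I (G * f)))); first exact: cvg_cst.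
    by apply/funext => n; rewrite (proj2 (FP n) G aG) sub0r; exact: ncN.
  by move=> h'; apply: cvg_unique h' h.
Qed.

Lemma testfun_ae f g : {ae mu, forall t, f t = g t} -> testfun f -> testfun g.
Proof. by move=> /L0P ->. Qed.

Lemma sin_half_gt0 (t : R) : 0 < t < 2 * pi -> 0 < sin (t / 2).
Proof. by move=> /andP[t0 t2]; apply: sin_gt0_pi; apply/andP; split; lra. Qed.

(* On [0, 2 pi] and up to null sets ]x, +oo[ is where
   cos (t - x/2) < cos (x/2), and
   exp (- exp (n (cos (t - x/2) - cos (x/2)))) tends to its indicator. *)
Lemma testfun_ray (x : R) : 0 < x < 2 * pi -> forall f,
  {ae mu, forall t, f t = (\1_(`]x, +oo[%classic : set R) t : R)%:C} -> testfun f.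
Proof.
move=> x02 f fE; have [cC cD cM cL] := testfun_closed.
pose p (t : R) := cos (t - x / 2) - cos (x / 2).
(* [p] written as a trigonometric polynomial of degree 1, by Euler's formula for the cosine. *)
pose q : L0 R := (2^-1%:C * conjc (chi 1 (x / 2))) *: chiL R 1 +
  (2^-1%:C * chi 1 (x / 2)) *: chiL R (- 1) + (- cos (x / 2))%:C%:A.
have qE : {ae mu, forall t, q t = (p t)%:C}.
  apply: filterS3 (L0_DE ((2^-1%:C * conjc (chi 1 (x / 2))) *: chiL R 1 +
    (2^-1%:C * chi 1 (x / 2)) *: chiL R (- 1)) ((- cos (x / 2))%:C%:A))
    (L0_DE ((2^-1%:C * conjc (chi 1 (x / 2))) *: chiL R 1)
       ((2^-1%:C * chi 1 (x / 2)) *: chiL R (- 1)))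
    (filterI (L0_algE (- cos (x / 2))%:C)
    (filterI (filterI (L0_ZE (2^-1%:C * conjc (chi 1 (x / 2))) (chiL R 1)) (chiLE R 1))
    (filterI (L0_ZE (2^-1%:C * chi 1 (x / 2)) (chiL R (- 1))) (chiLE R (- 1))))).
  move=> t -> -> [-> [[-> ->] [-> ->]]]; rewrite chiN /p cosB /chi /=.
  rewrite !mul1r; apply/eqP; rewrite eq_complex /=; apply/andP; split; apply/eqP; field => //.
have qP : testfun q.
  have cZ := bounded_closedZ testfun_closed.
  by apply: (cD); [apply: (cD); apply: (cZ); exact: testfun_chi|exact: cC].
have mp : measurable_fun setT (p : T -> R).
  apply: continuous_measurable_fun => s; apply: cvgB; last exact: cvg_cst.
  apply: continuous_comp; last exact: continuous_cos.
  by apply: cvgB; [exact: cvg_id|exact: cvg_cst].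
have p2 t : p t <= 2.
  by rewrite /p; have := cos_le1 (t - x / 2); have := cos_geN1 (x / 2); lra.
have mE n : measurable_fun setT ((fun t => expR (n%:R * p t)) : T -> R).
  by apply: measurableT_comp => //; exact: measurable_funM.
have m0 : measurable_fun setT (cst 0 : T -> R) by exact: measurable_cst.
have /choice[E EE] : forall n : nat, exists E : L0 R, {ae mu, forall t, E t = (expR (n%:R * p t))%:C}.
  by move=> n; exact: L0_mk (mE n) m0.
have Eoo n : Loo (E n).
  apply/LooP; exists (expR (n%:R * 2)); first exact: expR_ge0.
  apply: filterS (EE n) => t ->; rewrite nc_real ger0_norm ?expR_ge0//.
  by rewrite ler_expR ler_wpM2l.
have EP n : testfun (E n).
  apply: (bounded_closed_cexp testfun_closed (f := n%:R%:C *: q)).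
  - exact: (bounded_closedZ testfun_closed).
  - by apply: LooZ; case: qP.
  - apply: filterS3 qE (EE n) (L0_ZE n%:R%:C q) => t qt -> ->.
    by rewrite qt -rmorphM /= cexp_real.
have mF n : measurable_fun setT ((fun t => expR (- expR (n%:R * p t))) : T -> R).
  by apply: measurableT_comp => //; exact: measurable_funN.
have /choice[F FE] : forall n : nat, exists F : L0 R,
    {ae mu, forall t, F t = (expR (- expR (n%:R * p t)))%:C}.
  by move=> n; exact: L0_mk (mF n) m0.
apply: (cL F f 1).
- move=> n; apply: (bounded_closed_cexp testfun_closed (f := - E n)).
  + by rewrite -scaleN1r; exact: (bounded_closedZ testfun_closed).
  + exact: LooN.
  + apply: filterS3 (EE n) (FE n) (L0_NE (E n)) => t Et -> ->.
    by rewrite Et -rmorphN cexp_real.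
- move=> n; apply: filterS (FE n) => t ->; rewrite nc_real ger0_norm ?expR_ge0//.
- have tI := @ae_circle R (fun t : T => 0 <= t <= 2 * pi) (fun t h => h).
  have [t0 t2 tx] : [/\ {ae @circle_measure R, forall t : T, t <> 0},
    {ae @circle_measure R, forall t : T, t <> 2 * pi} & {ae @circle_measure R, forall t : T, t <> x}].
    by split; exact: circle_set1.
  apply: filterS3 fE (ae_all FE) (filterI tI (filterI t0 (filterI t2 tx))).
  move=> t -> Ft [/andP[t0' t2'] [t0n [t2n txn]]].
  have t02 : 0 < t < 2 * pi.
    by rewrite !lt_neqAle t0' t2' !andbT; apply/andP; split; apply/eqP => //; exact: nesym.
  (* In this product form sin (t / 2) is positive, so [p t] has the sign of x - t. *)
  have pE : p t = 2 * (sin (t / 2) * sin ((x - t) / 2)).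
    rewrite /p (_ : t - x / 2 = t / 2 - (x - t) / 2); last by field.
    rewrite (_ : cos (x / 2) = cos (t / 2 + (x - t) / 2)); last by congr cos; field.
    by rewrite cosB cosD; ring.
  have st := sin_half_gt0 t02.
  have decay (a : R) : 0 < a -> (fun n => expR (- (n%:R * a))) @ \oo --> (0 : R).
    move=> a0; have na : n%:R * a @[n --> \oo] --> +oo.
      have /cvgryPge h := @cvgr_idn R; apply/cvgryPge => A.
      by apply: filterS (h (A / a)) => n; rewrite ler_pdivrMr.
    exact: cvg_comp na (@cvgr_expR R).
  apply: (cvg_ext (u := fun n => `|expR (- expR (n%:R * p t)) - \1_(`]x, +oo[%classic : set R) t|)).
    by move=> n; rewrite Ft -rmorphB nc_real.
  rewrite -(normr0 R); apply: cvg_norm.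
  rewrite indicE; have /orP[tx'|tx'] : (t < x) || (x < t) by rewrite -neq_lt; apply/eqP.
    rewrite memNset/=; last by rewrite in_itv/= andbT; apply/negP; rewrite -leNgt ltW.
    have p0 : 0 < p t.
      by rewrite pE mulr_gt0// mulr_gt0// sin_half_gt0//; apply/andP; split; lra.
    rewrite -(subr0 0); apply: cvgB; last exact: cvg_cst.
    apply: (squeeze_cvgr (f := cst 0) (h := fun n => expR (- (n%:R * p t)))).
    - apply: nearW => n; rewrite expR_ge0/= ler_expR lerN2.
      by apply: le_trans (expR_ge1Dx _); rewrite lerDr.
    - exact: cvg_cst.
    - exact: decay.
  rewrite mem_set/=; last by rewrite in_itv/= tx'.
  have p0 : p t < 0.
    rewrite pE (_ : (x - t) / 2 = - ((t - x) / 2)); last by field.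
    rewrite sinN mulrN mulrN oppr_lt0 mulr_gt0// mulr_gt0// sin_half_gt0//.
    by apply/andP; split; lra.
  have hE : (fun n => expR (n%:R * p t)) @ \oo --> (0 : R).
    have := decay (- p t); rewrite oppr_gt0 => /(_ p0).
    by apply: cvg_ext => n; rewrite mulrN opprK.
  have hN : (fun n => - expR (n%:R * p t)) @ \oo --> (0 : R) by rewrite -oppr0; exact: cvgN.
  have hX : (fun n => expR (- expR (n%:R * p t))) @ \oo --> (1 : R).
    have h1 : expR x @[x --> (0 : R)] --> (1 : R).
      by have := @continuous_expR R 0; rewrite /continuous_at expR0.
    exact: (@cvg_comp _ _ _ (fun n => - expR (n%:R * p t)) (@expR R) _ _ _ hN h1).
  by have := cvgB hX (cvg_cst (1 : R)); rewrite subrr; apply.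
Qed.

(** The sets whose indicator is a test function form a sigma-algebra: complements come from
    linearity, intersections from products, countable unions from bounded limits. The rays of
    [testfun_ray] generate the Borel sets. *)
Lemma testfun_indic (A : set T) : measurable A -> forall f,
  {ae mu, forall t, f t = (\1_A t : R)%:C} -> testfun f.
Proof.
have [cC cD cM cL] := testfun_closed.
have c1 : testfun 1 by rewrite -(scale1r 1).
have c0 : testfun 0 by rewrite -(scale0r 1).
pose D := [set A : set T | measurable A /\ forall f,
  {ae mu, forall t, f t = (\1_A t : R)%:C} -> testfun f].
have mkf (B : set T) : measurable B -> exists f : L0 R, {ae mu, forall t, f t = (\1_B t : R)%:C}.
  move=> mB; have mI : measurable_fun setT (\1_B : T -> R) by exact/measurable_indicP.
  have m0 : measurable_fun setT (cst 0 : T -> R) by exact: measurable_cst.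
  by have [g gE] := L0_mk mI m0; exists g.
have DC (B : set T) : D B -> D (~` B).
  move=> [mB BP]; split; first exact: measurableC.
  move=> f fE; have [g gE] := mkf B mB.
  apply: (@testfun_ae (1 - g)).
    apply: filterS3 (L0_BE 1 g) (L0_1E R) (filterI gE fE) => t -> -> [-> ->].
    by rewrite !indicE in_setC; case: (t \in B); rewrite ?subrr ?subr0.
  apply: (cD _ _ c1); rewrite -scaleN1r; apply: (bounded_closedZ testfun_closed); exact: BP.
have DI (B B' : set T) : D B -> D B' -> D (B `&` B').
  move=> [mB BP] [mB' BP']; split; first exact: measurableI.
  move=> f fE; have [g gE] := mkf B mB; have [g' gE'] := mkf B' mB'.
  apply: (@testfun_ae (g * g')); last by apply: cM; [exact: BP|exact: BP'].
  apply: filterS3 (L0_ME g g') gE (filterI gE' fE) => t -> -> [-> ->].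
  by rewrite -rmorphM indicI.
have D0 : D set0.
  split; first exact: measurable0.
  move=> f fE; apply: (@testfun_ae 0) => //.
  by apply: filterS2 fE (L0_0E R) => t -> ->; rewrite indic0.
have DU (B B' : set T) : D B -> D B' -> D (B `|` B').
  by move=> /DC hB /DC hB'; rewrite -(setCK (B `|` B')) setCU; apply/DC/DI.
have DbU (B : (set T)^nat) : (forall k, D (B k)) -> D (\bigcup_k B k).
  move=> BD; pose U n := \big[setU/set0]_(k < n) B k.
  have UD n : D (U n).
    by rewrite /U; elim/big_ind : _ => //.
  have mU : measurable (\bigcup_k B k) by apply: bigcupT_measurable => k; case: (BD k).
  split => // f fE.
  have /choice[F FE] : forall n, exists F : L0 R, {ae mu, forall t, F t = (\1_(U n) t : R)%:C}.
    by move=> n; apply: mkf; case: (UD n).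
  apply: (cL F f 1).
  - by move=> n; case: (UD n) => _; apply; exact: FE.
  - move=> n; apply: filterS (FE n) => t ->.
    by rewrite nc_real indicE; case: (_ \in _); rewrite ?normr0 ?normr1.
  - apply: filterS2 fE (ae_all FE) => t -> Ft.
    have [[k _ Bk]|nB] := pselect ((\bigcup_k B k) t).
      apply: cvg_near_cst; exists k.+1 => // n /= kn; rewrite Ft.
      have Ut : U n t by rewrite /U -bigcup_mkord; exists k.
      have Bt : (\bigcup_k B k) t by exists k.
      by rewrite !indicE !mem_set// subrr Normc.normc0.
    apply: cvg_near_cst; exists 0%N => // n _; rewrite Ft.
    have Ut : ~ U n t.
      by rewrite /U -bigcup_mkord => -[k _ Bk]; apply: nB; exists k.
    by rewrite !indicE !memNset// subrr Normc.normc0.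
have DR (x : R) : D (`]x, +oo[%classic : set R).
  split; first exact: measurable_itv.
  (* Outside ]0, 2 pi[ the ray is, up to a null set, the whole circle or empty. *)
  move=> f fE; have [x0|x0] := leP x 0.
    apply: (@testfun_ae 1) => //.
    have tI := @ae_circle R (fun t : T => 0 <= t <= 2 * pi) (fun t h => h).
    apply: filterS3 fE (L0_1E R) (filterI tI (circle_set1 0)) => t -> -> [/andP[t0 _] tn0].
    rewrite indicE mem_set//= in_itv/= andbT (le_lt_trans x0)// lt_neqAle t0 andbT.
    by apply/eqP; exact: nesym.
  have [x2|x2] := ltP x (2 * pi); first by apply: testfun_ray fE; rewrite x0.
  apply: (@testfun_ae 0) => //.
  have tI := @ae_circle R (fun t : T => 0 <= t <= 2 * pi) (fun t h => h).
  apply: filterS3 fE (L0_0E R) tI => t -> -> /andP[_ t2].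
  rewrite indicE memNset//= in_itv/= andbT => xt.
  by move: (lt_le_trans xt t2); rewrite ltNge x2.
suff : measurable `<=` D by move=> mD mA; case: (mD A mA).
have -> : @measurable _ T = <<s @RGenOInfty.G R >> by exact: RGenOInfty.measurableE.
apply: smallest_sub; last by move=> _ [x ->]; exact: DR.
split => //.
  by move=> B DB; rewrite setTD; exact: DC.
Qed.

Lemma fourier_unique f : L1 f -> (forall n, I (f * chiL R n) = 0) -> f = 0.
Proof.
move=> f1 f0; have af : annihilates_chi f by split.
have /Lp1_cintegrable[ir ii] := f1; have [mr mi] := L0_meas f.
have m0 : measurable_fun setT (cst 0 : T -> R) by exact: measurable_cst.
have intA (A : set T) : measurable A -> cintegral (fun t => f t * (\1_A t : R)%:C) = 0.
  move=> mA; have mI : measurable_fun setT (\1_A : T -> R) by exact/measurable_indicP.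
  have [g gE] := L0_mk mI m0.
  have <- : I (f * g) = 0 by have [_] := testfun_indic mA gE; apply.
  apply: cintegral_ae; [|exact: L0_meas|].
    by apply: cmfunM; [exact: L0_meas|split].
  by apply: filterS2 (L0_ME f g) gE => t -> ->.
have zero (h : T -> R) : mu.-integrable setT (EFin \o h) ->
    (forall A : set T, measurable A -> \int[@circle_measure R]_t (h t * \1_A t) = 0) ->
    {ae @circle_measure R, forall t, h t = 0}.
  move=> ih hA.
  have h0 : ae_eq mu setT (EFin \o h) (cst 0%E).
    have mc : measurable_fun setT (cst 0%E : T -> \bar R) by exact: measurable_cst.
    apply: (integral_ae_eq measurableT ih mc).
    move=> A _ mA; rewrite integral0.
    have ihA : mu.-integrable setT (EFin \o (fun t => h t * \1_A t)).
      rewrite (_ : EFin \o _ = (EFin \o h) \_ A).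
        by apply/integrable_restrict => //; rewrite setTI; exact: (integrableS measurableT).
      by apply/funext => t; rewrite patchE /= indicE; case: (t \in A); rewrite ?mulr1 ?mulr0.
    have := hA A mA; rewrite /Rintegral => h0.
    rewrite integral_mkcond -[RHS]/(0%:E) -h0 fineK; last exact: integrable_fin_num.
    apply: eq_integral => t _.
    by rewrite patchE /= indicE; case: (t \in A); rewrite ?mulr1 ?mulr0.
  by apply: filterS h0 => t /(_ Logic.I) [].
apply/L0P.
have hr : {ae @circle_measure R, forall t, complex.Re (f t) = 0}.
  apply: zero => // A mA.
  transitivity (complex.Re (cintegral (fun t => f t * (\1_A t : R)%:C))); last by rewrite intA.
  apply: eq_Rintegral => t _.
  by case: (f t) => a b /=; rewrite mulr0 subr0.
have hi : {ae @circle_measure R, forall t, complex.Im (f t) = 0}.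
  apply: zero => // A mA.
  transitivity (complex.Im (cintegral (fun t => f t * (\1_A t : R)%:C))); last by rewrite intA.
  apply: eq_Rintegral => t _.
  by case: (f t) => a b /=; rewrite mulr0 add0r.
by apply: filterS3 hr hi (L0_0E R) => t; case: (f t) => a b /= -> -> ->.
Qed.
End Uniqueness.

(** * Hardy spaces *)

Section HardySpace.
Variable R : realType.
Local Notation T := (measurableTypeR R).
Implicit Types (f g h u : L0 R).
Local Notation L2 := (Lp R 2%:E).
Local Notation L1 := (Lp R 1%E).
Local Notation Loo := (Lp R +oo%E).
Local Notation H2s := (Hp R 2%:E).
Local Notation Hoo := (Hp R +oo%E).
Let p2 : (1 <= 2%:E :> \bar R)%E := le12 R.

Lemma HpP p f : Hp R p f <->
  Lp R p f /\ forall n : int, 0 < n -> I (f * chiL R n) = 0.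
Proof.
have E n : cintegral (fun t => f t * chi n t) = I (f * chiL R n).
  apply: cintegral_ae; [|exact: L0_meas|].
    by apply: cmfunM; [exact: L0_meas|exact: chi_meas].
  by apply: filterS2 (L0_ME f (chiL R n)) (chiLE R n) => t -> ->.
by split=> -[fp f0]; split=> // n n0; [rewrite -E|rewrite E]; exact: f0.
Qed.

Lemma L2_add f g : L2 f -> L2 g -> L2 (f + g). Proof. exact: Lp_D. Qed.
Lemma L2_sub f g : L2 f -> L2 g -> L2 (f - g). Proof. exact: Lp_B. Qed.
Lemma L2_scale (a : R[i]) f : L2 f -> L2 (a *: f). Proof. exact: Lp_Z. Qed.
Lemma Loo_mulL2 f g : Loo f -> L2 g -> L2 (f * g). Proof. exact: Loo_Lp. Qed.
Lemma L2_chi n : L2 (chiL R n). Proof. exact/Loo_L2/chiL_Loo. Qed.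

Lemma pythagoras f g : L2 f -> L2 g -> I (f * conjL0 g) = 0 ->
  N2 (f + g) ^+ 2 = N2 f ^+ 2 + N2 g ^+ 2.
Proof.
move=> f2 g2 fg0; have fc := L2_conj f2; have gc := L2_conj g2.
have gf0 : I (g * conjL0 f) = 0.
  have := I_conj (L2M f2 gc); rewrite fg0 conjc0 => <-.
  by rewrite rmorphM /= conjL0K mulrC.
apply: complexI; rewrite -inner_sqr ?rmorphD /= -?inner_sqr//; last exact: L2_add.
have -> : (f + g) * (conjL0 f + conjL0 g) =
    (f * conjL0 f + f * conjL0 g) + (g * conjL0 f + g * conjL0 g).
  by rewrite mulrDl !mulrDr.
have D1 a b : L1 a -> L1 b -> L1 (a + b) by exact: Lp_D.
by rewrite !ID ?fg0 ?gf0 ?addr0 ?add0r//; do ?apply: (D1); exact: L2M.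
Qed.

Lemma L2_cvg_I f g (u : nat -> L0 R) : L2 f -> L2 g -> (forall n, L2 (u n)) ->
  (fun n => N2 (u n - f)) @ \oo --> (0 : R) ->
  (fun n => nc (I (u n * g) - I (f * g))) @ \oo --> (0 : R).
Proof.
move=> f2 g2 u2 uf.
apply: (squeeze_cvgr (f := cst 0) (h := fun n => N2 (u n - f) * N2 g)).
- apply: nearW => n; apply/andP; split; first exact: nc_ge0.
  rewrite -(IB (L2M (u2 n) g2) (L2M f2 g2)) -mulrBl.
  by apply: cauchy_schwarz => //; exact: L2_sub.
- exact: cvg_cst.
- by rewrite -(mul0r (N2 g)); apply: cvgM => //; exact: cvg_cst.
Qed.

Lemma cvg_cst_eq (z w : R[i]) (u : nat -> R[i]) :
  (\forall n \near \oo, u n = z) -> (fun n => nc (u n - w)) @ \oo --> (0 : R) -> w = z.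
Proof.
move=> uz uw; apply/eqP; rewrite eq_sym -subr_eq0 -nc_eq0; apply/eqP.
apply: (@cvg_unique _ _ ((fun n => nc (u n - w)) @ \oo)) uw => //.
apply: cvg_near_cst.
by apply: filterS uz => n ->.
Qed.

Definition fcoef u (j : int) : R[i] := ((2 * pi)^-1)%:C * I (u * chiL R (- j)).

Definition fsum u (n : nat) : L0 R := \sum_(0 <= j < n) fcoef u j *: chiL R j.

Lemma fsumS u n : fsum u n.+1 = fsum u n + fcoef u n *: chiL R n.
Proof. by rewrite /fsum big_nat_recr. Qed.

Lemma fsum_Loo u n : Loo (fsum u n).
Proof.
elim: n => [|n ih]; first by rewrite /fsum big_geq//; apply/Lp_0/le1oo.
by rewrite fsumS; apply: LooD => //; exact/LooZ/chiL_Loo.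
Qed.

Lemma fsum_L2 u n : L2 (fsum u n). Proof. exact/Loo_L2/fsum_Loo. Qed.

(** Integrating against chi_k reads off the coefficient of index -k, which occurs in the sum exactly
    when 0 <= -k < n. *)
Lemma I_fsum_chi u n (k : int) : I (fsum u n * chiL R k) =
  if (k <= 0) && (`|k|%N < n)%N then I (u * chiL R k) else 0.
Proof.
elim: n => [|n ih].
  by rewrite /fsum big_geq// mul0r I0 andbF.
rewrite fsumS mulrDl ID; last 2 first.
- exact: L2M (fsum_L2 u n) (L2_chi k).
- exact: L2M (L2_scale _ (L2_chi n)) (L2_chi k).
rewrite ih -scalerAl -chiLD IZ; last exact/Loo_L1/chiL_Loo.
have [nk|nk] := eqVneq (n%:Z + k) 0.
  have -> : k = - n%:Z by apply/eqP; rewrite -addr_eq0 addrC nk.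
  rewrite subrr chiL0 I1 oppr_le0 abszN absz_nat ltnn ltnSn lez_nat leq0n /= add0r.
  by rewrite /fcoef mulrAC -rmorphM/= mulVf ?mul1r// mulf_neq0 ?gt_eqF ?pi_gt0.
rewrite I_chi// mulr0 addr0; case: (lerP k 0) => //= k0.
suff -> : (`|k| < n.+1)%N = (`|k| < n)%N by [].
rewrite ltnS leq_eqVlt; case: eqP => // kn; exfalso; move/eqP: nk; apply.
by rewrite -kn abszE ler0_norm// addNr.
Qed.

Lemma fsum_orth u n m : L2 u -> (n <= m)%N -> I ((u - fsum u m) * conjL0 (fsum u n)) = 0.
Proof.
move=> u2; have d2 : L2 (u - fsum u m) by apply: L2_sub => //; exact: fsum_L2.
elim: n => [|n ih] nm; first by rewrite /fsum [X in conjL0 X]big_geq// rmorph0 mulr0 I0.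
rewrite fsumS rmorphD /= mulrDr ID; last 2 first.
- exact/L2M/L2_conj/fsum_L2.
- exact/L2M/L2_conj/L2_scale/L2_chi.
rewrite ih ?(ltnW nm)// add0r conjL0Z chiLJ -scalerAr IZ; last exact/L2M/L2_chi.
rewrite mulrBl IB; [|exact/L2M/L2_chi|apply: L2M; [exact: fsum_L2|exact: L2_chi]].
by rewrite I_fsum_chi oppr_le0 lez_nat leq0n abszN absz_nat nm subrr mulr0.
Qed.

Lemma fsum_pythagoras u n m : L2 u -> (n <= m)%N ->
  N2 (u - fsum u n) ^+ 2 = N2 (u - fsum u m) ^+ 2 + N2 (fsum u m - fsum u n) ^+ 2.
Proof.
move=> u2 nm; have d2 k : L2 (u - fsum u k) by apply: L2_sub => //; exact: fsum_L2.
rewrite -pythagoras ?d2//.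
- by rewrite subrKA.
- by apply: L2_sub; exact: fsum_L2.
- rewrite rmorphB /= mulrBr IB; last 2 first.
  + exact/L2M/L2_conj/fsum_L2.
  + exact/L2M/L2_conj/fsum_L2.
  by rewrite !fsum_orth// subrr.
Qed.

(** By [fsum_pythagoras] the squared distances from u to its partial sums over nonnegative
    frequencies decrease, and their differences are the squared distances between partial sums.
    These sums are thus Cauchy, and their limit is the orthogonal projection of u. *)
Lemma hardy_proj_exists u : L2 u -> exists s, [/\ H2s s,
  forall j : nat, I ((u - s) * chiL R (- j%:Z)) = 0 &
  (fun n => N2 (fsum u n - s)) @ \oo --> (0 : R)].
Proof.
move=> u2; pose d n := N2 (u - fsum u n) ^+ 2.
have dE n m : (n <= m)%N -> d n = d m + N2 (fsum u m - fsum u n) ^+ 2.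
  exact: fsum_pythagoras.
have cd : cvgn d.
  apply: nonincreasing_is_cvgn.
    by move=> n m nm; rewrite (dE n m nm) lerDl sqr_ge0.
  by exists 0 => _ [n _ <-]; exact: sqr_ge0.
have [||s s2 us] := @L2_complete _ (fsum u); first exact: fsum_L2.
  move=> e e0; have /cvgrPdist_le/(_ (e ^+ 2 / 2)) := cd.
  rewrite divr_gt0 ?exprn_gt0// => /(_ isT) [N _ dN].
  have key n m : (N <= n)%N -> (n <= m)%N -> N2 (fsum u m - fsum u n) <= e.
    move=> Nn nm; have := dN n Nn; have := dN m (leq_trans Nn nm).
    rewrite /= !ler_norml => /andP[h1 h2] /andP[h3 h4].
    rewrite -(@ler_pXn2r _ 2)// ?nnegrE ?N2_ge0 ?(ltW e0)//.
    by have := dE n m nm; lra.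
  exists N => m n Nm Nn; have [mn|nm] := leqP n m; first exact: key.
  rewrite -N2N; last by apply: L2_sub; exact: fsum_L2.
  by rewrite opprB; apply: key => //; exact: ltnW.
have Ik k := L2_cvg_I s2 (L2_chi k) (fsum_L2 u) us.
exists s; split => //.
  apply/HpP; split => // n n0; apply: cvg_cst_eq (Ik n).
  by apply: nearW => m; rewrite I_fsum_chi leNgt n0.
move=> j; rewrite mulrBl IB; [|exact/L2M/L2_chi|exact/L2M/L2_chi].
apply/eqP; rewrite subr_eq0 eq_sym; apply/eqP; apply: cvg_cst_eq (Ik _).
by exists j.+1 => // m /= jm; rewrite I_fsum_chi oppr_le0 lez_nat abszN absz_nat jm.
Qed.

(** The limit of the partial sums has the same Fourier coefficients as g at every frequency, the
    missing ones being 0 because g is in H^2; [fourier_unique] identifies the two. *)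
Lemma fsum_cvg g : H2s g -> (fun n => N2 (fsum g n - g)) @ \oo --> (0 : R).
Proof.
move=> /HpP[g2 g0]; have [s [/HpP[s2 s0] gs us]] := hardy_proj_exists g2.
have sg : g - s = 0.
  apply: fourier_unique; first exact/L2_L1/L2_sub.
  move=> n; have [n0|n0] := ltP 0 n.
    by rewrite mulrBl IB ?g0 ?s0 ?subrr//; exact/L2M/L2_chi.
  by have := gs `|n|%N; rewrite abszE ler0_norm// opprK.
by move/eqP: sg; rewrite subr_eq0 => /eqP gE; apply: cvg_ext us => n; rewrite -gE.
Qed.

(** Density in H^2 of the span of the chi_j with j >= 0. *)
Lemma I_analytic_eq0 f g : L2 f -> (forall j : nat, I (f * chiL R j) = 0) ->
  H2s g -> I (f * g) = 0.
Proof.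
move=> f2 f0 g2; have /HpP[gL _] := g2.
rewrite mulrC; apply: cvg_cst_eq (L2_cvg_I gL f2 (fsum_L2 g) (fsum_cvg g2)).
apply: nearW => n; elim: n => [|n ih]; first by rewrite /fsum big_geq// mul0r I0.
rewrite fsumS mulrDl ID; last 2 first.
- exact: L2M (fsum_L2 g n) f2.
- exact: L2M (L2_scale _ (L2_chi n)) f2.
by rewrite ih add0r -scalerAl IZ ?[chiL R n * f]mulrC ?f0 ?mulr0//; exact/L2M/L2_chi.
Qed.

Lemma Hoo_H2 h : Hoo h -> H2s h.
Proof. by move=> /HpP[hoo h0]; apply/HpP; split => //; exact: Loo_L2. Qed.

(** For n > 0 the function h chi_n has zero integral against every chi_j with j >= 0, hence against
    all of H^2. *)
Lemma Hoo_mulH2 h g : Hoo h -> H2s g -> H2s (h * g).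
Proof.
move=> /HpP[hoo h0] g2; have /HpP[gL _] := g2; apply/HpP; split.
  exact: Loo_mulL2.
move=> n n0; rewrite mulrAC; apply: I_analytic_eq0 => //.
  exact: Loo_mulL2 (L2_chi n).
by move=> j; rewrite -mulrA -chiLD h0// ltr_wpDr// lez_nat.
Qed.

Lemma Hoo_mul h g : Hoo h -> Hoo g -> Hoo (h * g).
Proof.
move=> hh hg; have /HpP[_ hg0] := Hoo_mulH2 hh (Hoo_H2 hg).
by apply/HpP; split => //; case/HpP: hh => hoo _; case/HpP: hg => goo _; exact: LooM.
Qed.

Lemma H2_closed_lin (a : R[i]) f g : H2s f -> H2s g -> H2s (a *: f + g).
Proof.
move=> /HpP[f2 f0] /HpP[g2 g0]; apply/HpP; split; first exact/L2_add/g2/L2_scale.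
move=> n n0; rewrite mulrDl -scalerAl ID ?IZ ?f0 ?g0 ?mulr0 ?addr0//.
- exact/L2M/L2_chi.
- by rewrite scalerAl; exact: L2M (L2_scale _ f2) (L2_chi n).
- exact/L2M/L2_chi.
Qed.

Lemma Hoo_closed : bounded_closed Hoo.
Proof.
split.
- move=> a; apply/HpP; split; first exact: Loo_alg.
  move=> n n0; rewrite mulr_algl IZ ?I_chi ?mulr0 ?gt_eqF//.
  exact/Loo_L1/chiL_Loo.
- move=> f g /HpP[f2 f0] /HpP[g2 g0]; apply/HpP; split; first exact: LooD.
  move=> n n0; rewrite mulrDl ID ?f0 ?g0 ?addr0//.
    by apply/Loo_L1/LooM => //; exact: chiL_Loo.
  by apply/Loo_L1/LooM => //; exact: chiL_Loo.
- exact: Hoo_mul.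
- move=> F f M FP FM Ff; have fM := bounded_cvg_le FM Ff; apply/HpP; split.
    apply/LooP; exists M => //.
    have [t ft] := @filter_ex _ _ (ae_properfilter_algebraOfSetsType (circle_measureT_gt0 R)) _ fM.
    exact: le_trans (nc_ge0 _) ft.
  move=> n n0; rewrite mulrC.
  apply: cvg_cst_eq (bounded_cvg (Loo_L1 (chiL_Loo R n)) FM Ff).
  by apply: nearW => m; rewrite mulrC; have /HpP[_ ->] := FP m.
Qed.
End HardySpace.

(** * Reproducing kernels *)

Section Kernel.
Variable R : realType.
Local Notation T := (measurableTypeR R).
Implicit Types (f g h u : L0 R) (A B : R).
Local Notation L2 := (Lp R 2%:E).
Local Notation L1 := (Lp R 1%E).
Local Notation Loo := (Lp R +oo%E).
Local Notation H2s := (Hp R 2%:E).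
Local Notation Hoo := (Hp R +oo%E).

(** The squared modulus of 1 + A (1 - e^(it)). *)
Definition phi_den A (t : R) : R := (1 + A * (1 - cos t)) ^+ 2 + (A * sin t) ^+ 2.

Definition phi_re A (t : R) : R := (1 + A * (1 - cos t)) / phi_den A t.
Definition phi_im A (t : R) : R := (A * sin t) / phi_den A t.

(* [phi A] is 1 / (1 + A (1 - e^(it))); it is a multiple of the Szego kernel
   at the point A / (1 + A). *)
Definition phi A (t : R) : R[i] := Complex (phi_re A t) (phi_im A t).

Lemma phi_den_ge1 A t : 0 <= A -> 1 <= phi_den A t.
Proof.
move=> A0; have c0 : 0 <= A * (1 - cos t) by rewrite mulr_ge0// subr_ge0 cos_le1.
by rewrite /phi_den; have := sqr_ge0 (A * sin t); nra.
Qed.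

Lemma phi_den_neq0 A t : 0 <= A -> phi_den A t != 0.
Proof. by move=> A0; rewrite gt_eqF// (lt_le_trans ltr01)// phi_den_ge1. Qed.

Lemma phi_den_cont A : continuous (phi_den A).
Proof.
move=> t; have c1 : {for t, continuous (fun s => 1 + A * (1 - cos s))}.
  apply: cvgD; first exact: cvg_cst.
  apply: cvgM; first exact: cvg_cst.
  by apply: cvgB; [exact: cvg_cst|exact: continuous_cos].
have c2 : {for t, continuous (fun s => A * sin s)}.
  by apply: cvgM; [exact: cvg_cst|exact: continuous_sin].
apply: cvgD; exact: cvgM.
Qed.

Lemma phi_re_cont A : 0 <= A -> continuous (phi_re A).
Proof.
move=> A0 t; apply: cvgM.
  apply: cvgD; first exact: cvg_cst.
  apply: cvgM; first exact: cvg_cst.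
  by apply: cvgB; [exact: cvg_cst|exact: continuous_cos].
by apply: cvgV; [exact: phi_den_neq0|exact: phi_den_cont].
Qed.

Lemma phi_im_cont A : 0 <= A -> continuous (phi_im A).
Proof.
move=> A0 t; apply: cvgM.
  by apply: cvgM; [exact: cvg_cst|exact: continuous_sin].
by apply: cvgV; [exact: phi_den_neq0|exact: phi_den_cont].
Qed.

Lemma phi_chi A t : 0 <= A ->
  (1 + A)%:C * phi A t - A%:C * (chi 1 t * phi A t) = 1.
Proof.
move=> A0; have d0 := phi_den_neq0 t A0.
rewrite /phi /phi_re /phi_im /chi mul1r; move: d0; rewrite /phi_den => d0.
by apply/eqP; rewrite eq_complex /=; apply/andP; split; apply/eqP; field.
Qed.

Lemma nc_phi A t : 0 <= A -> nc (phi A t) ^+ 2 = (phi_den A t)^-1.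
Proof.
move=> A0; have d0 := phi_den_neq0 t A0.
rewrite nc_sqr /= /phi_re /phi_im; move: d0; rewrite /phi_den => d0; by field.
Qed.

Lemma nc_phi_le1 A t : 0 <= A -> nc (phi A t) <= 1.
Proof.
move=> A0; rewrite -(@ler_pXn2r _ 2)// ?nnegrE ?nc_ge0// nc_phi// expr1n.
by rewrite invf_le1 ?phi_den_ge1// (lt_le_trans ltr01)// phi_den_ge1.
Qed.

Lemma phiL_exists A : 0 <= A -> exists f : L0 R, {ae mu, forall t, f t = phi A t}.
Proof.
by move=> A0; apply: L0_mk; apply: continuous_measurable_fun; [exact: phi_re_cont|exact: phi_im_cont].
Qed.

Definition phiL A : L0 R := xget 0 [set f : L0 R | {ae mu, forall t, f t = phi A t}].

Lemma conj_realC (a : R) : conjc a%:C = a%:C.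
Proof. by apply/eqP; rewrite eq_complex /= oppr0 !eqxx. Qed.

Section FixedA.
Variables (A : R) (A0 : 0 <= A).

Lemma phiLE : {ae mu, forall t, phiL A t = phi A t}.
Proof. by rewrite /phiL; case: xgetP => [f _ //|]; have [f fE] := phiL_exists A0; move=> /(_ f). Qed.

Lemma phiL_Loo : Loo (phiL A).
Proof.
by apply/LooP; exists 1 => //; apply: filterS phiLE => t ->; exact: nc_phi_le1.
Qed.

Local Notation phiJ := (conjL0 (phiL A)).

Lemma phiJ_Loo : Loo phiJ. Proof. exact/Lp_conj/phiL_Loo/le1oo. Qed.

Lemma phiL_chi : (1 + A)%:C *: phiL A - A%:C *: (chiL R 1 * phiL A) = 1.
Proof.
apply/L0P.
apply: filterS3 (L0_BE ((1 + A)%:C *: phiL A) (A%:C *: (chiL R 1 * phiL A)))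
  (filterI (L0_ZE (1 + A)%:C (phiL A)) (L0_ZE A%:C (chiL R 1 * phiL A)))
  (filterI (filterI (L0_ME (chiL R 1) (phiL A)) (chiLE R 1)) (filterI phiLE (L0_1E R))).
by move=> t -> [-> ->] [[-> ->] [-> ->]]; exact: phi_chi.
Qed.

Lemma phiJ_chi : (1 + A)%:C *: phiJ - A%:C *: (chiL R (- 1) * phiJ) = 1.
Proof.
have /(congr1 (@conjL0 R)) := phiL_chi.
by rewrite rmorphB /= !conjL0Z !conj_realC rmorphM /= chiLJ rmorph1.
Qed.

Lemma A1_neq0 : (1 + A)%:C != 0 :> R[i].
Proof. by rewrite -nc_eq0 nc_real normr_eq0 gt_eqF// ltr_wpDr. Qed.

(** The identity [phiJ_chi] integrated against f. It shifts the frequency by one, and the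
    computations with the kernel all rest on this recurrence. *)
Lemma phiJ_rec f : L1 f ->
  (1 + A)%:C * I (f * phiJ) = I f + A%:C * I (f * (chiL R (- 1) * phiJ)).
Proof.
move=> f1; have h1 : L1 (f * phiJ) by exact: L1_Loo phiJ_Loo.
have h2 : L1 (f * (chiL R (- 1) * phiJ)).
  by apply: L1_Loo => //; apply: LooM; [exact: chiL_Loo|exact: phiJ_Loo].
apply/eqP; rewrite -subr_eq -!IZ// -IB; last 2 first.
- exact: Lp_Z.
- exact: Lp_Z.
by rewrite (scalerAr _ f phiJ) (scalerAr _ f (chiL R (- 1) * phiJ)) -mulrBr phiJ_chi mulr1.
Qed.

(** The moduli a_k of these integrals satisfy a_k = r a_(k+1) with r = A / (1 + A) < 1, and they are
    bounded; hence a_k = r^n a_(k+n) tends to 0 with n. By conjugation this says that [phiL A] is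
    analytic. *)
Lemma I_phiJ_chiN (m : nat) : I (chiL R (- m.+1%:Z) * phiJ) = 0.
Proof.
pose a k := nc (I (chiL R (- k.+1%:Z) * phiJ)).
have step k : (1 + A) * a k = A * a k.+1.
  have := phiJ_rec (Loo_L1 (chiL_Loo R (- k.+1%:Z))).
  have e : - k.+1%:Z + -1 = - k.+2%:Z by rewrite -opprD -PoszD addn1.
  rewrite I_chi// add0r mulrA -chiLD e => /(congr1 (@Normc.normc R)).
  by rewrite !Normc.normcM !nc_real !ger0_norm// addr_ge0.
have bound k : a k <= N2 1 * N2 phiJ.
  rewrite /a; apply: le_trans (cauchy_schwarz _ _) _.
  - exact/Loo_L2/chiL_Loo.
  - exact/Loo_L2/phiJ_Loo.
  rewrite ler_wpM2r ?N2_ge0//; apply: N2_le; first exact/Loo_L2/Loo1.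
  by apply: filterS2 (chiLE R (- k.+1%:Z)) (L0_1E R) => t -> ->; rewrite nc_chi Normc.normc1.
have A1 : 0 < 1 + A by rewrite ltr_wpDr.
have r1 : `|A / (1 + A)| < 1.
  by rewrite ger0_norm ?divr_ge0 ?(ltW A1)// ltr_pdivrMr// mul1r ltrDr.
have aE k n : a k = (A / (1 + A)) ^+ n * a (k + n)%N.
  elim: n k => [|n ih] k; first by rewrite expr0 mul1r addn0.
  rewrite exprSr -mulrA addnS -addSn.
  have -> : A / (1 + A) * a (k.+1 + n)%N = a (k + n)%N.
    apply: (mulfI (lt0r_neq0 A1)); rewrite step addSn; field.
    exact: lt0r_neq0.
  exact: ih.
apply: Normc.eq0_normc; apply/eqP; rewrite eq_le nc_ge0 andbT -/(a m).
have h : (fun n => (A / (1 + A)) ^+ n * (N2 1 * N2 phiJ)) @ \oo --> (0 : R).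
  by rewrite -(mul0r (N2 1 * N2 phiJ)); apply: cvgM; [exact: cvg_expr|exact: cvg_cst].
rewrite -(cvg_lim _ h)//; apply: limr_ge; first by apply: cvgP h.
apply: nearW => n; by rewrite (aE m n) ler_wpM2l// exprn_ge0// divr_ge0// ltW.
Qed.

Lemma I_phiJ : I phiJ = (2 * pi / (1 + A))%:C.
Proof.
have := phiJ_rec (Loo_L1 (Loo1 R)); rewrite !mul1r I1 (I_phiJ_chiN 0) mulr0 addr0.
move=> h; apply: (mulfI A1_neq0); rewrite h -rmorphM /=; congr (_%:C).
by rewrite mulrCA mulfV ?mulr1// gt_eqF// ltr_wpDr.
Qed.

Lemma phiL_Hoo : Hoo (phiL A).
Proof.
apply/HpP; split; first exact: phiL_Loo.
move=> n n0; rewrite -[phiL A]conjL0K -[n]opprK -chiLJ -rmorphM /= I_conj.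
  rewrite mulrC; case: n n0 => [[//|m] _|//].
  by rewrite I_phiJ_chiN conjc0.
by apply: L1_Loo; [exact/Loo_L1/phiJ_Loo|exact: chiL_Loo].
Qed.

(* On H^oo this is evaluation at the point A / (1 + A) of the disc, hence
   multiplicative. *)
Definition ev h : R[i] := ((1 + A) / (2 * pi))%:C * I (h * phiJ).

Lemma pi_neq0 : pi != 0 :> R. Proof. by rewrite gt_eqF// pi_gt0. Qed.

Lemma A1_neq0R : 1 + A != 0. Proof. by rewrite gt_eqF// ltr_wpDr. Qed.

Lemma ev_alg (a : R[i]) : ev a%:A = a.
Proof.
rewrite /ev mulr_algl IZ; last exact/Loo_L1/phiJ_Loo.
rewrite I_phiJ mulrCA -rmorphM /=.
rewrite (_ : (1 + A) / (2 * pi) * (2 * pi / (1 + A)) = 1) ?mulr1//.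
by move: pi_neq0 A1_neq0R; move: (@pi R) => p p0 a0; field; rewrite a0.
Qed.

Lemma ev_I h : I (h * phiJ) = ev h * I phiJ.
Proof.
rewrite /ev I_phiJ mulrAC -rmorphM /=.
rewrite (_ : (1 + A) / (2 * pi) * (2 * pi / (1 + A)) = 1) ?mul1r//.
by move: pi_neq0 A1_neq0R; move: (@pi R) => p p0 a0; field; rewrite a0.
Qed.

(** Put H = h - ev h. By induction on j >= 0, H times the conjugate of phi has zero integral against
    chi_j: for j = 0 by the choice of the constant, and then by [phiJ_rec], whose first term
    vanishes because H is analytic. It therefore annihilates H^2. *)
Lemma ev_mulH2 h g : Hoo h -> H2s g -> I (h * g * phiJ) = ev h * I (g * phiJ).
Proof.
move=> hh gg; have /HpP[hoo h0] := hh; have /HpP[g2 _] := gg.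
pose H := h - (ev h)%:A.
have Hoo' : Loo H by apply: LooD => //; exact/LooN/Loo_alg.
have HP : Hoo H.
  have [cC cD _ _] := Hoo_closed R.
  by rewrite /H -scaleN1r; apply: cD => //; exact/(bounded_closedZ (Hoo_closed R))/cC.
have /HpP[_ H0] := HP.
have Q0 (j : nat) : I (H * phiJ * chiL R j) = 0.
  elim: j => [|j ih].
    rewrite chiL0 mulr1 /H mulrBl mulr_algl IB.
    - by rewrite IZ ?ev_I ?subrr//; exact/Loo_L1/phiJ_Loo.
    - by apply/Loo_L1/LooM => //; exact: phiJ_Loo.
    - exact/Loo_L1/LooZ/phiJ_Loo.
  have := phiJ_rec (Loo_L1 (LooM Hoo' (chiL_Loo R j.+1))).
  rewrite H0// add0r -(mulrA H _ (chiL R (- 1) * phiJ)) (mulrA (chiL R j.+1)) -chiLD.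
  rewrite (_ : j.+1%:Z + -1 = j); last by rewrite intS addrC addKr.
  rewrite [chiL R j * _]mulrC (mulrA H) ih mulr0 mulrAC => /eqP.
  by rewrite mulf_eq0 (negbTE A1_neq0) => /eqP.
have := I_analytic_eq0 (Loo_L2 (LooM Hoo' phiJ_Loo)) Q0 gg.
have gp : L1 (g * phiJ) by apply: L1_Loo phiJ_Loo; exact: L2_L1.
rewrite /H mulrAC mulrBl mulr_algl mulrBl IB; last 2 first.
- by rewrite -mulrA; apply: Loo_Lp.
- by rewrite -scalerAl; exact: Lp_Z.
by move/eqP; rewrite subr_eq0 -scalerAl IZ// => /eqP.
Qed.

Lemma ev_mul h g : Hoo h -> Hoo g -> ev (h * g) = ev h * ev g.
Proof.
move=> hh hg; have gg := Hoo_H2 hg.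
by rewrite {1}/ev ev_mulH2// mulrCA.
Qed.

Lemma ev_add h g : Loo h -> Loo g -> ev (h + g) = ev h + ev g.
Proof.
move=> hh hg; rewrite /ev (mulrDl h g) ID ?mulrDr//.
  exact/Loo_L1/LooM/phiJ_Loo.
exact/Loo_L1/LooM/phiJ_Loo.
Qed.

Lemma ev_Z (a : R[i]) h : Loo h -> ev (a *: h) = a * ev h.
Proof.
move=> hh; rewrite /ev -(scalerAl a h phiJ) IZ; first exact: mulrCA.
exact/Loo_L1/LooM/phiJ_Loo.
Qed.

Lemma ev_1 : ev 1 = 1. Proof. by rewrite -(scale1r 1) ev_alg. Qed.

Lemma ev_exp h n : Hoo h -> ev (h ^+ n) = ev h ^+ n.
Proof.
move=> hh; elim: n => [|n ih]; first by rewrite !expr0 ev_1.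
by rewrite !exprS ev_mul ?ih//; exact: bounded_closedX (Hoo_closed R) _ _ _.
Qed.

Lemma chi1_Hoo : Hoo (chiL R 1).
Proof.
apply/HpP; split; first exact: chiL_Loo.
by move=> n n0; rewrite -chiLD I_chi// gt_eqF// ltr_wpDl.
Qed.

Lemma ev_chi : ev (chiL R 1) = (A / (1 + A))%:C.
Proof.
have A1 : 1 + A != 0 by rewrite gt_eqF// ltr_wpDr.
rewrite /ev; have := phiJ_rec (Loo_L1 (chiL_Loo R 1)).
rewrite I_chi// add0r mulrA -chiLD subrr chiL0 mul1r I_phiJ -rmorphM /= => h.
apply: (mulfI A1_neq0); rewrite mulrCA h -!rmorphM /=; congr (_%:C).
by move: pi_neq0 A1_neq0R; move: (@pi R) => p p0 a0; field; rewrite a0.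
Qed.

End FixedA.
End Kernel.

(** * Unit kernels: overlap, weak convergence and concentration *)

Section NormalizedKernel.
Variable R : realType.
Local Notation T := (measurableTypeR R).
Implicit Types (f g h u : L0 R) (A B : R).
Local Notation L2 := (Lp R 2%:E).
Local Notation L1 := (Lp R 1%E).
Local Notation Loo := (Lp R +oo%E).
Local Notation H2s := (Hp R 2%:E).
Local Notation Hoo := (Hp R +oo%E).

(** [ev A] is applied to (1 + B) phi_B - B chi_1 phi_B = 1; multiplicativity and the value at chi_1
    leave a linear equation for the unknown. *)
Lemma ev_phi A B : 0 <= A -> 0 <= B -> ev A (phiL B) = ((1 + B / (1 + A))^-1)%:C.
Proof.
move=> A0 B0; have A1 := A1_neq0R A0.
have hB := phiL_Hoo B0; have LB := phiL_Loo B0.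
have Lc : Loo (chiL R 1 * phiL B) by apply: LooM => //; exact: chiL_Loo.
have := congr1 (ev A) (phiL_chi B0).
rewrite -scaleNr ev_add//; [|exact: LooZ|exact: LooZ].
rewrite !ev_Z// ev_mul//; last exact: chi1_Hoo.
rewrite ev_chi// ev_1// => h.
have q0 : 1 + B / (1 + A) != 0 by rewrite gt_eqF// ltr_wpDr// divr_ge0// addr_ge0.
have {}h : (1 + B / (1 + A))%:C * ev A (phiL B) = 1.
  rewrite -h mulrA -mulrDl -rmorphN -rmorphM -rmorphD; congr (_%:C * _) => /=.
  by field.
have q0' : (1 + B / (1 + A))%:C != 0 :> R[i] by rewrite -nc_eq0 nc_real normr_eq0.
apply: (mulfI q0'); rewrite h -rmorphM /= mulfV//.
Qed.

Lemma I_phi_phiJ A B : 0 <= A -> 0 <= B ->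
  I (phiL A * conjL0 (phiL B)) = (2 * pi / (1 + A + B))%:C.
Proof.
move=> A0 B0; rewrite ev_I// ev_phi// I_phiJ// -rmorphM /=; congr (_%:C).
have B1 := A1_neq0R B0.
have AB : 1 + A + B != 0 by rewrite gt_eqF// ltr_wpDr// ltr_wpDr.
have AB' : 1 + B + A != 0 by rewrite addrAC.
by move: (2 * pi) => p; field; rewrite ?AB ?AB' ?B1.
Qed.

(** The inverse of the L^2 norm of [phiL A], whose square is 2 pi / (1 + 2 A) by [I_phi_phiJ]. *)
Definition kscale A : R := Num.sqrt ((1 + 2 * A) / (2 * pi)).
Definition kern A : L0 R := (kscale A)%:C *: phiL A.

Lemma kscale_ge0 A : 0 <= kscale A. Proof. exact: sqrtr_ge0. Qed.

Lemma kscale_sqr A : 0 <= A -> kscale A ^+ 2 = (1 + 2 * A) / (2 * pi).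
Proof.
move=> A0; rewrite sqr_sqrtr// divr_ge0// ?addr_ge0 ?mulr_ge0//.
exact: pi_ge0.
Qed.

Section FixedA.
Variables (A : R) (A0 : 0 <= A).

Lemma kern_Hoo : Hoo (kern A).
Proof. exact/(bounded_closedZ (Hoo_closed R))/phiL_Hoo. Qed.

Lemma kern_Loo : Loo (kern A). Proof. by have /HpP[] := kern_Hoo. Qed.
Lemma kern_L2 : L2 (kern A). Proof. exact/Loo_L2/kern_Loo. Qed.

Lemma kern_conj : conjL0 (kern A) = (kscale A)%:C *: conjL0 (phiL A).
Proof. by rewrite conjL0Z conj_realC. Qed.

Lemma kern_ev h g : Hoo h -> H2s g ->
  I (h * g * conjL0 (kern A)) = ev A h * I (g * conjL0 (kern A)).
Proof.
move=> hh gg; have /HpP[g2 _] := gg; have /HpP[hL _] := hh.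
have pL : L2 (conjL0 (phiL A)) by exact/Loo_L2/phiJ_Loo.
rewrite kern_conj -(scalerAr _ (h * g)) -(scalerAr _ g) !IZ ?ev_mulH2//; last 2 first.
- exact: L2M.
- by apply: L2M => //; exact: Loo_mulL2.
exact: mulrCA.
Qed.
End FixedA.

Lemma I_kern A B : 0 <= A -> 0 <= B -> I (kern A * conjL0 (kern B)) =
  (kscale A * kscale B * (2 * pi / (1 + A + B)))%:C.
Proof.
move=> A0 B0; rewrite kern_conj// -(scalerAl _ (phiL A)) -(scalerAr _ (phiL A)).
have h : L1 (phiL A * conjL0 (phiL B)).
  by apply/Loo_L1/LooM; [exact: phiL_Loo|exact: phiJ_Loo].
rewrite IZ; last exact: Lp_Z.
by rewrite IZ// I_phi_phiJ// !rmorphM /= mulrA.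
Qed.

Lemma I_kern_sqr A : 0 <= A -> I (kern A * conjL0 (kern A)) = 1.
Proof.
move=> A0; rewrite I_kern// -expr2 kscale_sqr//.
rewrite -addrA (_ : A + A = 2 * A); last by rewrite mulr_natl.
have p0 := pi_neq0 R; have A1 : 1 + 2 * A != 0 by rewrite gt_eqF// ltr_wpDr// mulr_ge0.
have -> : (1 + 2 * A) / (2 * pi) * (2 * pi / (1 + 2 * A)) = 1.
  by move: p0; move: (@pi R) => p p0; field; rewrite A1.
by [].
Qed.

Lemma N2_kern A : 0 <= A -> N2 (kern A) = 1.
Proof.
move=> A0; have := inner_sqr (kern_L2 A0); rewrite I_kern_sqr// => /(congr1 (@complex.Re R)) /= h.
by apply/eqP; rewrite -(@eqrXn2 _ 2) ?N2_ge0// -h expr1n.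
Qed.

Lemma ev_kern A h : 0 <= A -> Hoo h -> ev A h = I (h * kern A * conjL0 (kern A)).
Proof.
by move=> A0 hh; rewrite kern_ev ?I_kern_sqr ?mulr1//; exact/Hoo_H2/kern_Hoo.
Qed.

(** A maximum principle: [ev A h] is the diagonal coefficient of the multiplication by h at a unit
    vector. *)
Lemma nc_ev_le A h (M : R) : 0 <= A -> Hoo h -> {ae mu, forall t, nc (h t) <= M} ->
  nc (ev A h) <= M.
Proof.
move=> A0 hh hM; rewrite ev_kern//; have k2 := kern_L2 A0.
have /HpP[hL _] := hh.
apply: le_trans (cauchy_schwarz _ _) _; [exact: Loo_mulL2|exact: L2_conj|].
rewrite N2_conj// N2_kern// mulr1; apply: le_trans (N2_Loo k2 hM) _.
by rewrite N2_kern// mulr1.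
Qed.

Lemma nc_I_kern_le A h (M : R) : 0 <= A -> Hoo h -> {ae mu, forall t, nc (h t) <= M} ->
  nc (I (h * conjL0 (kern A))) <= M * (kscale A * (2 * pi / (1 + A))).
Proof.
move=> A0 hh hM; rewrite kern_conj// -(scalerAr _ h) IZ; last first.
  by apply/Loo_L1/LooM; [case/HpP: hh|exact: phiJ_Loo].
rewrite ev_I// I_phiJ//; move: (ev A h) (nc_ev_le A0 hh hM) => z zM.
rewrite !Normc.normcM !nc_real.
rewrite (ger0_norm (kscale_ge0 A)) ger0_norm; last first.
  by rewrite divr_ge0 ?mulr_ge0 ?pi_ge0// addr_ge0.
rewrite (mulrCA (kscale A)); apply: ler_wpM2r zM.
by rewrite mulr_ge0 ?kscale_ge0// divr_ge0 ?mulr_ge0 ?pi_ge0// addr_ge0.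
Qed.

(* [kA n] places the kernel at the point 1 - 2^-n of the disc. *)
Definition kA (n : nat) : R := 2 ^+ n - 1.

Lemma kA_ge0 n : 0 <= kA n.
Proof. by rewrite subr_ge0 exprn_ege1// ler1n. Qed.

Lemma kA1 n : 1 + kA n = 2 ^+ n. Proof. by rewrite /kA addrC subrK. Qed.

Definition kn (n : nat) : L0 R := kern (kA n).

Lemma sqrt_half_decay : (fun n => Num.sqrt 2^-1 ^+ n) @ \oo --> (0 : R).
Proof.
apply: cvg_expr; rewrite ger0_norm ?sqrtr_ge0// -{2}(@sqrtr1 R) ltr_sqrt//.
by rewrite invf_lt1// ltr1n.
Qed.

(** These numbers are the integrals of the conjugates of the k_n. Since 1 + [kA n] = 2^n, they are
    at most of order 2^(-n/2). *)
Lemma kn_decay : (fun n => kscale (kA n) * (2 * pi / (1 + kA n))) @ \oo --> (0 : R).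
Proof.
have h : (fun n => 2 * pi * (Num.sqrt 2^-1) ^+ n) @ \oo --> (0 : R).
  rewrite -(mulr0 (2 * pi)); apply: cvgM; first exact: cvg_cst.
  exact: sqrt_half_decay.
apply: (squeeze_cvgr (f := cst 0) (h := fun n => 2 * pi * (Num.sqrt 2^-1) ^+ n)) h; last exact: cvg_cst.
apply: nearW => n; have A0 := kA_ge0 n; have p0 := @pi_ge0 R.
apply/andP; split.
  by rewrite mulr_ge0 ?kscale_ge0// divr_ge0 ?mulr_ge0// addr_ge0.
rewrite mulrCA ler_wpM2l ?mulr_ge0//.
have A1 : 0 < 1 + kA n by rewrite ltr_wpDr.
rewrite ler_pdivrMr// -(@ler_pXn2r _ 2)// ?nnegrE ?kscale_ge0//; last first.
  by rewrite mulr_ge0 ?exprn_ge0 ?sqrtr_ge0 ?ltW.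
rewrite kscale_sqr// exprMn -exprM mulnC exprM sqr_sqrtr ?invr_ge0//.
rewrite [X in _ <= X * _](_ : _ = (1 + kA n)^-1); last by rewrite kA1 exprVn.
rewrite expr2 mulrA mulVf ?gt_eqF// mul1r ler_pdivrMr; last by rewrite mulr_gt0// pi_gt0.
have := @pi_ge2 R; nra.
Qed.

(** For a partial Fourier sum p of g, the integral is a value of p in the disc, bounded by sup |p|,
    times the quantity of [kn_decay]. The remainder g - p is small in L^2 norm and the k_n are unit
    vectors. *)
Lemma kn_weak g : H2s g -> (fun n => nc (I (g * conjL0 (kn n)))) @ \oo --> (0 : R).
Proof.
move=> gg; have /HpP[g2 _] := gg; apply/cvgr0Pnorm_le => e e0.
have e20 : 0 < e / 2 by rewrite divr_gt0.
have /cvgr0Pnorm_le/(_ _ e20)[m _ /(_ m (leqnn m))] := fsum_cvg gg.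
rewrite ger0_norm ?N2_ge0// => gm; set p := fsum g m in gm.
have pL : Loo p by exact: fsum_Loo.
have pH : Hoo p.
  apply/HpP; split => // k k0; rewrite I_fsum_chi.
  by rewrite leNgt k0.
have /LooP[M M0 pM] := pL.
have h : (fun n => M * (kscale (kA n) * (2 * pi / (1 + kA n)))) @ \oo --> (0 : R).
  by rewrite -(mulr0 M); apply: cvgM; [exact: cvg_cst|exact: kn_decay].
have /cvgr0Pnorm_le/(_ _ e20) := h; apply: filterS => n hn.
rewrite ger0_norm ?nc_ge0//; have A0 := kA_ge0 n; have k2 := kern_L2 A0.
have -> : g = p - (p - g) by rewrite subKr.
rewrite mulrBl IB; last 2 first.
- exact: L2M (Loo_L2 pL) (L2_conj k2).
- exact: L2M (L2_sub (Loo_L2 pL) g2) (L2_conj k2).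
apply: le_trans (ncB _ _) _; rewrite (splitr e); apply: lerD.
  by apply: le_trans (nc_I_kern_le A0 pH pM) _; apply: le_trans hn; exact: ler_norm.
apply: le_trans (cauchy_schwarz (L2_sub (Loo_L2 pL) g2) (L2_conj k2)) _.
by rewrite N2_conj// N2_kern// mulr1.
Qed.

(** Since [kA n.+1] = 1 + 2 [kA n], the squared inner product is (1 + 2 A) (3 + 4 A) / (2 + 3 A)^2
    with A = [kA n], which is at least 1/4 for every A >= 0. *)
Lemma kn_overlap n : exists2 q : R, 2^-1 <= q &
  I (kn n * conjL0 (kn n.+1)) = q%:C.
Proof.
have A0 := kA_ge0 n; have B0 := kA_ge0 n.+1.
exists (kscale (kA n) * kscale (kA n.+1) * (2 * pi / (1 + kA n + kA n.+1))); last exact: I_kern.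
have BE : kA n.+1 = 1 + 2 * kA n by rewrite /kA exprS; ring.
set A := kA n in A0 BE *; rewrite BE in B0 *.
have p0 := @pi_gt0 R; have q0 : 0 <= 2 * pi / (1 + A + (1 + 2 * A)).
  by rewrite divr_ge0 ?mulr_ge0 ?(ltW p0)// addr_ge0// addr_ge0.
have Q0 : 0 <= kscale A * kscale (1 + 2 * A) * (2 * pi / (1 + A + (1 + 2 * A))).
  by apply: mulr_ge0 q0; apply: mulr_ge0; exact: kscale_ge0.
rewrite -(@ler_pXn2r _ 2)// ?nnegrE ?invr_ge0//.
rewrite 2!exprMn !kscale_sqr//; move: p0; move: (@pi R) => p p0.
have -> : (1 + 2 * A) / (2 * p) * ((1 + 2 * (1 + 2 * A)) / (2 * p)) *
    (2 * p / (1 + A + (1 + 2 * A))) ^+ 2 = (1 + 2 * A) * (3 + 4 * A) / (2 + 3 * A) ^+ 2.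
  field; rewrite (gt_eqF p0) /= andbT gt_eqF//; lra.
rewrite ler_pdivlMr; last by rewrite exprn_gt0//; lra.
nra.
Qed.

Lemma absL0_exists f : exists g, {ae mu, forall t, g t = (nc (f t))%:C}.
Proof.
have m0 : measurable_fun setT (cst 0 : T -> R) by exact: measurable_cst.
exact: L0_mk (measurable_cabs (L0_meas f)) m0.
Qed.

(** |1 - chi_1|^2 = (1 - chi_1) + (1 - chi_(-1)), and both chi_1 and its conjugate have mean A / (1
    + A) against |k|^2. The kernel thus concentrates at the point 1 as A grows. *)
Lemma N2_chi_kern A : 0 <= A -> N2 ((1 - chiL R 1) * kern A) ^+ 2 = 2 / (1 + A).
Proof.
move=> A0; have k2 := kern_L2 A0; have kL := kern_Loo A0.
have c1 : Loo (1 - chiL R 1) by apply: LooD; [exact: Loo1|exact/LooN/chiL_Loo].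
have L2k : L2 ((1 - chiL R 1) * kern A) by exact: Loo_mulL2.
apply: complexI; rewrite -inner_sqr// rmorphM rmorphB rmorph1 /= chiLJ.
set k := kern A in k2 kL L2k *.
have kk a : Loo a -> L1 (a * k * conjL0 k).
  by move=> aL; apply: L2M; [exact: Loo_mulL2|exact: L2_conj].
have -> : (1 - chiL R 1) * k * ((1 - chiL R (- 1)) * conjL0 k) =
  (1 - chiL R 1) * k * conjL0 k + (1 - chiL R (- 1)) * k * conjL0 k.
  rewrite mulrACA -!(mulrA _ k) -mulrDl; congr (_ * _).
  rewrite mulrBr mulr1 mulrBl mul1r -chiLD subrr chiL0.
  by rewrite opprB.
have Ek (a : int) : I ((1 - chiL R a) * k * conjL0 k) = 1 - I (chiL R a * k * conjL0 k).
  rewrite mulrBl mulrBl mul1r IB; [|exact: L2M k2 (L2_conj k2)|exact/kk/chiL_Loo].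
  by rewrite I_kern_sqr.
have E1 : I (chiL R 1 * k * conjL0 k) = (A / (1 + A))%:C.
  by rewrite -ev_kern ?ev_chi//; exact: chi1_Hoo.
have EN : I (chiL R (- 1) * k * conjL0 k) = (A / (1 + A))%:C.
  rewrite -conj_realC -E1 -I_conj; last exact/kk/chiL_Loo.
  rewrite (rmorphM (@conjL0 R) (chiL R 1 * k)) (rmorphM (@conjL0 R) (chiL R 1)) /=.
  by rewrite chiLJ conjL0K mulrAC.
rewrite ID; [|apply: kk|apply: kk]; last 2 first.
- by apply: LooD; [exact: Loo1|exact/LooN/chiL_Loo].
- by apply: LooD; [exact: Loo1|exact/LooN/chiL_Loo].
rewrite !Ek E1 EN -(rmorph1 (real_complex R)) -rmorphB -rmorphD; congr (_%:C) => /=.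
by have A1 := A1_neq0R A0; field.
Qed.

Lemma continuous_nc (g : R -> R[i]) (t : R) : {for t, continuous (g : R -> R[i]^o)} ->
  (fun s => nc (g s - g t)) @ t --> (0 : R).
Proof.
move=> /cvgrPdist_lt h; apply/cvgr0Pnorm_lt => e e0.
have := h e%:C; rewrite ltcR => /(_ e0); apply: filterS => s.
by rewrite (ger0_norm (nc_ge0 _)) nc_distC -ltcR.
Qed.

Lemma continuous_nc0 (g : R -> R[i]) (t : R) : {for t, continuous (g : R -> R[i]^o)} ->
  {for t, continuous (fun s => nc (g s))}.
Proof. by move=> /continuous_nc; exact: cvg_nc_norm. Qed.

Lemma nc_1Bchi (t : R) : nc (1 - chi 1 t) ^+ 2 = 2 * (1 - cos t).
Proof. by rewrite nc_sqr /chi mul1r /= sub0r sqrrN sin2cos2; ring. Qed.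

Lemma cos_lt1 (t : R) : 0 < t < 2 * pi -> cos t < 1.
Proof.
move=> /sin_half_gt0 st; have -> : t = (t / 2) *+ 2 by rewrite -mulr_natr divfK.
rewrite cos_mulr2n cos2sin2; have : 0 < sin (t / 2) ^+ 2 by rewrite exprn_gt0.
by rewrite -mulr_natr; lra.
Qed.

(** Near 0 and 2 pi continuity gives |g| <= e. On the remaining compact interval |1 - chi_1| has a
    positive minimum, and M is the maximum of |g| divided by it. *)
Lemma periodic_concentration (g : R -> R[i]) : continuous (g : R -> R[i]^o) ->
  g (2 * pi) = 0 -> g 0 = 0 -> forall e : R, 0 < e -> exists2 M, 0 <= M &
    forall t, 0 <= t <= 2 * pi -> nc (g t) <= e + M * nc (1 - chi 1 t).
Proof.
move=> cg g2 g0 e e0; have p0 := @pi_gt0 R.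
have ng t := continuous_nc0 (cg t).
have near0 (x : R) : g x = 0 -> exists2 d, 0 < d & forall t, `|t - x| < d -> nc (g t) <= e.
  move=> gx; have := ng x; move/cvgrPdist_le => /(_ e e0); rewrite gx Normc.normc0.
  move=> [d /= d0 h]; exists d => // t td; have := h t; rewrite /= distrC => /(_ td).
  by rewrite sub0r normrN ger0_norm ?nc_ge0.
have [d1 d10 h1] := near0 0 g0; have [d2 d20 h2] := near0 _ g2.
(* The bound d <= 1 makes the middle interval [d, 2 pi - d] nonempty. *)
pose d := Num.min (Num.min d1 d2) 1.
have d0 : 0 < d by rewrite !lt_min d10 d20 ltr01.
have d1' : d <= 1 by rewrite ge_min lexx orbT.
have dd1 : d <= d1 by rewrite !ge_min lexx.
have dd2 : d <= d2 by rewrite !ge_min lexx orbT.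
have pi2 := @pi_ge2 R.
have I0 : 0 <= 2 * pi :> R by lra.
have I1 : d <= 2 * pi - d by lra.
have [x _ xB] := EVT_max I0 (continuous_subspaceT ng).
have cc : continuous (fun t : R => nc (1 - chi 1 t)).
  have -> : (fun t : R => nc (1 - chi 1 t)) = (fun t => Num.sqrt (2 * (1 - cos t))).
    by apply/funext => t; rewrite -nc_1Bchi sqrtr_sqr ger0_norm ?nc_ge0.
  move=> t; apply: (continuous_comp (f := fun t : R => 2 * (1 - cos t))); last exact: sqrt_continuous.
  apply: cvgM; first exact: cvg_cst.
  by apply: cvgB; [exact: cvg_cst|exact: continuous_cos].
have [y yI yB] := EVT_min I1 (continuous_subspaceT cc).
have y0 : 0 < nc (1 - chi 1 y).
  rewrite -(@ltr_pXn2r _ 2)// ?nnegrE ?nc_ge0// expr0n nc_1Bchi mulr_gt0// subr_gt0.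
  apply: cos_lt1; move: yI; rewrite in_itv /= => /andP[? ?]; apply/andP; split; lra.
exists (nc (g x) / nc (1 - chi 1 y)); first by rewrite divr_ge0 ?nc_ge0.
move=> t t02; have q0 : 0 <= nc (g x) / nc (1 - chi 1 y) * nc (1 - chi 1 t).
  by rewrite mulr_ge0 ?divr_ge0 ?nc_ge0.
have [td|td] := ltP t d.
  have := h1 t; rewrite subr0 ger0_norm; last by case/andP: t02.
  by move=> /(_ (lt_le_trans td dd1)) => h; lra.
have [td'|td'] := ltP (2 * pi - d) t.
  have h : nc (g t) <= e.
    by apply: h2; case/andP: t02 => _ ?; rewrite ler0_norm; lra.
  by lra.
have h3 : nc (g t) <= nc (g x) by apply: xB; rewrite in_itv.
have h4 : nc (1 - chi 1 y) <= nc (1 - chi 1 t) by apply: yB; rewrite in_itv /= td.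
apply: (@le_trans _ _ (nc (g x))) => //.
rewrite -[X in X <= _]add0r; apply: lerD; first exact: ltW.
by rewrite mulrAC ler_pdivlMr// ler_wpM2l ?nc_ge0.
Qed.

(** The pointwise bound gives norm (c k_n) <= e / 2 + M norm ((1 - chi_1) k_n), and the last norm is
    computed by [N2_chi_kern]. *)
Lemma concentration (c : L0 R) (g : R -> R[i]) : continuous (g : R -> R[i]^o) ->
  g (2 * pi) = 0 -> g 0 = 0 -> {ae mu, forall t, c t = g t} ->
  Loo c /\ (fun n => N2 (c * kn n)) @ \oo --> (0 : R).
Proof.
move=> cg g2 g0 cE; have key := periodic_concentration cg g2 g0.
have c2 t : nc (1 - chi 1 t) <= 2 :> R.
  by apply: le_trans (ncB _ _) _; rewrite Normc.normc1 nc_chi.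
have cL : Loo c.
  have [M M0 gM] := key 1 ltr01; apply/LooP; exists (1 + M * 2).
    by rewrite addr_ge0// mulr_ge0.
  have tI := @ae_circle R (fun t : T => 0 <= t <= 2 * pi) (fun t tI => tI).
  apply: filterS2 cE tI => t -> /gM h; apply: le_trans h _.
  by rewrite lerD2l ler_wpM2l.
split=> //; apply/cvgr0Pnorm_le => e e0.
have e20 : 0 < e / 2 by rewrite divr_gt0.
have [M M0 gM] := key _ e20.
have h : (fun n => M * Num.sqrt (2 / (1 + kA n))) @ \oo --> (0 : R).
  have -> : (fun n => M * Num.sqrt (2 / (1 + kA n))) =
      (fun n => M * Num.sqrt 2 * Num.sqrt 2^-1 ^+ n).
    apply/funext => n; rewrite kA1 sqrtrM// -mulrA; congr (_ * (_ * _)).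
    elim: n => [|n ih]; first by rewrite !expr0 invr1 sqrtr1.
    by rewrite !exprS invfM sqrtrM ?invr_ge0// ih.
  rewrite -(mulr0 (M * Num.sqrt 2)); apply: cvgM; first exact: cvg_cst.
  exact: sqrt_half_decay.
have /cvgr0Pnorm_le/(_ _ e20) := h; apply: filterS => n hn.
rewrite ger0_norm ?N2_ge0//; have A0 := kA_ge0 n; have k2 := kern_L2 A0; have kL := kern_Loo A0.
have c1 : Loo (1 - chiL R 1) by apply: LooD; [exact: Loo1|exact/LooN/chiL_Loo].
have L2k : L2 ((1 - chiL R 1) * kn n) by exact: Loo_mulL2.
(* The moduli are taken as elements of L^2, so that the pointwise bound on |c k_n| can be followed
   by the triangle inequality for the norm. *)
have [a aE] := absL0_exists (kn n); have [b bE] := absL0_exists ((1 - chiL R 1) * kn n).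
have aN : {ae mu, forall t, nc (a t) <= nc (kn n t)}.
  by apply: filterS aE => t ->; rewrite nc_real ger0_norm ?nc_ge0.
have bN : {ae mu, forall t, nc (b t) <= nc (L0_fun ((1 - chiL R 1) * kn n) t)}.
  by apply: filterS bE => t ->; rewrite nc_real ger0_norm ?nc_ge0.
have a2 : L2 a by apply: Lp_le aN k2; exact: le12.
have b2 : L2 b by apply: Lp_le bN L2k; exact: le12.
rewrite (splitr e); apply: (@le_trans _ _ (N2 ((e / 2)%:C *: a + M%:C *: b))).
  apply: N2_le; first by apply: L2_add; exact: L2_scale.
  have tI := @ae_circle R (fun t : T => 0 <= t <= 2 * pi) (fun t tI => tI).
  apply: filterS3 (L0_ME c (kn n)) (filterI cE (filterI tI (filterI aE bE)))
    (filterI (L0_DE ((e / 2)%:C *: a) (M%:C *: b)) (filterI (L0_ZE (e / 2)%:C a) (filterI (L0_ZE M%:C b)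
    (filterI (L0_ME (1 - chiL R 1) (kn n)) (filterI (L0_BE 1 (chiL R 1)) (filterI (L0_1E R) (chiLE R 1))))))).
  move=> t -> [-> [/gM h' [aE' bE']]] [-> [-> [-> [m1 [m2 [m3 m4]]]]]].
  rewrite aE' bE' m1 m2 m3 m4.
  rewrite -!rmorphM -rmorphD nc_real ger0_norm; last first.
    by rewrite addr_ge0// mulr_ge0 ?nc_ge0// ltW.
  by rewrite !Normc.normcM mulrA -mulrDl ler_wpM2r ?nc_ge0.
apply: le_trans (N2D (L2_scale _ a2) (L2_scale _ b2)) _.
rewrite !N2Z// !nc_real ger0_norm ?(ltW e20)// (ger0_norm M0); apply: lerD.
  rewrite -[X in _ <= X]mulr1 ler_wpM2l ?(ltW e20)//.
  by apply: le_trans (N2_le k2 aN) _; rewrite N2_kern.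
apply: le_trans (le_trans (ler_norm _) hn); rewrite ler_wpM2l//.
apply: le_trans (N2_le L2k bN) _.
by rewrite -N2_chi_kern// sqrtr_sqr ger0_norm ?N2_ge0.
Qed.
End NormalizedKernel.

(** * Asymptotic eigenvectors *)

Section Asymptotics.
Variable R : realType.
Local Notation T := (measurableTypeR R).
Implicit Types (f h c : L0 R).
Local Notation L2s := (Lp R 2%:E).
Local Notation L1 := (Lp R 1%E).
Local Notation Loo := (Lp R +oo%E).
Local Notation H2s := (Hp R 2%:E).
Local Notation Hoo := (Hp R +oo%E).
Local Notation kn := (@kn R).
Local Notation H2 := (H2 R).

Local Notation "g ^L" := (Lp_val (H2_val g)) (at level 2, format "g ^L").

Lemma H2_L2 (g : H2) : L2s g^L. Proof. exact: LpP. Qed.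

Lemma H2_H2s (g : H2) : H2s g^L.
Proof. by case: g => g gP; exact: set_mem gP. Qed.

Lemma mkH2_exists (f : L0 R) : H2s f -> exists g : H2, g^L = f.
Proof.
move=> fH; have /HpP[f2 _] := fH; exists (MkH2 (mem_set (fH : [set g : L2 R | Hp R 2%:E g] (MkLp (mem_set f2))))).
by [].
Qed.

Lemma H2_inj (g k : H2) : g^L = k^L -> g = k.
Proof. by move=> gk; do 2 apply: val_inj. Qed.

Lemma kn_H2s n : H2s (kn n). Proof. exact/Hoo_H2/kern_Hoo/kA_ge0. Qed.

Definition kH n : H2 := xget 0 [set g : H2 | g^L = kn n].

Lemma kHE n : (kH n)^L = kn n.
Proof.
by rewrite /kH; case: xgetP => [g _ //|]; have [g gE] := mkH2_exists (kn_H2s n); move=> /(_ g).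
Qed.

Lemma inner_conj (g k : H2) : inner k g = conjc (inner g k).
Proof.
rewrite !innerE -I_conj; last exact/L2M/L2_conj/H2_L2/H2_L2.
by rewrite rmorphM /= conjL0K mulrC.
Qed.

Lemma inner_le (g k : H2) : nc (inner g k) <= N2 g^L * N2 k^L.
Proof.
rewrite innerE; apply: le_trans (cauchy_schwarz (H2_L2 g) (L2_conj (H2_L2 k))) _.
by rewrite N2_conj//; exact: H2_L2.
Qed.

Lemma N2_kH n : N2 (kH n)^L = 1. Proof. by rewrite kHE N2_kern//; exact: kA_ge0. Qed.

Lemma inner_kH n : inner (kH n) (kH n) = 1.
Proof. by rewrite innerE kHE I_kern_sqr//; exact: kA_ge0. Qed.

(* The weak form of: k_n is asymptotically an eigenvector of the operator with
   form b and of its adjoint. *)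
Definition asym_eigen (b : H2 -> H2 -> R[i]) : Prop :=
  forall e : R, 0 < e -> \forall n \near \oo, forall g : H2,
    nc (b g (kH n) - b (kH n) (kH n) * inner g (kH n)) <= e * N2 g^L /\
    nc (b (kH n) g - b (kH n) (kH n) * inner (kH n) g) <= e * N2 g^L.

(** Approximate eigenvalues may be guessed, and guessed differently on the two sides: testing with g
    = k_n shows that each guess is within e / 2 of the diagonal value. *)
Lemma asym_eigenW (b : H2 -> H2 -> R[i]) (l l' : nat -> R[i]) :
  (forall e : R, 0 < e -> \forall n \near \oo, forall g : H2,
    nc (b g (kH n) - l n * inner g (kH n)) <= e * N2 g^L) ->
  (forall e : R, 0 < e -> \forall n \near \oo, forall g : H2,
    nc (b (kH n) g - l' n * inner (kH n) g) <= e * N2 g^L) ->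
  asym_eigen b.
Proof.
move=> h h' e e0; have e20 : 0 < e / 2 by rewrite divr_gt0.
apply: filterS2 (h _ e20) (h' _ e20) => n hn hn' g.
have gk : nc (inner g (kH n)) <= N2 g^L.
  by apply: le_trans (inner_le _ _) _; rewrite N2_kH mulr1.
have kg : nc (inner (kH n) g) <= N2 g^L by rewrite inner_conj ncJ.
have aux (x d i : R[i]) (l0 : R[i]) : nc (x - l0 * i) <= e / 2 * N2 g^L ->
    nc (d - l0) <= e / 2 -> nc i <= N2 g^L -> nc (x - d * i) <= e * N2 g^L.
  move=> h1 h2 h3; have -> : x - d * i = (x - l0 * i) - (d - l0) * i by ring.
  apply: le_trans (ncB _ _) _; rewrite [X in _ <= X * _](splitr e) [X in _ <= X]mulrDl; apply: lerD => //.
  by rewrite Normc.normcM; apply: ler_pM => //; exact: nc_ge0.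
split.
  apply: aux (hn g) _ gk.
  by have := hn (kH n); rewrite inner_kH mulr1 N2_kH mulr1.
apply: aux (hn' g) _ kg.
by have := hn' (kH n); rewrite inner_kH mulr1 N2_kH mulr1.
Qed.

(** The value b (k_n, k_(n+1)) is estimated twice, with k_n and with k_(n+1) as the eigenvector: it
    is close to both diagonal values multiplied by the same overlap q >= 1/2. *)
Lemma asym_eigen_slow b : asym_eigen b ->
  (fun n => nc (b (kH n.+1) (kH n.+1) - b (kH n) (kH n))) @ \oo --> (0 : R).
Proof.
move=> hb; apply/cvgr0Pnorm_le => e e0; have e40 : 0 < e / 4 by rewrite divr_gt0.
have [N _ hN] := hb _ e40; exists N => // n /= Nn; rewrite ger0_norm ?nc_ge0//.
have [q q2 qE] := kn_overlap R n.
have [_] := hN n Nn (kH n.+1); have [+ _] := hN n.+1 (leqW Nn) (kH n).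
rewrite !N2_kH mulr1 innerE !kHE qE.
set x := b (kH n) (kH n.+1); set y := b (kH n.+1) _; set z := b _ _ => h1 h2.
have : nc ((y - z) * q%:C) <= e / 2.
  have -> : (y - z) * q%:C = (x - z * q%:C) - (x - y * q%:C) by ring.
  by apply: le_trans (ncB _ _) _; lra.
rewrite Normc.normcM nc_real ger0_norm; last by lra.
by have := nc_ge0 (y - z); nra.
Qed.

Lemma N2_eq f h : L2s f -> {ae mu, forall t, nc (f t) = nc (h t)} -> N2 f = N2 h.
Proof.
move=> f2 fh; have h2 : L2s h.
  by apply: Lp_le f2; [exact: le12|apply: filterS fh => t ->].
apply/eqP; rewrite eq_le; apply/andP; split; apply: N2_le => //.
  by apply: filterS fh => t ->.
by apply: filterS fh => t ->.
Qed.

(** The value at the point 1 of the continuous part is moved to the analytic part, so that the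
    remaining continuous function vanishes where the k_n concentrate. *)
Lemma H_plus_CP f : H_plus_C R f -> exists h c, [/\ Hoo h, Loo c,
  f = h + c & (fun n => N2 (c * kn n)) @ \oo --> (0 : R)].
Proof.
move=> [h hH [c [g [cg gp] cE] <-]].
pose c0 := g 0; pose g1 t := g t - c0.
have g1c : continuous (g1 : R -> R[i]^o).
  by move=> t; apply: cvgB; [exact: cg|exact: cvg_cst].
have g10 : g1 0 = 0 by rewrite /g1 subrr.
have g12 : g1 (2 * pi) = 0 by rewrite /g1 -[2 * pi]add0r gp subrr.
have c1E : {ae mu, forall t, L0_fun (c - c0%:A) t = g1 t}.
  by apply: filterS3 (L0_BE c c0%:A) cE (L0_algE c0) => t -> -> ->.
have [c1L c1N] := concentration g1c g12 g10 c1E.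
exists (h + c0%:A), (c - c0%:A); split => //; last by rewrite addrACA subrr addr0.
by have [cC cD _ _] := Hoo_closed R; exact: cD.
Qed.

Lemma H_plus_C_Loo f : H_plus_C R f -> Loo f.
Proof. by move=> /H_plus_CP[h [c [/HpP[hL _] cL -> _]]]; exact: LooD. Qed.

Lemma QC_Loo f : QC R f -> Loo f. Proof. by case=> /H_plus_C_Loo. Qed.

Lemma QC_conj f : QC R f -> QC R (conjL0 f).
Proof. by move=> [h1 [g h2 gf]]; split; [rewrite -gf conjL0K|exists f]. Qed.

(** The form of the Toeplitz operator with symbol f: the projection disappears when the second
    argument is in H^2. *)
Definition mform f (g k : H2) : R[i] := I (f * g^L * conjL0 k^L).

(** The analytic part h gives exactly [ev h] by [kern_ev]; the other part contributes at most norm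
    (c k_n) times the norm of g. *)
Lemma H_plus_C_eigen f : H_plus_C R f -> exists l : nat -> R[i],
  forall e : R, 0 < e -> \forall n \near \oo, forall g : H2,
    nc (mform f g (kH n) - l n * inner g (kH n)) <= e * N2 g^L.
Proof.
move=> /H_plus_CP[h [c [hH cL -> cN]]]; exists (fun n => ev (kA R n) h) => e e0.
have /cvgr0Pnorm_le/(_ _ e0) := cN; apply: filterS => n; rewrite ger0_norm ?N2_ge0// => hn g.
have /HpP[hL _] := hH; have g2 := H2_L2 g; have k2 := L2_conj (H2_L2 (kH n)).
rewrite /mform (mulrDl h c) (mulrDl (h * g^L)) ID; last 2 first.
- by apply: L2M => //; exact: Loo_mulL2.
- by apply: L2M => //; exact: Loo_mulL2.
rewrite innerE kHE kern_ev//; [|exact: kA_ge0|exact: H2_H2s].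
rewrite addrAC subrr add0r (mulrC c) -mulrA (mulrC c).
have ck2 : L2s (c * kn n) by apply: Loo_mulL2 => //; exact/kern_L2/kA_ge0.
have E : N2 (conjL0 (kn n) * c) = N2 (c * kn n).
  apply/esym/N2_eq => //.
  apply: filterS3 (L0_ME c (kn n)) (L0_ME (conjL0 (kn n)) c) (conjL0E (kn n)) => t -> -> ->.
  by rewrite !Normc.normcM ncJ mulrC.
apply: le_trans (cauchy_schwarz _ _) _ => //.
  by rewrite mulrC; apply: Loo_mulL2 => //; rewrite -kHE.
by rewrite E mulrC ler_wpM2r ?N2_ge0// (le_trans (ler_norm _)) ?ger0_norm ?N2_ge0.
Qed.

Lemma mform_conj f (g k : H2) : Loo f -> mform f k g = conjc (mform (conjL0 f) g k).
Proof.
move=> fL; rewrite /mform -I_conj.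
  by rewrite (rmorphM (@conjL0 R) (conjL0 f * g^L)) (rmorphM (@conjL0 R) (conjL0 f)) /= !conjL0K mulrAC.
apply: L2M; last exact/L2_conj/H2_L2.
by apply: Loo_mulL2 (H2_L2 g); exact/Lp_conj/fL/le1oo.
Qed.

Lemma conjcB (z w : R[i]) : conjc (z - w) = conjc z - conjc w.
Proof. exact: (rmorphB (@conjc R)). Qed.

Lemma conjcM (z w : R[i]) : conjc (z * w) = conjc z * conjc w.
Proof. exact: (rmorphM (@conjc R)). Qed.

(** The estimate on the second side is the one on the first side for the conjugate symbol, which
    lies in H^oo + C too. *)
Lemma QC_eigen f : QC R f -> asym_eigen (mform f).
Proof.
move=> fQ; have [l hl] := H_plus_C_eigen (proj1 fQ).
have [l' hl'] := H_plus_C_eigen (proj1 (QC_conj fQ)).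
apply: (@asym_eigenW _ l (fun n => conjc (l' n))) => // e e0.
apply: filterS (hl' e e0) => n h g.
rewrite mform_conj; last exact: QC_Loo.
by rewrite inner_conj -conjcM -conjcB ncJ.
Qed.

Lemma mform_kH_le f (M : R) n : Loo f -> {ae mu, forall t, nc (f t) <= M} ->
  nc (mform f (kH n) (kH n)) <= M.
Proof.
move=> fL fM; rewrite /mform; have k2 := H2_L2 (kH n).
apply: le_trans (cauchy_schwarz (Loo_mulL2 fL k2) (L2_conj k2)) _.
rewrite N2_conj// N2_kH mulr1; apply: le_trans (N2_Loo k2 fM) _.
by rewrite N2_kH mulr1.
Qed.

Lemma mformB f h (g k : H2) : Loo f -> Loo h -> mform (f - h) g k = mform f g k - mform h g k.
Proof.
move=> fL hL; rewrite /mform (mulrBl _ f h) (mulrBl _ (f * g^L)) IB//.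
- by apply: L2M; [exact: Loo_mulL2 (H2_L2 g)|exact/L2_conj/H2_L2].
- by apply: L2M; [exact: Loo_mulL2 (H2_L2 g)|exact/L2_conj/H2_L2].
Qed.

(** Write g = h + c as in [H_plus_CP]. Then 1 = (f g k_n, k_n) is close to (f h k_n, k_n), since c
    k_n is small, and the latter is close to L (h k_n, k_n), since h k_n is in H^2 and k_n is nearly
    an eigenvector of the adjoint. So |L| times a bound of h cannot be small. *)
Lemma QC_inv_lower f g : QC R f -> QC R g -> f * g = 1 ->
  exists2 d : R, 0 < d & \forall n \near \oo, d <= nc (mform f (kH n) (kH n)).
Proof.
move=> fQ gQ fg1; have fL := QC_Loo fQ; have /LooP[F F0 fF] := fL.
have [h [c [hH cL gE cN]]] := H_plus_CP (proj1 gQ).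
have /HpP[hL _] := hH; have /LooP[M M0 hM] := hL.
have M1 : 0 < M + 1 by rewrite ltr_wpDl.
have F1 : 0 < F + 1 by rewrite ltr_wpDl.
(* Each error is made at most 1/4: the first is multiplied by the norm of h k_n, at most M, the
   second by F, a bound of |f|. There remains 1/2 <= |L| M, and M + 1 and F + 1 are used to divide
   by positive numbers. *)
have e1 : 0 < (4 * (M + 1))^-1 by rewrite invr_gt0 mulr_gt0.
have e2 : 0 < (4 * (F + 1))^-1 by rewrite invr_gt0 mulr_gt0.
exists (2 * (M + 1))^-1; first by rewrite invr_gt0 mulr_gt0.
have /cvgr0Pnorm_le/(_ _ e2) cN' := cN.
apply: filterS2 (QC_eigen fQ e1) cN' => n; rewrite ger0_norm ?N2_ge0// => hn cn.
have k2 := H2_L2 (kH n); have kc := L2_conj k2.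
have [x xE] := mkH2_exists (Hoo_mulH2 hH (H2_H2s (kH n))).
have [xn _] := hn x; set L := mform f (kH n) (kH n) in xn *.
have E1 : 1 = mform f x (kH n) + I (f * (c * kn n) * conjL0 (kH n)^L).
  rewrite /mform xE -ID.
  - by rewrite -mulrDl -mulrDr -kHE -mulrDl -gE mulrA fg1 mul1r -innerE inner_kH.
  - by apply: L2M kc; apply: Loo_mulL2 => //; rewrite -xE; exact: H2_L2.
  - by apply: L2M kc; apply: Loo_mulL2 => //; apply: Loo_mulL2 => //; rewrite -kHE.
have N2x : N2 x^L <= M by rewrite xE; apply: le_trans (N2_Loo k2 hM) _; rewrite N2_kH mulr1.
have small : nc (I (f * (c * kn n) * conjL0 (kH n)^L)) <= 4^-1.
  have ck2 : L2s (c * kn n) by apply: Loo_mulL2 => //; rewrite -kHE.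
  apply: le_trans (cauchy_schwarz (Loo_mulL2 fL ck2) kc) _.
  rewrite N2_conj// N2_kH mulr1; apply: le_trans (N2_Loo ck2 fF) _.
  apply: (@le_trans _ _ ((F + 1) * (4 * (F + 1))^-1)).
    apply: ler_pM => //; [exact: N2_ge0|by rewrite lerDl].
  by rewrite invfM mulrCA mulfV ?mulr1// gt_eqF.
have xi : nc (inner x (kH n)) <= M.
  by apply: le_trans (inner_le _ _) _; rewrite N2_kH mulr1.
have xn' : nc (mform f x (kH n) - L * inner x (kH n)) <= 4^-1.
  apply: le_trans xn _; apply: (@le_trans _ _ ((4 * (M + 1))^-1 * (M + 1))).
    apply: ler_wpM2l; first exact: ltW.
    by apply: le_trans N2x _; rewrite lerDl.
  by rewrite invfM -mulrA mulVf ?mulr1// gt_eqF.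
have tot : 1 <= nc L * M + 4^-1 + 4^-1.
  rewrite -{1}(@Normc.normc1 R) E1.
  apply: le_trans (ncD _ _) _; apply: lerD => //.
  rewrite -(subrK (L * inner x (kH n)) (mform f x (kH n))).
  apply: le_trans (ncD _ _) _; rewrite addrC; apply: lerD => //.
  by rewrite Normc.normcM ler_wpM2l ?nc_ge0.
rewrite -[X in X <= _]mulr1 mulrC ler_pdivrMr ?mulr_gt0//.
have := nc_ge0 L; nra.
Qed.
End Asymptotics.

(** * The Toeplitz algebra *)

Section Operators.
Variable R : realType.
Local Notation H2 := (H2 R).
Local Notation H2s := (Hp R 2%:E).
Local Notation L2s := (Lp R 2%:E).
Local Notation "g ^L" := (Lp_val (H2_val g)) (at level 2, format "g ^L").
Implicit Types (S : BL H2) (g k x y : H2).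

Lemma H2_normE g : `|g| = (N2 g^L)%:C. Proof. by []. Qed.

Lemma H2_addE g k : (g + k)^L = g^L + k^L. Proof. by []. Qed.
Lemma H2_scaleE (a : R[i]) g : (a *: g)^L = a *: g^L. Proof. by []. Qed.
Lemma H2_0E : (0 : H2)^L = 0. Proof. by []. Qed.

Lemma innerDl g k x : inner (g + k)^L x^L = inner g^L x^L + inner k^L x^L.
Proof.
by rewrite !innerE H2_addE mulrDl ID//; apply: L2M (H2_L2 _) (L2_conj (H2_L2 _)).
Qed.

Lemma innerZl (a : R[i]) g x : inner (a *: g)^L x^L = a * inner g^L x^L.
Proof.
rewrite !innerE H2_scaleE -(scalerAl a g^L) IZ//.
exact: L2M (H2_L2 _) (L2_conj (H2_L2 _)).
Qed.

Lemma innerBl g k x : inner (g - k)^L x^L = inner g^L x^L - inner k^L x^L.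
Proof. by rewrite innerDl -scaleN1r innerZl mulN1r. Qed.

Lemma inner0l x : inner (0 : H2)^L x^L = 0.
Proof. by rewrite innerE H2_0E mul0r I0. Qed.

Lemma inner_self g : inner g^L g^L = (N2 g^L ^+ 2)%:C.
Proof. by rewrite innerE inner_sqr//; exact: H2_L2. Qed.

Lemma BL_D S x y : S (x + y) = S x + S y.
Proof. by have := BL_linear S 1 x y; rewrite !scale1r. Qed.

Lemma BL_0 S : S 0 = 0.
Proof. by have := BL_linear S (- 1) 0 0; rewrite scaler0 addr0 scaleN1r addNr. Qed.

Lemma BL_Z S (a : R[i]) x : S (a *: x) = a *: S x.
Proof. by have := BL_linear S a x 0; rewrite BL_0 !addr0. Qed.

Lemma BL_B S x y : S (x - y) = S x - S y.
Proof. by rewrite BL_D -scaleN1r BL_Z scaleN1r. Qed.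

Lemma N2_H2_eq0 x : N2 x^L = 0 -> x = 0.
Proof. by move=> h; apply: H2_inj; apply: N2_eq0 h; exact: H2_L2. Qed.

Lemma opnorm_bound S x : N2 (S x)^L <= opnorm S * N2 x^L.
Proof.
have [x0|x0] := eqVneq (N2 x^L) 0.
  by rewrite (N2_H2_eq0 x0) BL_0 H2_0E N2_0 mulr0.
have xp : 0 < N2 x^L by rewrite lt_neqAle eq_sym x0 N2_ge0.
have := @opnorm_ub _ _ S ((N2 x^L)^-1%:C *: x).
rewrite BL_Z !H2_normE !H2_scaleE !N2Z; [|exact: H2_L2|exact: H2_L2].
rewrite nc_real ger0_norm ?invr_ge0 ?N2_ge0// mulVf// => /(_ (lexx _)) /=.
by rewrite ler_pdivrMl// mulrC.
Qed.

Lemma opnorm_boundB S S' x : N2 (S x - S' x)^L <= opnorm (S - S') * N2 x^L.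
Proof. exact: (opnorm_bound (S - S') x). Qed.

Definition bform S g k : R[i] := inner (S g)^L k^L.

Definition diag S (n : nat) : R[i] := bform S (kH R n) (kH R n).

Lemma bform_le S g k : nc (bform S g k) <= opnorm S * N2 g^L * N2 k^L.
Proof.
apply: le_trans (inner_le _ _) _; apply: ler_wpM2r; first exact: N2_ge0.
exact: opnorm_bound.
Qed.

Lemma diag_le S n : nc (diag S n) <= opnorm S.
Proof. by apply: le_trans (bform_le _ _ _) _; rewrite N2_kH !mulr1. Qed.

Lemma diag_lip S S' n : nc (diag S n - diag S' n) <= opnorm (S - S').
Proof.
rewrite /diag /bform -innerBl; apply: le_trans (inner_le _ _) _.
by apply: le_trans (ler_wpM2r (N2_ge0 _) (opnorm_boundB _ _ _)) _; rewrite N2_kH !mulr1.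
Qed.

(* Testing against S k_n - lambda_n k_n itself turns the weak estimate into a
   norm estimate. *)
Lemma asym_eigen_norm S (e : R) n :
  (forall g, nc (bform S (kH R n) g - diag S n * inner (kH R n)^L g^L) <= e * N2 g^L) ->
  N2 (S (kH R n) - diag S n *: kH R n)^L <= e.
Proof.
move=> h; set z := S _ - _; have := h z; rewrite /bform -innerZl -innerBl inner_self nc_real.
rewrite ger0_norm ?sqr_ge0// => hz.
have [->|z0] := eqVneq (N2 z^L) 0.
  have := h (kH R n); rewrite N2_kH mulr1; apply: le_trans; exact: nc_ge0.
have zp : 0 < N2 z^L by rewrite lt_neqAle eq_sym z0 N2_ge0.
by move: hz; rewrite expr2 ler_pM2r.
Qed.

Definition eigen_algebra : set (BL H2) := [set S | asym_eigen (bform S)].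

(** Absorbs a constant factor into an error that is arbitrary anyway. *)
Lemma nearP_le (P : nat -> R -> Prop) :
  (forall n (e e' : R), e <= e' -> P n e -> P n e') ->
  (exists2 K : R, 0 < K & forall e : R, 0 < e -> \forall n \near \oo, P n (K * e)) ->
  forall e : R, 0 < e -> \forall n \near \oo, P n e.
Proof.
move=> Pm [K K0 h] e e0; have := h (e / K); rewrite divr_gt0// => /(_ isT).
by apply: filterS => n; apply: Pm; rewrite mulrCA mulfV ?mulr1// gt_eqF.
Qed.

(** The approximate eigenvalues add, multiply and conjugate along with the operators. Norm limits
    are handled by a three-term estimate with e / 3, the diagonal values being 1-Lipschitz in the
    operator. *)
Lemma eigen_algebra_cstar : cstar_subalgebra eigen_algebra.
Proof.
split.
- split.
    have b0 g k : bform 0 g k = 0 by exact: inner0l.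
    move=> e e0; apply: nearW => n g; rewrite !b0 !mul0r subrr Normc.normc0.
    by split; rewrite mulr_ge0 ?N2_ge0// ltW.
  move=> a S S' hS hS'; set S'' := a *: S + S'.
  have bE g k : bform S'' g k = a * bform S g k + bform S' g k.
    by rewrite /bform -innerZl -innerDl.
  have main (x y d d' i : R[i]) (e N : R) : nc (x - d * i) <= e * N -> nc (y - d' * i) <= e * N ->
      nc (a * x + y - (a * d + d') * i) <= (nc a + 1) * e * N.
    move=> h1 h2; have -> : a * x + y - (a * d + d') * i = a * (x - d * i) + (y - d' * i) by ring.
    apply: le_trans (ncD _ _) _; rewrite Normc.normcM -mulrA mulrDl mul1r; apply: lerD => //.
    by rewrite ler_wpM2l ?nc_ge0.
  have K0 : 0 < nc a + 1 by rewrite ltr_wpDl ?nc_ge0.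
  apply: (nearP_le (P := fun n e => forall g, _ <= e * N2 g^L /\ _ <= e * N2 g^L)).
    move=> n e e' ee' h g; have [h1 h2] := h g.
    by split; [apply: le_trans h1 _|apply: le_trans h2 _]; rewrite ler_wpM2r ?N2_ge0.
  exists (nc a + 1) => // e e0; apply: filterS2 (hS e e0) (hS' e e0) => n h h' g.
  have [h1 h2] := h g; have [h1' h2'] := h' g.
  by rewrite !bE; split; apply: main.
- move=> S S' hS hS'; have o0 := opnorm_ge0 S; have o0' := opnorm_ge0 S'.
  apply: (@asym_eigenW _ _ (fun n => diag S n * diag S' n) (fun n => diag S n * diag S' n)).
    apply: (nearP_le (P := fun n e => forall g, _ <= e * N2 g^L)).
      by move=> n e e' ee' h g; apply: le_trans (h g) _; rewrite ler_wpM2r ?N2_ge0.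
    exists (opnorm S' + opnorm S + 1); first by rewrite ltr_wpDl ?addr_ge0.
    move=> e e0; apply: filterS2 (hS e e0) (hS' e e0) => n h h' g.
    have [h1 _] := h (S' g); have [h2 _] := h' g.
    rewrite (_ : _ - _ = (bform S (S' g) (kH R n) - diag S n * inner (S' g)^L (kH R n)^L) +
      diag S n * (bform S' g (kH R n) - diag S' n * inner g^L (kH R n)^L)); last first.
      by rewrite /bform /=; ring.
    apply: le_trans (ncD _ _) _; rewrite Normc.normcM.
    have h3 := ler_pM (nc_ge0 _) (nc_ge0 _) (diag_le S n) h2.
    have h4 := ler_wpM2l (ltW e0) (opnorm_bound S' g).
    apply: le_trans (lerD h1 h3) _; apply: le_trans (lerD h4 (lexx _)) _.
    have := mulr_ge0 (ltW e0) (N2_ge0 g^L); move: (N2 g^L) => N eN.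
    have -> : e * (opnorm S' * N) + opnorm S * (e * N) =
      (opnorm S' + opnorm S + 1) * e * N - e * N by ring.
    by rewrite lerBlDr lerDl.
  apply: (nearP_le (P := fun n e => forall g, _ <= e * N2 g^L)).
    by move=> n e e' ee' h g; apply: le_trans (h g) _; rewrite ler_wpM2r ?N2_ge0.
  exists (opnorm S + opnorm S' + 1); first by rewrite ltr_wpDl ?addr_ge0.
  move=> e e0; apply: filterS2 (hS e e0) (hS' e e0) => n h h' g.
  have [_ h1] := h g.
  (* On this side S acts on the error made by S' at k_n. The weak estimate is not enough: the error
     must be small in norm before S is applied. *)
  have h2 : N2 (S' (kH R n) - diag S' n *: kH R n)^L <= e.
    by apply: asym_eigen_norm => k; have [] := h' k.
  rewrite (_ : _ - _ = bform S (S' (kH R n) - diag S' n *: kH R n) g +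
      diag S' n * (bform S (kH R n) g - diag S n * inner (kH R n)^L g^L)); last first.
    by rewrite /bform BL_B BL_Z innerBl innerZl /=; ring.
  apply: le_trans (ncD _ _) _; rewrite Normc.normcM.
  have h3 := ler_pM (nc_ge0 _) (nc_ge0 _) (diag_le S' n) h1.
  have h4 := ler_wpM2r (N2_ge0 g^L) (ler_wpM2l o0 h2).
  have h5 := le_trans (bform_le S (S' (kH R n) - diag S' n *: kH R n) g) h4.
  apply: le_trans (lerD h5 h3) _.
  have := mulr_ge0 (ltW e0) (N2_ge0 g^L); move: (N2 g^L) => N eN.
  have -> : opnorm S * e * N + opnorm S' * (e * N) =
    (opnorm S + opnorm S' + 1) * e * N - e * N by ring.
  by rewrite lerBlDr lerDl.
- move=> S S' hS adj.
  (* Taking the adjoint swaps the two halves of the property. *)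
  have bE g k : bform S' g k = conjc (bform S k g).
    by rewrite /bform (inner_conj k) -adj.
  apply: (@asym_eigenW _ _ (fun n => conjc (diag S n)) (fun n => conjc (diag S n))) => e e0.
    apply: filterS (hS e e0) => n h g; have [_ h2] := h g.
    by rewrite bE (inner_conj (kH R n)) -conjcM -conjcB ncJ.
  apply: filterS (hS e e0) => n h g; have [h1 _] := h g.
  by rewrite bE (inner_conj g) -conjcM -conjcB ncJ.
- move=> S hS e e0; have e30 : 0 < e / 3 by rewrite divr_gt0.
  have e3C : 0 < (e / 3)%:C :> R[i] by rewrite ltcR.
  have [S' [hS' SS']] := hS _ (nbhsx_ballx S _ e3C).
  have {}SS' : opnorm (S - S') <= e / 3.
    move: SS'; rewrite -ball_normE /ball_ /= => /ltW.
    by rewrite -[`|S - S'|]/((opnorm (S - S'))%:C) lecR.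
  apply: filterS (hS' _ e30) => n h g; have [h1 h2] := h g.
  have aux (x x' d d' i : R[i]) : nc (x' - d' * i) <= e / 3 * N2 g^L ->
      nc (x - x') <= e / 3 * N2 g^L -> nc (d - d') <= e / 3 -> nc i <= N2 g^L ->
      nc (x - d * i) <= e * N2 g^L.
    move=> a1 a2 a3 a4.
    have -> : x - d * i = (x - x') + (x' - d' * i) - (d - d') * i by ring.
    apply: le_trans (ncB _ _) _; apply: le_trans (lerD (ncD _ _) (lexx _)) _.
    rewrite Normc.normcM; have a5 := ler_pM (nc_ge0 _) (nc_ge0 _) a3 a4.
    by move: a1 a2 a5; move: (N2 g^L) => N; lra.
  have gk : nc (inner g^L (kH R n)^L) <= N2 g^L.
    by apply: le_trans (inner_le _ _) _; rewrite N2_kH mulr1.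
  have dd : nc (diag S n - diag S' n) <= e / 3 by apply: le_trans (diag_lip _ _ _) SS'.
  have bb x y : nc (bform S x y - bform S' x y) <= e / 3 * (N2 x^L * N2 y^L).
    rewrite /bform -innerBl; apply: le_trans (inner_le _ _) _.
    rewrite mulrA; apply: ler_wpM2r; first exact: N2_ge0.
    by apply: le_trans (opnorm_boundB _ _ _) _; rewrite ler_wpM2r ?N2_ge0.
  split.
    by apply: aux h1 _ dd gk; have := bb g (kH R n); rewrite N2_kH mulr1.
  apply: aux h2 _ dd _; first by have := bb (kH R n) g; rewrite N2_kH mul1r.
  by rewrite inner_conj ncJ.
Qed.
End Operators.

(** * Toeplitz operators and Fredholm operators *)

Section Toeplitz.
Variable R : realType.
Local Notation H2 := (H2 R).
Local Notation H2s := (Hp R 2%:E).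
Local Notation Hoo := (Hp R +oo%E).
Local Notation L2s := (Lp R 2%:E).
Local Notation Loo := (Lp R +oo%E).
Local Notation "g ^L" := (Lp_val (H2_val g)) (at level 2, format "g ^L").
Implicit Types (S : BL H2) (g k x y : H2).

(** The limit given by [hardy_proj_exists] satisfies the defining property, so [xget] does not fall
    back on its default value 0. *)
Lemma hardy_projP (u : L2 R) k : inner (hardy_proj u)^L k^L = inner (u : L0 R) k^L.
Proof.
have u2 : L2s u by exact: LpP.
have [s [sH su _]] := hardy_proj_exists u2; have /HpP[s2 _] := sH.
have us2 : L2s ((u : L0 R) - s) by exact: L2_sub.
have [h hE] := mkH2_exists sH.
have hP : forall k : H2, inner (u - H2_val h : L2 R) k = 0.
  move=> k'; rewrite innerE -[Lp_val (u - H2_val h)]/((u : L0 R) - h^L) hE.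
  have H0 (j : nat) : I (conjL0 ((u : L0 R) - s) * chiL R j) = 0.
    rewrite -[j%:Z]opprK -chiLJ -rmorphM /= I_conj ?su ?conjc0//.
    exact: L2M us2 (L2_chi _ _).
  have := I_analytic_eq0 (L2_conj us2) H0 (H2_H2s k').
  rewrite -{1}[k'^L]conjL0K -rmorphM /= I_conj; last exact: L2M us2 (L2_conj (H2_L2 _)).
  by move=> /(congr1 (@conjc R)); rewrite conjcK conjc0.
have : forall k : H2, inner (u - H2_val (hardy_proj u) : L2 R) k = 0.
  rewrite /hardy_proj; case: xgetP => [x _ //|]; by move=> /(_ h).
move=> /(_ k); rewrite !innerE -[Lp_val (u - _)]/((u : L0 R) - (hardy_proj u)^L).
rewrite mulrBl IB; [|exact: L2M u2 (L2_conj (H2_L2 _))|exact: L2M (H2_L2 _) (L2_conj (H2_L2 _))].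
by move=> /eqP; rewrite subr_eq0 => /eqP.
Qed.

Lemma toeplitzE (f : Linf R) g k : inner (toeplitz f g)^L k^L = mform f g k.
Proof. by rewrite hardy_projP innerE. Qed.

Lemma toeplitz_algebra_eigen S : toeplitz_algebra R S -> asym_eigen (bform S).
Proof.
move=> /(_ (@eigen_algebra R)); apply; split; first exact: eigen_algebra_cstar.
move=> T [f fQ Tf].
have e : bform T = mform f.
  by apply/funext => g; apply/funext => k; rewrite /bform Tf toeplitzE.
by rewrite /eigen_algebra /= e; exact: QC_eigen.
Qed.

(* y = sum_j 2^-j k_(n_j); all the inner products of the kernels are
   nonnegative, hence the j-th one bounds that of y from below. *)
Lemma kernel_series (nn : nat -> nat) : exists y, forall j,
  2^-1 ^+ j <= nc (inner y^L (kH R (nn j))^L).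
Proof.
pose s (N : nat) : L0 R := \sum_(0 <= j < N) (2^-1 ^+ j)%:C *: kn R (nn j).
have k2 j : L2s (kn R (nn j)) by exact/kern_L2/kA_ge0.
have sS N : s N.+1 = s N + (2^-1 ^+ N)%:C *: kn R (nn N) by rewrite /s big_nat_recr.
have sH N : H2s (s N).
  elim: N => [|N ih].
    rewrite /s big_geq//; apply/HpP; split; first exact/Lp_0/le12.
    by move=> n n0; rewrite mul0r I0.
  by rewrite sS addrC; apply: H2_closed_lin ih; exact: kn_H2s.
have s2 N : L2s (s N) by have /HpP[] := sH N.
have h0 (n : nat) : 0 <= 2^-1 ^+ n :> R by rewrite exprn_ge0.
have sd n m : N2 (s (n + m)%N - s n) <= 2 * 2^-1 ^+ n - 2 * 2^-1 ^+ (n + m).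
  elim: m => [|m ih]; first by rewrite addn0 !subrr N2_0.
  rewrite addnS sS -addrA (addrC _ (- s n)) addrA.
  apply: le_trans (N2D _ _) _; [exact: L2_sub|exact: L2_scale|].
  rewrite N2Z// N2_kern ?kA_ge0// mulr1 nc_real ger0_norm// exprS.
  by move: ih; move: (N2 _) (2^-1 ^+ n) (2^-1 ^+ (n + m)) => a b c; lra.
have sC (e : R) : 0 < e -> exists N, forall m n, (N <= m)%N -> (N <= n)%N -> N2 (s m - s n) <= e.
  move=> e0; have h : (fun n => 2 * 2^-1 ^+ n) @ \oo --> (0 : R).
    rewrite -(mulr0 2); apply: cvgM; first exact: cvg_cst.
    by apply: cvg_expr; rewrite ger0_norm// invf_lt1// ltr1n.
  have e20 : 0 < e / 2 by rewrite divr_gt0.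
  have /cvgr0Pnorm_le/(_ _ e20)[N _ hN] := h.
  exists N => m n Nm Nn.
  have aux a : (N <= a)%N -> N2 (s a - s N) <= e / 2.
    move=> Na; rewrite -(subnKC Na); apply: le_trans (sd _ _) _.
    have := hN N (leqnn N); rewrite /= ger0_norm ?mulr_ge0//.
    by have := h0 (N + (a - N))%N; move: (2^-1 ^+ _) (2^-1 ^+ _) => b c; lra.
  have -> : s m - s n = (s m - s N) - (s n - s N) by rewrite opprB addrA subrK.
  apply: le_trans (N2B _ _) _; [exact: L2_sub|exact: L2_sub|].
  by rewrite (splitr e); apply: lerD; exact: aux.
have [y y2 sy] := L2_complete s2 sC.
have Iy (u : L0 R) : L2s u -> (fun n => nc (I (s n * u) - I (y * u))) @ \oo --> (0 : R).
  by move=> u2; exact: L2_cvg_I y2 u2 s2 sy.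
have yH : H2s y.
  apply/HpP; split=> // n n0; apply: cvg_cst_eq (Iy _ (L2_chi R n)).
  by apply: nearW => m; have /HpP[_ ->] := sH m.
have [y' yE] := mkH2_exists yH; exists y' => j; rewrite innerE yE kHE.
apply: le_trans (le_trans (ler_norm _) (Re_le_nc _)).
have hc : (fun n => complex.Re (I (s n * conjL0 (kn R (nn j))))) @ \oo -->
    complex.Re (I (y * conjL0 (kn R (nn j)))) by exact: cvg_nc_Re (Iy _ (L2_conj (k2 j))).
rewrite -(cvg_lim _ hc)//; apply: limr_ge; first exact: cvgP hc.
have re_ge0 i : 0 <= complex.Re (I (kn R (nn i) * conjL0 (kn R (nn j)))).
  rewrite I_kern ?kA_ge0//=; apply: mulr_ge0; first by apply: mulr_ge0; exact: kscale_ge0.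
  apply: divr_ge0; first by rewrite mulr_ge0 ?pi_ge0.
  by apply: addr_ge0 (kA_ge0 R _); apply: addr_ge0 (kA_ge0 R _).
have IS N : complex.Re (I (s N.+1 * conjL0 (kn R (nn j)))) =
    complex.Re (I (s N * conjL0 (kn R (nn j)))) +
    2^-1 ^+ N * complex.Re (I (kn R (nn N) * conjL0 (kn R (nn j)))).
  rewrite sS mulrDl ID; last 2 first.
  - exact: L2M (s2 N) (L2_conj (k2 j)).
  - exact: L2M (L2_scale _ (k2 N)) (L2_conj (k2 j)).
  rewrite ReD; congr (_ + _); rewrite -(scalerAl _ (kn R (nn N))) IZ ?ReZ//.
  exact: L2M (k2 N) (L2_conj (k2 j)).
have S0 N : 0 <= complex.Re (I (s N * conjL0 (kn R (nn j)))).
  elim: N => [|N ih]; first by rewrite /s big_geq// mul0r I0.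
  by rewrite IS addr_ge0// mulr_ge0.
have mono i : 2^-1 ^+ j <= complex.Re (I (s (j.+1 + i)%N * conjL0 (kn R (nn j)))).
  elim: i => [|i ih].
    by rewrite addn0 IS I_kern_sqr ?kA_ge0// mulr1 lerDr.
  by rewrite addnS IS; apply: le_trans ih _; rewrite lerDl mulr_ge0.
by exists j.+1 => // N jN; rewrite -(subnKC (jN : (j.+1 <= N)%N)); exact: mono.
Qed.

(** Otherwise there are indices n_j at which the adjoint of S is at most 2 4^-j on k_(n_j), while
    k_(n_j) is 4^-j-orthogonal to the finitely many e_i spanning a complement of the range. The
    vector y of [kernel_series], written as S x plus a combination of the e_i, would then satisfy
    2^-j <= |(y, k_(n_j))| <= K 4^-j for all j. *)
Lemma fredholm_lower S : asym_eigen (bform S) -> fredholm S ->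
  exists2 d : R, 0 < d & \forall n \near \oo, d <= nc (diag S n).
Proof.
move=> hS [_ _ [W [m [e We]] cod]]; apply: contrapT => hn.
have h4 j : 0 < 4^-1 ^+ j :> R by rewrite exprn_gt0// invr_gt0.
have step j : exists n, [/\ forall g, nc (bform S g (kH R n)) <= 2 * 4^-1 ^+ j * N2 g^L &
    forall i, nc (inner (e i)^L (kH R n)^L) <= 4^-1 ^+ j].
  have ev1 := hS _ (h4 j).
  have ev2 : \forall n \near \oo, forall i, nc (inner (e i)^L (kH R n)^L) <= 4^-1 ^+ j.
    have H i : \forall n \near \oo, nc (inner (e i)^L (kH R n)^L) <= 4^-1 ^+ j.
      have /cvgr0Pnorm_le/(_ _ (h4 j)) := kn_weak (H2_H2s (e i)).
      by apply: filterS => n; rewrite ger0_norm ?nc_ge0// innerE kHE.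
    exact: filter_forall.
  have [N _ hN] := filterI ev1 ev2.
  apply: contrapT => no; apply: hn; exists (4^-1 ^+ j) => //.
  exists N => // n /= Nn; rewrite leNgt; apply/negP => dn; apply: no.
  exists n; have [h1 h2] := hN n Nn; split => // g.
  have [h3 _] := h1 g; rewrite -(subrK (diag S n * inner g^L (kH R n)^L) (bform S g (kH R n))).
  have -> : 2 * 4^-1 ^+ j * N2 g^L = 4^-1 ^+ j * N2 g^L + 4^-1 ^+ j * N2 g^L.
    by move: (N2 g^L) (4^-1 ^+ j) => a b; ring.
  apply: le_trans (ncD _ _) _; apply: lerD => //.
  rewrite Normc.normcM; apply: ler_pM; rewrite ?nc_ge0//; first exact: ltW.
  by apply: le_trans (inner_le _ _) _; rewrite N2_kH mulr1.
have /choice[nn nnP] := step.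
have [y yP] := kernel_series nn.
have [_ [x _ <-] /We[c cE]] := cod y.
(* Collects the bounds of both parts of y: the 2 comes from the eigenvector error plus the small
   diagonal value, 4^-j each. *)
pose K : R := 2 * N2 x^L + \sum_(i < m) nc (c i).
have K0 : 0 <= K by rewrite addr_ge0 ?mulr_ge0 ?N2_ge0// sumr_ge0// => i _; exact: nc_ge0.
have bound j : 2^-1 ^+ j <= 4^-1 ^+ j * K.
  apply: le_trans (yP j) _; have [p1 p2] := nnP j.
  have -> : y = S x + \sum_(i < m) c i *: e i by rewrite -cE addrC subrK.
  rewrite innerDl; apply: le_trans (ncD _ _) _; rewrite /K mulrDr; apply: lerD.
    by apply: le_trans (p1 x) _; rewrite mulrCA mulrA.
  elim/big_rec2 : _ => [|i a b _ ih]; first by rewrite inner0l Normc.normc0 mulr0.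
  rewrite innerDl innerZl mulrDr; apply: le_trans (ncD _ _) _; apply: lerD => //.
  by rewrite Normc.normcM mulrC ler_wpM2r ?nc_ge0.
have pow j : 2 ^+ j <= K.
  have := bound j; rewrite -(ler_pM2l (_ : 0 < 4 ^+ j)) ?exprn_gt0//.
  rewrite mulrA -!exprMn mulfV ?pnatr_eq0// expr1n mul1r.
  by rewrite (_ : 4 * 2^-1 = 2 :> R)//; field.
have big : (fun j => 2^-1 ^+ j) @ \oo --> (0 : R).
  by apply: cvg_expr; rewrite ger0_norm// invf_lt1// ltr1n.
have K1 : 0 < (K + 1)^-1 by rewrite invr_gt0 ltr_wpDl.
have /cvgr0Pnorm_lt/(_ _ K1)[j _ /(_ j (leqnn j))] := big.
rewrite /= ger0_norm ?exprn_ge0// exprVn ltf_pV2 ?posrE ?exprn_gt0 ?ltr_wpDl//.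
by move=> h2; have := lt_le_trans h2 (pow j); rewrite ltNge lerDl ler01.
Qed.

Lemma multiplication_exists (h : L0 R) (hH : Hoo h) : exists S,
  forall g, (S g)^L = h * g^L.
Proof.
have /choice[F FE] : forall g, exists g' : H2, g'^L = h * g^L.
  by move=> g; apply: mkH2_exists; apply: Hoo_mulH2 => //; exact: H2_H2s.
have /HpP[hL _] := hH; have /LooP[M M0 hM] := hL.
have Fb : F \in @bounded_op R H2.
  apply/mem_set; split.
    by move=> a x y; apply: H2_inj; rewrite H2_addE H2_scaleE !FE mulrDr scalerAr.
  exists M%:C => x; rewrite !H2_normE -rmorphM lecR FE.
  by apply: N2_Loo => //; exact: H2_L2.
by exists (MkBL Fb).
Qed.

(** As h g is already in H^2, its difference with the projection lies in H^2 and is orthogonal to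
    itself. *)
Lemma toeplitz_analytic (h : L0 R) (hH : Hoo h) (f : Linf R) g : (f : L0 R) = h ->
  (toeplitz f g)^L = h * g^L.
Proof.
move=> fh; have [x xE] := mkH2_exists (Hoo_mulH2 hH (H2_H2s g)).
rewrite -xE; congr (_ ^L); apply/eqP; rewrite -subr_eq0; apply/eqP.
apply: N2_H2_eq0; apply/eqP; rewrite -sqrf_eq0; apply/eqP.
have : inner (toeplitz f g - x)^L (toeplitz f g - x)^L = 0.
  by rewrite innerBl toeplitzE innerE /mform xE fh subrr.
by rewrite inner_self => /(congr1 (@complex.Re R)).
Qed.

(** Multiplications by h and h' are inverse to each other on H^2, so the operator has zero kernel
    and full range. *)
Lemma analytic_toeplitz_fredholm (h h' : L0 R) : Hoo h -> Hoo h' -> h * h' = 1 ->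
  QC R h -> exists S, toeplitz_fredholm R S /\ forall g, (S g)^L = h * g^L.
Proof.
move=> hH hH' hh' hQ; have [S SE] := multiplication_exists hH; exists S; split => //.
have [S' SE'] := multiplication_exists hH'.
have hL : Loo h by have /HpP[] := hH.
have SK y : S (S' y) = y by apply: H2_inj; rewrite SE SE' mulrA hh' mul1r.
split.
  move=> A [_]; apply; exists (MkLp (mem_set (hL : [set f : L0 R | Lp R +oo%E f] h))) => //.
  by move=> g; apply: H2_inj; rewrite (toeplitz_analytic hH)// SE.
have rT : range S = setT by apply/seteqP; split => // y _; exists (S' y).
split.
- exists 0%N; exists (fun _ => 0) => x /= Sx; exists (fun _ => 0); rewrite big_ord0.
  apply: H2_inj; rewrite H2_0E -[x^L]mul1r -hh' mulrAC -SE Sx.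
  by rewrite H2_0E mul0r.
- by rewrite rT; exact: closedT.
- exists [set 0]; last by move=> y; exists y; rewrite ?rT//= subrr.
  by exists 0%N; exists (fun _ => 0) => x /= ->; exists (fun _ => 0); rewrite big_ord0.
Qed.
End Toeplitz.

(** * A logarithmically growing analytic function *)

Section Oscillation.
Variable R : realType.
Implicit Types (k n N M : nat).
Local Notation Hoo := (Hp R +oo%E).
Local Notation Loo := (Lp R +oo%E).
Local Notation T := (measurableTypeR R).

Lemma ev_bounded_cvg A (F : nat -> L0 R) (f : L0 R) (M : R) : 0 <= A ->
  (forall n, {ae mu, forall t, nc (F n t) <= M}) -> ae_cvg F f ->
  (fun n => nc (ev A (F n) - ev A f)) @ \oo --> (0 : R).
Proof.
move=> A0 FM Ff; have h := bounded_cvg (Loo_L1 (phiJ_Loo A0)) FM Ff.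
apply: (cvg_ext (u := fun n => nc (((1 + A) / (2 * pi))%:C) *
   nc (I (conjL0 (phiL A) * F n) - I (conjL0 (phiL A) * f)))) => [n|].
  by rewrite -Normc.normcM mulrBr /ev ![conjL0 _ * _]mulrC.
by rewrite -(mulr0 (nc (((1 + A) / (2 * pi))%:C))); apply: cvgM => //; exact: cvg_cst.
Qed.

Lemma nc_cvg_unique (u : nat -> R[i]) (l l' : R[i]) :
  (fun n => nc (u n - l)) @ \oo --> (0 : R) -> (fun n => nc (u n - l')) @ \oo --> (0 : R) -> l = l'.
Proof.
move=> h h'; apply/eqP; rewrite -subr_eq0 -nc_eq0; apply/eqP.
apply: (@cvg_unique _ _ ((fun n => nc (l - l')) @ \oo)); [exact: Rhausdorff|exact: cvg_cst|].
apply: (squeeze_cvgr (f := cst 0) (h := fun n => nc (u n - l) + nc (u n - l'))).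
- apply: nearW => n; rewrite nc_ge0 /= -(nc_distC l).
  by have -> : l - l' = (l - u n) + (u n - l') by [ring]; exact: ncD.
- exact: cvg_cst.
- by rewrite -(addr0 0); exact: cvgD.
Qed.

(** [ev] is multiplicative, so it commutes with the powers (1 + f / (n + 1))^(n+1), and it is
    continuous for bounded almost everywhere convergence. *)
Lemma ev_cexp A (f g : L0 R) : 0 <= A -> Hoo f -> {ae mu, forall t, g t = cexp (f t)} ->
  ev A g = cexp (ev A f).
Proof.
move=> A0 fH gE; have /HpP[fL _] := fH; have /LooP[M M0 fM] := fL.
pose F n : L0 R := (1 + n.+1%:R^-1%:C *: f) ^+ n.+1.
have Hc := Hoo_closed R; have [cC cD cM cL] := Hc.
have h1 : Hoo 1 by rewrite -(scale1r 1).
have evF n : ev A (F n) = (1 + n.+1%:R^-1%:C * ev A f) ^+ n.+1.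
  have hf : Hoo (n.+1%:R^-1%:C *: f) by exact: bounded_closedZ.
  rewrite /F ev_exp//; last exact: cD.
  by rewrite ev_add ?ev_1 ?ev_Z//; [exact: Loo1|exact: LooZ].
apply: (@nc_cvg_unique (fun n => ev A (F n))).
  apply: (@ev_bounded_cvg A F g (expR M)) => //.
    move=> n; apply: filterS2 fM (L0_1DexpE f n) => t fM ->.
    by apply: le_trans (nc_1Dexp_le _ _) _; rewrite ler_expR.
  apply: filterS2 gE (ae_all (L0_1DexpE f)) => t -> ge.
  by apply: cvg_ext (cexp_lim (f t)) => n; rewrite -ge.
by apply: cvg_ext (cexp_lim (ev A f)) => n; rewrite evF.
Qed.

Implicit Types (t : R).

(** The chord |1 - e^(it)|. *)
Definition gap (t : R) : R := Num.sqrt (2 * (1 - cos t)).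

Lemma gap_ge0 t : 0 <= gap t. Proof. exact: sqrtr_ge0. Qed.

Lemma gap_sqr t : gap t ^+ 2 = 2 * (1 - cos t).
Proof. by rewrite sqr_sqrtr// mulr_ge0// subr_ge0 cos_le1. Qed.

Lemma gap_cont : continuous gap.
Proof.
move=> t; apply: (continuous_comp (f := fun t : R => 2 * (1 - cos t))); last exact: sqrt_continuous.
apply: cvgM; first exact: cvg_cst.
by apply: cvgB; [exact: cvg_cst|exact: continuous_cos].
Qed.

Lemma gap_eq0 t : gap t = 0 -> sin t = 0.
Proof.
move=> g0; have := gap_sqr t; rewrite g0 expr0n /= => /esym/eqP.
rewrite mulf_eq0 pnatr_eq0 /= subr_eq0 => /eqP c1.
by apply/eqP; rewrite -sqrf_eq0 sin2cos2 -c1 expr1n subrr.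
Qed.

Lemma phi_den_gap A t : phi_den A t = 1 + A * gap t ^+ 2 + (A * gap t) ^+ 2.
Proof. by rewrite exprMn gap_sqr /phi_den exprMn sin2cos2; ring. Qed.

Lemma sin_gap t : `|sin t| <= gap t.
Proof.
rewrite -(@ler_pXn2r _ 2)// ?nnegrE ?gap_ge0// real_normK ?num_real// gap_sqr sin2cos2.
by have := cos_le1 t; have := cos_geN1 t; nra.
Qed.

Definition decr t k : R := 4 / (1 + 2 ^+ k * gap t).

Lemma decr_itv t k : 0 <= decr t k <= 4.
Proof.
have h : 1 <= 1 + 2 ^+ k * gap t by rewrite lerDl mulr_ge0 ?exprn_ge0 ?gap_ge0.
have h0 : 0 < 1 + 2 ^+ k * gap t by exact: lt_le_trans h.
by rewrite /decr divr_ge0 ?(ltW h0)//= ler_pdivrMr// ler_peMr.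
Qed.

(* The bound A q / (1 + (A q)^2) on the imaginary part, q = |1 - e^(it)|, is
   dominated by a difference telescoping along A = 2^k. *)
Lemma phi_im_le t k : `|phi_im (2 ^+ k) t| <= decr t k - decr t k.+1.
Proof.
have A0 : 0 <= 2 ^+ k :> R by rewrite exprn_ge0.
have q0 := gap_ge0 t; have sq := sin_gap t.
set q := gap t in q0 sq *; set A := 2 ^+ k in A0 *.
have d1 := phi_den_ge1 t A0; have d0 : 0 < phi_den A t by exact: lt_le_trans d1.
rewrite /phi_im normrM normfV (gtr0_norm d0) normrM (ger0_norm A0) ler_pdivrMr//.
rewrite /decr exprS -/A -/q phi_den_gap -/q.
have x0 : 0 <= A * q by rewrite mulr_ge0.
apply: (@le_trans _ _ (A * q)); first by rewrite ler_wpM2l.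
have y0 : 0 <= A * q ^+ 2 by rewrite mulr_ge0 ?sqr_ge0.
rewrite -[2 * A * q]mulrA; move: (A * q) (A * q ^+ 2) x0 y0 => x y x0 y0.
have n1 : 1 + x != 0 by rewrite gt_eqF// ltr_wpDr.
have n2 : 1 + 2 * x != 0 by rewrite gt_eqF// ltr_wpDr// mulr_ge0.
have -> : (4 / (1 + x) - 4 / (1 + 2 * x)) * (1 + y + x ^+ 2) =
   4 * x * (1 + y + x ^+ 2) / ((1 + x) * (1 + 2 * x)).
  by field; rewrite n1 n2.
have n3 : 0 < (1 + x) * (1 + 2 * x) by rewrite mulr_gt0// ltr_wpDr// mulr_ge0.
rewrite ler_pdivlMr// (mulrC 4) -mulrA ler_wpM2l//.
(* What remains is 3 - 3 x + 2 x^2 + 4 y >= 0, and 2 x^2 - 3 x = (4 x - 3)^2 / 8 - 9/8. *)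
by have := sqr_ge0 (4 * x - 3); nra.
Qed.

Lemma phi_re_le t k : 0 < gap t -> `|phi_re (2 ^+ k) t| <= 2^-1 ^+ k / gap t.
Proof.
move=> q0; have A0 : 0 < 2 ^+ k :> R by rewrite exprn_gt0.
have h : nc (phi (2 ^+ k) t) <= 2^-1 ^+ k / gap t.
  have r0 : 0 <= 2^-1 ^+ k / gap t by rewrite divr_ge0 ?exprn_ge0// ltW.
  rewrite -(@ler_pXn2r _ 2)// ?nnegrE ?nc_ge0// nc_phi ?(ltW A0)//.
  have -> : (2^-1 ^+ k / gap t) ^+ 2 = ((2 ^+ k * gap t) ^+ 2)^-1.
    by rewrite exprVn -invfM exprVn.
  rewrite lef_pV2 ?posrE ?exprn_gt0 ?mulr_gt0//; last first.
    by apply: lt_le_trans (phi_den_ge1 t (ltW A0)).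
  by rewrite phi_den_gap lerDr addr_ge0// mulr_ge0 ?(ltW A0)// sqr_ge0.
by apply: le_trans h; exact: (@Re_le_nc R (phi (2 ^+ k) t)).
Qed.

Local Notation a := (@harmonic R).

Definition reF N t : R := \sum_(0 <= k < N) a k * phi_re (2 ^+ k) t.
Definition imF N t : R := \sum_(0 <= k < N) a k * phi_im (2 ^+ k) t.

Lemma a_ge0 k : 0 <= a k. Proof. exact: harmonic_ge0. Qed.

Lemma a_le k n : (k <= n)%N -> a n <= a k.
Proof. by move=> kn; rewrite /harmonic/= lef_pV2 ?posrE// ler_nat. Qed.

Lemma a_le1 k : a k <= 1.
Proof. by rewrite (le_trans (a_le (leq0n k)))// /harmonic /= invr1. Qed.

(** For k >= N the decreasing coefficient [a k] is at most [a N], which factors out of the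
    telescoping sum. The resulting bound 4 [a N] is uniform in t, which makes the imaginary part
    continuous everywhere. *)
Lemma imF_dist N m t : `|imF (N + m) t - imF N t| <= a N * (decr t N - decr t (N + m)).
Proof.
elim: m => [|m ih]; first by rewrite addn0 !subrr normr0 mulr0.
rewrite addnS /imF big_nat_recr//= -/(imF _ t) addrAC.
apply: le_trans (ler_normD _ _) _; rewrite normrM (ger0_norm (a_ge0 _)).
have h := ler_pM (a_ge0 (N + m)) (normr_ge0 _) (a_le (leq_addr m N)) (phi_im_le t (N + m)).
apply: le_trans (lerD ih h) _; rewrite -mulrDr ler_wpM2l ?a_ge0//.
by rewrite addrA subrK.
Qed.

Lemma imF_cauchy N M t : (N <= M)%N -> `|imF M t - imF N t| <= 4 * a N.
Proof.
move=> NM; rewrite -(subnKC NM); apply: le_trans (imF_dist _ _ _) _.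
rewrite mulrC ler_wpM2r ?a_ge0//.
have /andP[_ h1] := decr_itv t N; have /andP[h2 _] := decr_itv t (N + (M - N)).
by lra.
Qed.

Lemma imF_le N t : `|imF N t| <= 4.
Proof.
have := imF_cauchy t (leq0n N); rewrite {2}/imF big_geq// subr0 => /le_trans; apply.
by rewrite ler_piMr// a_le1.
Qed.

(** A geometric tail divided by the chord: convergence is only locally uniform away from the point
    1, where the real part blows up. *)
Lemma reF_dist N m t : 0 < gap t ->
  `|reF (N + m) t - reF N t| <= (2 * 2^-1 ^+ N - 2 * 2^-1 ^+ (N + m)) / gap t.
Proof.
move=> q0; elim: m => [|m ih]; first by rewrite addn0 !subrr normr0 mul0r.
rewrite addnS /reF big_nat_recr//= -/(reF _ t) addrAC.
apply: le_trans (ler_normD _ _) _; rewrite normrM (ger0_norm (a_ge0 _)).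
have h : a (N + m) * `|phi_re (2 ^+ (N + m)) t| <= 2^-1 ^+ (N + m) / gap t.
  by apply: le_trans (phi_re_le _ q0); rewrite ler_piMl// a_le1.
apply: le_trans (lerD ih h) _; rewrite -mulrDl ler_wpM2r ?invr_ge0 ?gap_ge0//.
by rewrite exprS; move: (2^-1 ^+ N) (2^-1 ^+ (N + m)) => x y; lra.
Qed.

Lemma reF_cauchy N M t : 0 < gap t -> (N <= M)%N ->
  `|reF M t - reF N t| <= 2 * 2^-1 ^+ N / gap t.
Proof.
move=> q0 NM; rewrite -(subnKC NM); apply: le_trans (reF_dist _ _ q0) _.
by rewrite ler_wpM2r ?invr_ge0 ?gap_ge0// gerBl mulr_ge0// exprn_ge0.
Qed.

Lemma half_decay (c : R) : (fun N => c * 2^-1 ^+ N) @ \oo --> (0 : R).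
Proof.
rewrite -(mulr0 c); apply: cvgM; first exact: cvg_cst.
by apply: cvg_expr; rewrite ger0_norm// invf_lt1// ltr1n.
Qed.

Lemma uniform_cauchy_lim (u e : R^nat) : e @ \oo --> (0 : R) ->
  (forall N M, (N <= M)%N -> `|u M - u N| <= e N) ->
  cvgn u /\ forall N, `|limn u - u N| <= e N.
Proof.
move=> e0 ue; have cu : cvgn u.
  apply: cauchy_cvg; apply: cauchy_exP => d d0.
  have /cvgr0Pnorm_lt/(_ _ d0)[N _ hN] := e0.
  exists (u N); exists N => // n /= Nn; rewrite /ball /= distrC.
  by apply: le_lt_trans (ue N n Nn) _; apply: le_lt_trans (ler_norm _) (hN N (leqnn N)).
split=> // N; have h : (fun M => `|u M - u N|) @ \oo --> `|limn u - u N|.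
  by apply: cvg_norm; apply: cvgB => //; exact: cvg_cst.
rewrite -(cvg_lim _ h)//; apply: limr_le; first exact: cvgP h.
by exists N => // M /= NM; exact: ue.
Qed.

(** Where [gap t] = 0 the partial sums are those of the harmonic series, and the value of [limn]
    carries no meaning there; the other factor of [jump] vanishes at these points. *)
Definition reL t : R := limn (reF^~ t).
Definition imL t : R := limn (imF^~ t).

Lemma a_decay : (fun N => 4 * a N) @ \oo --> (0 : R).
Proof. by rewrite -(mulr0 4); apply: cvgM; [exact: cvg_cst|exact: cvg_harmonic]. Qed.

Lemma imL_dist t N : `|imL t - imF N t| <= 4 * a N.
Proof.
by have [_] := uniform_cauchy_lim a_decay (fun N M => @imF_cauchy N M t); apply.
Qed.

Lemma imF_cvg t : imF^~ t @ \oo --> imL t.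
Proof. by have [] := uniform_cauchy_lim a_decay (fun N M => @imF_cauchy N M t). Qed.

Lemma re_decay t : (fun N => 2 * 2^-1 ^+ N / gap t) @ \oo --> (0 : R).
Proof. by apply: cvg_ext (half_decay (2 / gap t)) => N; rewrite mulrAC. Qed.

Lemma reL_dist t N : 0 < gap t -> `|reL t - reF N t| <= 2 * 2^-1 ^+ N / gap t.
Proof.
by move=> q0; have [_] := uniform_cauchy_lim (re_decay t) (fun N M => @reF_cauchy N M t q0); apply.
Qed.

Lemma reF_cvg t : 0 < gap t -> reF^~ t @ \oo --> reL t.
Proof. by move=> q0; have [] := uniform_cauchy_lim (re_decay t) (fun N M => @reF_cauchy N M t q0). Qed.

Lemma sum_cont (c : nat -> R) (f : nat -> R -> R) N : (forall k, continuous (f k)) ->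
  continuous (fun t => \sum_(0 <= k < N) c k * f k t).
Proof.
move=> cf; elim: N => [|N ih].
  by rewrite (_ : (fun _ => _) = cst 0); [move=> t; exact: cvg_cst|apply/funext => t; rewrite big_geq].
rewrite (_ : (fun _ => _) = (fun t => \sum_(0 <= k < N) c k * f k t + c N * f N t)); last first.
  by apply/funext => t; rewrite big_nat_recr.
move=> t; apply: cvgD; first exact: ih.
by apply: cvgM; [exact: cvg_cst|exact: cf].
Qed.

Lemma reF_cont N : continuous (reF N).
Proof. by apply: sum_cont => k; apply: phi_re_cont; rewrite exprn_ge0. Qed.

Lemma imF_cont N : continuous (imF N).
Proof. by apply: sum_cont => k; apply: phi_im_cont; rewrite exprn_ge0. Qed.

Lemma local_uniform_cont (f : nat -> R -> R) (l : R -> R) (x : R) :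
  (forall N, {for x, continuous (f N)}) ->
  (forall e, 0 < e -> exists N, \forall t \near x, `|l t - f N t| <= e) ->
  {for x, continuous l}.
Proof.
move=> cf h; apply/cvgrPdist_le => e e0; have e30 : 0 < e / 3 by rewrite divr_gt0.
have [N hN] := h _ e30; have hx := nbhs_singleton hN.
have /cvgrPdist_le/(_ _ e30) := cf N; apply: filterS2 hN => t ht hf.
have -> : l x - l t = (l x - f N x) + (f N x - f N t) - (l t - f N t) by ring.
apply: le_trans (ler_normB _ _) _; have := ler_normD (l x - f N x) (f N x - f N t); lra.
Qed.

Lemma imL_cont : continuous imL.
Proof.
move=> x; apply: (local_uniform_cont (f := imF)); first by move=> N; exact: imF_cont.
move=> e e0; have /cvgr0Pnorm_le/(_ _ e0)[N _ hN] := a_decay; exists N.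
apply: (@filterE _ (nbhs x)) => t; by apply: le_trans (imL_dist t N) (le_trans (ler_norm _) (hN N (leqnn N))).
Qed.

Lemma reL_cont x : 0 < gap x -> {for x, continuous reL}.
Proof.
move=> q0; apply: (local_uniform_cont (f := reF)); first by move=> N; exact: reF_cont.
move=> e e0; have q20 : 0 < gap x / 2 by rewrite divr_gt0.
have /cvgr0Pnorm_le/(_ _ e0)[N _ /(_ N (leqnn N)) hN] := half_decay (2 / (gap x / 2)).
exists N; have /cvgrPdist_lt/(_ _ q20) := @gap_cont x; apply: filterS => t ht.
have qt : gap x / 2 <= gap t by have := ler_norm (gap x - gap t); lra.
have qt0 : 0 < gap t by exact: lt_le_trans qt.
apply: le_trans (reL_dist N qt0) _; apply: le_trans (le_trans (ler_norm _) hN).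
rewrite [leRHS]mulrAC ler_wpM2l ?mulr_ge0 ?exprn_ge0//.
by rewrite lef_pV2 ?posrE.
Qed.
End Oscillation.

(** * The symbols g_al and their phases *)

Section Symbols.
Variable R : realType.
Local Notation Hoo := (Hp R +oo%E).
Local Notation Loo := (Lp R +oo%E).
Local Notation T := (measurableTypeR R).
Local Notation a := (@harmonic R).
Implicit Types (k n N : nat) (al : R).

Lemma gap_gt0_ae : {ae mu, forall t : T, 0 < gap (t : R)}.
Proof.
apply: filterS3 (circle_set1 (0 : R)) (circle_set1 (2 * pi : R)) (ae_circle (P := fun t : T => 0 <= (t : R) <= 2 * pi) _) => //.
move=> t t0 t2 /andP[h0 h2]; rewrite sqrtr_gt0 mulr_gt0// subr_gt0 cos_lt1//.
by rewrite !lt_neqAle h0 h2 !andbT; apply/andP; split; apply/eqP => // /esym.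
Qed.

Lemma cexpL_exists (f : L0 R) : exists g : L0 R, {ae mu, forall t : T, g t = cexp (f t)}.
Proof.
have [mr mi] := L0_meas f.
have me := measurableT_comp (@measurable_expR R) mr.
have mc := measurableT_comp (continuous_measurable_fun (@continuous_cos R)) mi.
have ms := measurableT_comp (continuous_measurable_fun (@continuous_sin R)) mi.
have [g gE] := L0_mk (measurable_funM me mc) (measurable_funM me ms).
exists g; apply: filterS gE => t ->; rewrite /cexp /=.
by apply/eqP; rewrite eq_complex /= !mul0r subr0 addr0 !eqxx.
Qed.

Definition cexpL (f : L0 R) : L0 R := xget 0 [set g : L0 R | {ae mu, forall t : T, g t = cexp (f t)}].

Lemma cexpLE (f : L0 R) : {ae mu, forall t : T, cexpL f t = cexp (f t)}.
Proof.
rewrite /cexpL; case: xgetP => [g _ //|]; have [g gE] := cexpL_exists f.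
by move=> /(_ g).
Qed.

Lemma cexp_cvg (z : nat -> R[i]) (l : R[i]) : (fun n => nc (z n - l)) @ \oo --> (0 : R) ->
  (fun n => nc (cexp (z n) - cexp l)) @ \oo --> (0 : R).
Proof.
move=> h.
have hr : (fun n => complex.Re (z n)) @ \oo --> complex.Re l by exact: cvg_nc_Re.
have hi : (fun n => complex.Im (z n)) @ \oo --> complex.Im l by exact: cvg_nc_Im.
have er : (fun n => expR (complex.Re (z n))) @ \oo --> expR (complex.Re l).
  exact: (continuous_cvg _ (@continuous_expR R _) hr).
have ec : (fun n => cos (complex.Im (z n))) @ \oo --> cos (complex.Im l).
  exact: (continuous_cvg _ (@continuous_cos R _) hi).
have es : (fun n => sin (complex.Im (z n))) @ \oo --> sin (complex.Im l).
  exact: (continuous_cvg _ (@continuous_sin R _) hi).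
apply: nc_cvg.
  by rewrite /cexp /= mul0r subr0; apply: cvg_ext (cvgM er ec) => n; rewrite mul0r subr0.
by rewrite /cexp /= mul0r addr0; apply: cvg_ext (cvgM er es) => n; rewrite mul0r addr0.
Qed.

Definition FL N : L0 R := \sum_(0 <= k < N) (a k)%:C *: phiL (2 ^+ k).

Lemma FL_S N : FL N.+1 = FL N + (a N)%:C *: phiL (2 ^+ N).
Proof. by rewrite /FL big_nat_recr. Qed.

Lemma FL0 : FL 0 = 0. Proof. by rewrite /FL big_geq. Qed.

Lemma FL_Hoo N : Hoo (FL N).
Proof.
have Hc := Hoo_closed R; have [cC cD _ _] := Hc.
elim: N => [|N ih]; first by rewrite FL0 -(scale0r 1).
by rewrite FL_S; apply: cD => //; apply: bounded_closedZ => //; exact/phiL_Hoo/exprn_ge0.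
Qed.

Lemma FLE N : {ae mu, forall t : T, FL N t = Complex (reF N t) (imF N t)}.
Proof.
elim: N => [|N ih].
  by rewrite FL0; apply: filterS (L0_0E R) => t ->; rewrite /reF /imF !big_geq.
have p0 : 0 <= 2 ^+ N :> R by rewrite exprn_ge0.
rewrite FL_S; apply: filterS3 ih (L0_DE (FL N) ((a N)%:C *: phiL (2 ^+ N)))
  (filterI (L0_ZE (a N)%:C (phiL (2 ^+ N))) (phiLE p0)) => t ih -> [-> ->].
rewrite ih /phi /reF /imF !big_nat_recr//=.
by apply/eqP; rewrite eq_complex /= !mul0r subr0 addr0 !eqxx.
Qed.

Lemma UL_exists : exists f : L0 R, {ae mu, forall t : T, f t = Complex (reL t) (imL t)}.
Proof.
have h : {ae mu, forall t : T, forall N, FL N t = Complex (reF N t) (imF N t)} by exact/ae_all/FLE.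
have [] := @L0_lim R FL.
  apply: filterS2 gap_gt0_ae h => t t0 h; split.
    have c : (fun N => complex.Re (FL N t)) @ \oo --> reL t.
      by apply: cvg_ext (@reF_cvg R t t0) => N; rewrite h.
    exact: cvgP c.
  have c : (fun N => complex.Im (FL N t)) @ \oo --> imL t.
    by apply: cvg_ext (@imF_cvg R t) => N; rewrite h.
  exact: cvgP c.
move=> f fE; exists f; apply: filterS3 gap_gt0_ae h fE => t t0 h fE.
apply: nc_cvg_unique fE _; apply: nc_cvg => /=.
  by apply: cvg_ext (@reF_cvg R t t0) => N; rewrite h.
by apply: cvg_ext (@imF_cvg R t) => N; rewrite h.
Qed.

Definition UL : L0 R := xget 0 [set f : L0 R | {ae mu, forall t : T, f t = Complex (reL t) (imL t)}].

Lemma ULE : {ae mu, forall t : T, UL t = Complex (reL t) (imL t)}.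
Proof. by rewrite /UL; case: xgetP => [g _ //|]; have [g gE] := UL_exists => /(_ g). Qed.

Definition rot al : R[i] := Complex 0 al.

Lemma rotM al x y : rot al * Complex x y = Complex (- (al * y)) (al * x).
Proof. by apply/eqP; rewrite eq_complex /= !mul0r sub0r add0r !eqxx. Qed.

(* g_al = exp (i al F) with F = sum_k phi_(2^k) / (k + 1). *)
Definition gN al N : L0 R := cexpL (rot al *: FL N).
Definition gL al : L0 R := cexpL (rot al *: UL).

Lemma gNE al N : {ae mu, forall t : T, gN al N t = cexp (Complex (- (al * imF N t)) (al * reF N t))}.
Proof.
apply: filterS3 (cexpLE (rot al *: FL N)) (L0_ZE (rot al) (FL N)) (FLE N) => t -> -> ->.
by rewrite rotM.
Qed.

Lemma gLE al : {ae mu, forall t : T, gL al t = cexp (Complex (- (al * imL t)) (al * reL t))}.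
Proof.
apply: filterS3 (cexpLE (rot al *: UL)) (L0_ZE (rot al) UL) ULE => t -> -> ->.
by rewrite rotM.
Qed.

(** Multiplication by i al turns the bounded imaginary part into the real part of the exponent; this
    is why the exponentials stay bounded although F does not. *)
Lemma gN_le al N : {ae mu, forall t : T, nc (gN al N t) <= expR (`|al| * 4)}.
Proof.
apply: filterS (gNE al N) => t ->; rewrite nc_cexp ler_expR /=.
by apply: le_trans (ler_norm _) _; rewrite normrN normrM ler_wpM2l// imF_le.
Qed.

Lemma gN_cvg al : ae_cvg (gN al) (gL al).
Proof.
apply: filterS3 gap_gt0_ae (gLE al) (ae_all (gNE al)) => t t0 gE gNE.
apply: (cvg_ext (u := fun n => nc (cexp (Complex (- (al * imF n t)) (al * reF n t)) -
   cexp (Complex (- (al * imL t)) (al * reL t))))) => [n|]; first by rewrite gE gNE.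
apply: cexp_cvg; apply: nc_cvg => /=.
  by apply: cvgN; apply: cvgM; [exact: cvg_cst|exact: imF_cvg].
by apply: cvgM; [exact: cvg_cst|exact: reF_cvg].
Qed.

Lemma rotFL_Hoo al N : Hoo (rot al *: FL N).
Proof. by apply: bounded_closedZ; [exact: Hoo_closed|exact: FL_Hoo]. Qed.

Lemma gN_Hoo al N : Hoo (gN al N).
Proof.
apply: (bounded_closed_cexp (Hoo_closed R) (rotFL_Hoo al N)); last exact: cexpLE.
by have /HpP[] := rotFL_Hoo al N.
Qed.

Lemma gL_Hoo al : Hoo (gL al).
Proof.
have [_ _ _ cl] := Hoo_closed R.
exact: (cl (gN al) (gL al) _ (gN_Hoo al) (gN_le al) (gN_cvg al)).
Qed.

Lemma gL_inv al : gL al * gL (- al) = 1.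
Proof.
apply/L0P; apply: filterS3 (L0_ME (gL al) (gL (- al))) (gLE al) (filterI (gLE (- al)) (L0_1E R)).
move=> t -> -> [-> ->]; rewrite -cexpD -cexp0; congr cexp.
by apply/eqP; rewrite eq_complex /= !mulNr opprK addNr subrr !eqxx.
Qed.

(* The conjugate of g_al is e^(-2 al Im F) g_(-al), and Im F is continuous and
   vanishes where Re F blows up: it differs from g_(-al) by a continuous
   function. *)
Definition jump al (t : R) : R[i] :=
  (expR (- (al * imL t)) - expR (al * imL t))%:C * Complex (cos (al * reL t)) (- sin (al * reL t)).

Lemma nc_jump al t : nc (jump al t) = `|expR (- (al * imL t)) - expR (al * imL t)|.
Proof. by rewrite /jump Normc.normcM nc_real /= sqrrN cos2Dsin2 sqrtr1 mulr1. Qed.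

Lemma cvg_complex (g : R -> R[i]) (t : R) : (fun s => nc (g s - g t)) @ t --> (0 : R) ->
  {for t, continuous (g : R -> R[i]^o)}.
Proof.
move=> h; apply/cvgrPdist_lt => e; rewrite ltcE /= => /andP[/eqP ie re].
have /cvgr0Pnorm_lt/(_ _ re) := h; apply: filterS => s.
rewrite (ger0_norm (nc_ge0 _)) nc_distC => hs.
by rewrite ltcE /= -ie eqxx.
Qed.

Lemma expR_diff_cont al t :
  {for t, continuous (fun s => expR (- (al * imL s)) - expR (al * imL s))}.
Proof.
have hv : {for t, continuous (fun s => al * imL s)}.
  by apply: cvgM; [exact: cvg_cst|exact: imL_cont].
apply: cvgB; apply: continuous_cvg; [exact: continuous_expR| |exact: continuous_expR|exact: hv].
by apply: cvgN; exact: hv.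
Qed.

Lemma imL_gap0 (t : R) : gap t = 0 -> imL t = 0.
Proof.
move=> /gap_eq0 s0; have h N : imF N t = 0.
  by rewrite /imF big1// => k _; rewrite /phi_im s0 mulr0 mul0r mulr0.
have := @imF_cvg R t; rewrite (_ : (@imF R)^~ t = cst 0); last exact/funext.
by move=> h'; apply: cvg_unique h' _; [exact: Rhausdorff|exact: cvg_cst].
Qed.

Lemma jump_cont al : continuous (jump al : R -> R[i]^o).
Proof.
(* At the point 1 the oscillating factor is only known to have modulus 1, and continuity comes from
   the real factor tending to 0. Elsewhere both factors are continuous. *)
move=> t; apply: cvg_complex; have := gap_ge0 t; rewrite le_eqVlt => /predU1P[/esym g0|g0].
  have j0 : nc (jump al t) = 0 by rewrite nc_jump imL_gap0// mulr0 oppr0 subrr normr0.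
  have /eqP := j0; rewrite nc_eq0 => /eqP jt.
  apply: (cvg_ext (u := fun s => `|expR (- (al * imL s)) - expR (al * imL s)|)).
    by move=> s; rewrite jt subr0 nc_jump.
  have c : (fun s => `|expR (- (al * imL s)) - expR (al * imL s)|) @ t -->
      `|expR (- (al * imL t)) - expR (al * imL t)|.
    by apply: cvg_norm; exact: expR_diff_cont.
  by rewrite -(nc_jump al t) j0 in c.
have hu : {for t, continuous (fun s => al * reL s)}.
  by apply: cvgM; [exact: cvg_cst|exact: reL_cont].
have hc : (fun s => cos (al * reL s)) @ t --> cos (al * reL t).
  by apply: continuous_cvg; [exact: continuous_cos|exact: hu].
have hs : (fun s => sin (al * reL s)) @ t --> sin (al * reL t).
  by apply: continuous_cvg; [exact: continuous_sin|exact: hu].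
apply: nc_cvg; rewrite /jump /= mul0r.
  rewrite subr0; apply: (cvg_ext (u := fun s => (expR (- (al * imL s)) - expR (al * imL s)) * cos (al * reL s))).
    by move=> s; rewrite mul0r subr0.
  by apply: cvgM hc; exact: expR_diff_cont.
rewrite addr0; apply: (cvg_ext (u := fun s => (expR (- (al * imL s)) - expR (al * imL s)) * - sin (al * reL s))).
  by move=> s; rewrite mul0r addr0.
by apply: cvgM; [exact: expR_diff_cont|exact: cvgN].
Qed.

Lemma jump_periodic al t : jump al (t + 2 * pi) = jump al t.
Proof.
have pp : 2 * pi = pi *+ 2 :> R by rewrite mulr_natl.
have hr : (@reF R)^~ (t + 2 * pi) = (@reF R)^~ t.
  by apply/funext => N; apply: eq_bigr => k _; rewrite /phi_re /phi_den pp cosD2pi sinD2pi.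
have hi : (@imF R)^~ (t + 2 * pi) = (@imF R)^~ t.
  by apply/funext => N; apply: eq_bigr => k _; rewrite /phi_im /phi_den pp cosD2pi sinD2pi.
by rewrite /jump /reL /imL hr hi.
Qed.

Lemma jump_CT al : CT R (conjL0 (gL al) - gL (- al)).
Proof.
exists (jump al); first by split; [exact: jump_cont|exact: jump_periodic].
apply: filterS3 (L0_BE (conjL0 (gL al)) (gL (- al))) (conjL0E (gL al)) (filterI (gLE al) (gLE (- al))).
move=> t -> -> [-> ->]; rewrite cexpJ /jump /cexp /= !mulNr opprK cosN !sinN.
by rewrite rmorphB /= mulrBl.
Qed.

Lemma CT0 : CT R 0.
Proof. by exists (cst 0); [split => // t; exact: cvg_cst|exact: L0_0E]. Qed.

Lemma gL_QC al : QC R (gL al).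
Proof.
split.
  by exists (gL al); [exact: gL_Hoo|exists 0; [exact: CT0|rewrite addr0]].
exists (conjL0 (gL al)); last exact: conjL0K.
by exists (gL (- al)); [exact: gL_Hoo|exists (conjL0 (gL al) - gL (- al)); [exact: jump_CT|rewrite addrC subrK]].
Qed.

(** The value of phi_(2^k) at the point 1 - 2^-n, from [ev_phi] with 1 + [kA n] = 2^n. *)
Definition weight n k : R := (1 + 2 ^+ k / 2 ^+ n)^-1.

Lemma weight_itv n k : 0 < weight n k <= 1.
Proof.
have h : 1 <= 1 + 2 ^+ k / 2 ^+ n :> R by rewrite lerDl divr_ge0 ?exprn_ge0.
by rewrite invr_gt0 invf_le1 ?(lt_le_trans ltr01 h)// h.
Qed.

Lemma weightS n k : weight n.+1 k.+1 = weight n k.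
Proof. by rewrite /weight !exprS -mulf_div divff ?pnatr_eq0// mul1r. Qed.

Lemma weight_le n k : weight n k.+1 <= weight n k.
Proof.
have h m : 0 < 1 + 2 ^+ m / 2 ^+ n :> R by rewrite ltr_pwDl// divr_ge0 ?exprn_ge0.
rewrite lef_pV2 ?posrE// lerD2l ler_wpM2r ?invr_ge0 ?exprn_ge0//.
by rewrite exprS ler_peMl ?exprn_ge0// ler1n.
Qed.

Lemma weight_decay n k : weight n k <= 2 ^+ n * 2^-1 ^+ k.
Proof.
have h : 0 < 2 ^+ k / 2 ^+ n :> R by rewrite divr_gt0 ?exprn_gt0.
apply: (@le_trans _ _ (2 ^+ k / 2 ^+ n)^-1).
  by rewrite lef_pV2 ?posrE// ?lerDr// ltr_pwDl// ltW.
by rewrite invf_div exprVn.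
Qed.

Definition phase_sum n N : R := \sum_(0 <= k < N) a k * weight n k.

Lemma phase_sum_S n N : phase_sum n N.+1 = phase_sum n N + a N * weight n N.
Proof. by rewrite /phase_sum big_nat_recr. Qed.

Lemma phase_sum_cauchy n N M : (N <= M)%N -> `|phase_sum n M - phase_sum n N| <= 2 * 2 ^+ n * 2^-1 ^+ N.
Proof.
move=> NM; rewrite -(subnKC NM); move: (M - N)%N => m {NM M}.
apply: (@le_trans _ _ (2 * 2 ^+ n * (2^-1 ^+ N - 2^-1 ^+ (N + m)))); last first.
  by rewrite ler_wpM2l ?mulr_ge0 ?exprn_ge0// gerBl exprn_ge0.
elim: m => [|m ih]; first by rewrite addn0 !subrr normr0 mulr0.
rewrite addnS phase_sum_S addrAC; apply: le_trans (ler_normD _ _) _.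
have /andP[w0 w1] := weight_itv n (N + m).
have h : `|a (N + m) * weight n (N + m)| <= 2 ^+ n * 2^-1 ^+ (N + m).
  rewrite ger0_norm; last by rewrite mulr_ge0 ?a_ge0// ltW.
  by apply: le_trans (weight_decay _ _); rewrite ler_piMl ?a_le1// ltW.
apply: le_trans (lerD ih h) _; rewrite exprS; move: (2 ^+ n : R) (2^-1 ^+ N : R) (2^-1 ^+ (N + m) : R).
by move=> x y z; rewrite le_eqVlt; apply/orP; left; apply/eqP; field.
Qed.

(* The value of F at the point 1 - 2^-n of the disc. *)
Definition phase n : R := limn (phase_sum n).

Lemma phase_sum_cvg n : phase_sum n @ \oo --> phase n.
Proof. by have [] := uniform_cauchy_lim (half_decay _) (@phase_sum_cauchy n). Qed.

Lemma phase_sum_le n N : phase_sum n N <= phase n.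
Proof.
apply: nondecreasing_cvgn_le; last by apply/cvg_ex; exists (phase n); exact: phase_sum_cvg.
apply/nondecreasing_seqP => k; rewrite phase_sum_S lerDl mulr_ge0 ?a_ge0//.
by have /andP[/ltW] := weight_itv n k.
Qed.

(** The weights with k < n are at least 1/2, since 2^k <= 2^n. *)
Lemma phase_ge n : 2^-1 * series a n <= phase n.
Proof.
apply: le_trans (phase_sum_le n n); rewrite /series /= /phase_sum mulr_sumr big_nat_cond [leRHS]big_nat_cond.
apply: ler_sum => k /andP[/andP[_ kn] _]; rewrite mulrC ler_wpM2l ?a_ge0//.
rewrite lef_pV2 ?posrE ?ltr_pwDl ?divr_ge0 ?exprn_ge0//.
by rewrite -[leRHS]/(1 + 1) lerD2l ler_pdivrMr ?exprn_gt0// mul1r ler_eXn2l ?ltr1n// ltnW.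
Qed.

Lemma phase_unbounded (M : R) : \forall n \near \oo, M <= phase n.
Proof.
have nda : nondecreasing_seq (series a).
  by apply/nondecreasing_seqP => n; rewrite seriesSr lerDl a_ge0.
have /cvgryPge/(_ (2 * M)) : series a @ \oo --> +oo.
  apply: (nondecreasing_dvgn_lt nda); exact: dvg_harmonic.
by apply: filterS => n h; apply: le_trans (phase_ge n); rewrite ler_pdivlMl.
Qed.

(** As [weight n k] = [weight n.+1 k.+1], the k-th term of the difference is [a k] times a
    difference of consecutive weights of level n + 1. With 0 <= [a k] <= 1 the sum telescopes to at
    most [weight n.+1 0] <= 1. *)
Lemma phase_step n : 0 <= phase n.+1 - phase n <= 1.
Proof.
have h N : 0 <= phase_sum n.+1 N - phase_sum n N <= weight n.+1 0 - weight n.+1 N.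
  elim: N => [|N /andP[h1 h2]]; first by rewrite /phase_sum !big_geq ?subrr ?lexx.
  have w := weight_le n.+1 N; rewrite weightS in w.
  rewrite !phase_sum_S weightS opprD addrACA -mulrBr.
  have h3 : 0 <= a N * (weight n.+1 N - weight n N) by rewrite mulr_ge0 ?a_ge0 ?subr_ge0.
  have h4 : a N * (weight n.+1 N - weight n N) <= weight n.+1 N - weight n N.
    by rewrite ler_piMl ?subr_ge0 ?a_le1.
  lra.
have c : (fun N => phase_sum n.+1 N - phase_sum n N) @ \oo --> phase n.+1 - phase n by apply: cvgB; exact: phase_sum_cvg.
rewrite -(cvg_lim _ c)//; apply/andP; split.
  by apply: limr_ge; [exact: cvgP c|apply: nearW => N; have /andP[] := h N].
apply: limr_le; [exact: cvgP c|apply: nearW => N; have /andP[_ h2] := h N].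
have /andP[_ w1] := weight_itv n.+1 0; have /andP[/ltW w2 _] := weight_itv n.+1 N; lra.
Qed.

Lemma ev_FL n N : ev (kA R n) (FL N) = (phase_sum n N)%:C.
Proof.
have A0 := @kA_ge0 R n; elim: N => [|N ih].
  by rewrite FL0 /phase_sum big_geq// -(scale0r 1) (ev_alg A0).
have p0 : 0 <= 2 ^+ N :> R by rewrite exprn_ge0.
rewrite FL_S ev_add//; last 2 first.
- by have /HpP[] := FL_Hoo N.
- by apply: LooZ; exact: phiL_Loo.
rewrite ih ev_Z//; last exact: phiL_Loo.
by rewrite ev_phi// kA1 phase_sum_S rmorphD rmorphM.
Qed.

Lemma ev_gL n al : ev (kA R n) (gL al) = cexp (rot al * (phase n)%:C).
Proof.
have A0 := @kA_ge0 R n.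
apply: (@nc_cvg_unique R (fun N => ev (kA R n) (gN al N))).
  exact: (ev_bounded_cvg A0 (gN_le al) (gN_cvg al)).
have h N : ev (kA R n) (gN al N) = cexp (rot al * (phase_sum n N)%:C).
  rewrite (ev_cexp A0 (rotFL_Hoo al N) (cexpLE _)) ev_Z ?ev_FL//.
  by have /HpP[] := FL_Hoo N.
apply: (cvg_ext (u := fun N => nc (cexp (rot al * (phase_sum n N)%:C) - cexp (rot al * (phase n)%:C)))) => [N|].
  by rewrite h.
apply: cexp_cvg.
apply: (cvg_ext (u := fun N => nc (rot al) * `|phase_sum n N - phase n|)) => [N|].
  by rewrite -mulrBr -rmorphB Normc.normcM nc_real.
rewrite -(mulr0 (nc (rot al))); apply: cvgM; first exact: cvg_cst.
rewrite -(normr0 R) -(subrr (phase n)); apply: cvg_norm; apply: cvgB; last exact: cvg_cst.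
exact: phase_sum_cvg.
Qed.

Lemma mform_gL n al : mform (gL al) (kH R n) (kH R n) = Complex (cos (al * phase n)) (sin (al * phase n)).
Proof.
rewrite /mform !kHE -(ev_kern (@kA_ge0 R n) (gL_Hoo al)) ev_gL.
have -> : rot al * (phase n)%:C = Complex 0 (al * phase n).
  by rewrite -[(phase n)%:C]/(Complex (phase n) 0) rotM mulr0 oppr0.
by rewrite /cexp /= expR0 mul1r.
Qed.
End Symbols.

(** * Arguments of slowly varying sequences *)

Section Winding.
Variable R : realType.
Implicit Types (la mu nu : nat -> R[i]) (x y : R).

Definition cis x : R[i] := Complex (cos x) (sin x).

Lemma cisD x y : cis (x + y) = cis x * cis y.
Proof. by rewrite /cis cosD sinD; apply/eqP; rewrite eq_complex /= addrC eqxx addrC eqxx. Qed.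

Lemma cis0 : cis 0 = 1. Proof. by rewrite /cis cos0 sin0. Qed.

Lemma nc_cis x : nc (cis x) = 1. Proof. by rewrite /= cos2Dsin2 sqrtr1. Qed.

Lemma cis_eq1 x : `|x| < 2 * pi -> cis x = 1 -> x = 0.
Proof.
move=> x2 /(congr1 (@complex.Re R)) /= cx; apply/eqP; rewrite -normr_le0 leNgt; apply/negP => x0.
have : cos `|x| < 1 by apply: cos_lt1; rewrite x0.
have -> : cos `|x| = cos x by case: (ger0P x) => // _; rewrite cosN.
by rewrite cx ltxx.
Qed.

Lemma atan_lip x y : `|atan x - atan y| <= `|x - y|.
Proof.
wlog xy : x y / x <= y => [h|].
  by case/orP: (le_total x y) => [/h//|/h]; rewrite distrC => /le_trans; apply; rewrite distrC.
have [z _ h] := @MVT_segment R (@atan R) (fun z => (1 + z ^+ 2)^-1) x y xy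
  (fun z _ => is_derive1_atan z) (continuous_subspaceT (@continuous_atan R)).
rewrite distrC h (distrC x) normrM ler_piMl// ger0_norm ?invr_ge0 ?addr_ge0 ?sqr_ge0//.
by rewrite invf_le1 ?lerDl ?sqr_ge0// ltr_pwDl ?sqr_ge0.
Qed.

Lemma polar (w : R[i]) : 0 < complex.Re w ->
  w = (nc w)%:C * cis (atan (complex.Im w / complex.Re w)).
Proof.
move=> w0; set r := complex.Im w / complex.Re w; have [/andP[r1 r2] tr] := atan_def r.
have c0 : 0 < cos (atan r) by apply: cos_gt0_pihalf; rewrite r1.
have sc : sin (atan r) = r * cos (atan r) by rewrite -{2}tr /tan divfK// gt_eqF.
have nw : nc w * cos (atan r) = complex.Re w.
  apply/eqP; rewrite -(@eqrXn2 _ 2) ?mulr_ge0 ?nc_ge0 ?(ltW c0) ?(ltW w0)//.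
  rewrite exprMn nc_sqr.
  have -> : complex.Im w = r * complex.Re w by rewrite divfK// gt_eqF.
  have := cos2Dsin2 (atan r); rewrite sc => h; apply/eqP.
  by rewrite -[RHS]mulr1 -h; ring.
apply/eqP; rewrite eq_complex /cis /= mul0r subr0 mul0r addr0 nw eqxx /=.
by rewrite sc mulrCA nw divfK// gt_eqF.
Qed.

Definition slow la := (fun n => nc (la n.+1 - la n)) @ \oo --> (0 : R).
Definition away la := exists2 d : R, 0 < d & \forall n \near \oo, d <= nc (la n).

(* The argument of la / mu is a bounded function with steps tending to 0. *)
Definition bounded_turn la mu := exists (th : nat -> R) (M : R),
  [/\ forall n, `|th n| <= M, (fun n => th n.+1 - th n) @ \oo --> (0 : R) &
    \forall n \near \oo, la n * (nc (mu n))%:C = mu n * (nc (la n))%:C * cis (th n)].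

Lemma bounded_turn_sym la mu : bounded_turn la mu -> bounded_turn mu la.
Proof.
move=> [th [M [thM th0 h]]]; exists (fun n => - th n), M; split.
- by move=> n; rewrite normrN.
- rewrite -(oppr0 R); apply: (cvg_ext (u := fun n => - (th n.+1 - th n))) => [n|].
    by rewrite opprB opprK addrC.
  exact: cvgN.
- by apply: filterS h => n ->; rewrite -mulrA -cisD subrr cis0 mulr1.
Qed.

(** The two turns add up; [away mu] allows cancelling the factor |mu n|. *)
Lemma bounded_turn_trans mu la nu : away mu ->
  bounded_turn la mu -> bounded_turn mu nu -> bounded_turn la nu.
Proof.
move=> [d d0 md] [th [M [thM th0 h]]] [et [N [etN et0 h']]].
exists (fun n => th n + et n), (M + N); split.
- by move=> n; apply: le_trans (ler_normD _ _) _; rewrite lerD.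
- rewrite -(addr0 0); apply: (cvg_ext (u := fun n => (th n.+1 - th n) + (et n.+1 - et n))) => [n|].
    by ring.
  exact: cvgD.
- apply: filterS3 md h h' => n dn e1 e2.
  have n0 : (nc (mu n))%:C != 0 :> R[i] by rewrite (fmorph_eq0 (real_complex R)) gt_eqF// (lt_le_trans d0).
  apply: (mulIf n0); rewrite mulrAC e1 cisD.
  rewrite [LHS](_ : _ = mu n * (nc (nu n))%:C * ((nc (la n))%:C * cis (th n))); last by ring.
  by rewrite e2; ring.
Qed.

(** The quotient w = la / mu is eventually within 1/2 of 1, so its argument is atan (Im w / Re w),
    bounded by pi / 2. It varies slowly because w does, and because atan (Im / Re) is Lipschitz on
    that disc. *)
Lemma bounded_turn_close la mu (d : R) : 0 < d ->
  (\forall n \near \oo, d <= nc (mu n)) -> (\forall n \near \oo, nc (la n - mu n) <= d / 2) ->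
  slow la -> slow mu -> bounded_turn la mu.
Proof.
move=> d0 md lm sl sm; pose w n := la n / mu n.
pose th n := atan (complex.Im (w n) / complex.Re (w n)).
have mu0 n : d <= nc (mu n) -> mu n != 0.
  by move=> dn; rewrite -nc_eq0 gt_eqF// (lt_le_trans d0).
have wE n : d <= nc (mu n) -> nc (la n - mu n) <= d / 2 ->
    nc (w n - 1) <= 2^-1.
  move=> dn ln; have m0 := mu0 _ dn.
  have -> : w n - 1 = (la n - mu n) / mu n by rewrite mulrBl divff.
  rewrite Normc.normcM Normc.normcV ler_pdivrMr ?(lt_le_trans d0)//.
  by apply: le_trans ln _; rewrite mulrC ler_wpM2l.
have wRe n : nc (w n - 1) <= 2^-1 -> 2^-1 <= complex.Re (w n).
  move=> wn; have := le_trans (Re_le_nc (w n - 1)) wn; rewrite ReB /= ler_norml => /andP[h _].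
  by move: h; lra.
have wIm n : nc (w n - 1) <= 2^-1 -> `|complex.Im (w n)| <= 2^-1.
  by move=> wn; have := le_trans (Im_le_nc (w n - 1)) wn; rewrite ImB /= subr0.
exists th, (pi / 2); split.
- move=> n; rewrite ler_norml; have [/andP[h1 h2] _] := atan_def (complex.Im (w n) / complex.Re (w n)).
  by rewrite (ltW h1) (ltW h2).
- have hS (P : nat -> Prop) : (\forall n \near \oo, P n) -> \forall n \near \oo, P n.+1.
    by move=> [N _ hN]; exists N => // n /= Nn; apply: hN => /=; exact: leqW.
  have near2 : \forall n \near \oo, (d <= nc (mu n) /\ nc (la n - mu n) <= d / 2) /\
      (d <= nc (mu n.+1) /\ nc (la n.+1 - mu n.+1) <= d / 2).
    by apply: filterI; apply: filterI => //; [exact: hS md|exact: hS lm].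
  (* 1 / d comes from dividing by mu, the inner 2 from |w| <= 2, and 4 is the Lipschitz constant of
     Im / Re where Re >= 1/2 and |Im| <= 1/2. *)
  pose e n := 4 / d * (nc (la n.+1 - la n) + 2 * nc (mu n.+1 - mu n)).
  have e0 : e @ \oo --> (0 : R).
    rewrite -(mulr0 (4 / d)); apply: cvgM; first exact: cvg_cst.
    rewrite -(addr0 0); apply: cvgD; first exact: sl.
    by rewrite -(mulr0 2); apply: cvgM; [exact: cvg_cst|exact: sm].
  apply/cvgr0Pnorm_le => eps eps0; have /cvgr0Pnorm_le/(_ _ eps0) near1 := e0.
  apply: filterS2 near2 near1 => n [[d1 l1] [d2 l2]] en.
  apply: le_trans (le_trans (ler_norm _) en); apply: le_trans (atan_lip _ _) _.
  have w1 := wE _ d1 l1; have w2 := wE _ d2 l2.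
  have r1 := wRe _ w1; have r2 := wRe _ w2; have i1 := wIm _ w1; have i2 := wIm _ w2.
  have m1 := mu0 _ d1; have m2 := mu0 _ d2.
  have dw : nc (w n.+1 - w n) <= d^-1 * (nc (la n.+1 - la n) + 2 * nc (mu n.+1 - mu n)).
    have -> : w n.+1 - w n = ((la n.+1 - la n) - w n * (mu n.+1 - mu n)) / mu n.+1.
      by rewrite /w; field; rewrite m1 m2.
    have wn : nc (w n) <= 2.
      have -> : w n = (w n - 1) + 1 by rewrite subrK.
      by apply: le_trans (ncD _ _) _; rewrite Normc.normc1; lra.
    rewrite Normc.normcM Normc.normcV mulrC; apply: ler_pM; rewrite ?invr_ge0 ?nc_ge0//.
      by rewrite lef_pV2 ?posrE// (lt_le_trans d0).
    by apply: le_trans (ncB _ _) _; rewrite lerD2l Normc.normcM ler_wpM2r ?nc_ge0.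
  have dr : `|complex.Re (w n.+1) - complex.Re (w n)| <= nc (w n.+1 - w n).
    by rewrite -ReB Re_le_nc.
  have di : `|complex.Im (w n.+1) - complex.Im (w n)| <= nc (w n.+1 - w n).
    by rewrite -ImB Im_le_nc.
  apply: (@le_trans _ _ (4 * nc (w n.+1 - w n))); last first.
    by rewrite /e -mulrA ler_wpM2l.
  move: (complex.Re (w n.+1)) (complex.Re (w n)) (complex.Im (w n.+1)) (complex.Im (w n))
    (nc (w n.+1 - w n)) r1 r2 i1 i2 dr di => p q s t D qq pp tt ss dp ds.
  have p0 : 0 < p by lra. have q0 : 0 < q by lra.
  have -> : s / p - t / q = (s - t) / p - t * (p - q) / (p * q).
    by field; rewrite !gt_eqF.
  apply: le_trans (ler_normB _ _) _.
  have ip : p^-1 <= 2 by rewrite -(invrK 2) lef_pV2 ?posrE ?invr_gt0.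
  have iq : q^-1 <= 2 by rewrite -(invrK 2) lef_pV2 ?posrE ?invr_gt0.
  have ip0 : 0 <= p^-1 by rewrite invr_ge0 ltW.
  have iq0 : 0 <= q^-1 by rewrite invr_ge0 ltW.
  have h1 : `|(s - t) / p| <= D * 2 by rewrite normrM (ger0_norm ip0) ler_pM.
  have h2 : `|t * (p - q) / (p * q)| <= (2^-1 * D) * (2 * 2).
    rewrite normrM [`|t * _|]normrM ler_pM ?mulr_ge0// ?ler_pM//.
    by rewrite invfM ger0_norm ?mulr_ge0// ler_pM.
  by lra.
- apply: filterS2 md lm => n d1 l1; have m0 := mu0 _ d1.
  have r1 := wRe _ (wE _ d1 l1); have w0 : 0 < complex.Re (w n) by lra.
  have lE : la n = w n * mu n by rewrite divfK.
  have pw := polar w0.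
  rewrite lE Normc.normcM rmorphM [in LHS]pw /th -mulrA; ring.
Qed.

(** Eventually z_n = c X_n - th_n is a multiple of 2 pi with steps at most 2 < 2 pi, hence constant.
    Then c X_n is bounded, which is impossible for c != 0 since X is unbounded. *)
Lemma slow_turn_rigid (X th : nat -> R) (c M : R) : `|c| <= 1 ->
  (forall n, 0 <= X n.+1 - X n <= 1) -> (forall B, \forall n \near \oo, B <= X n) ->
  (forall n, `|th n| <= M) -> (fun n => th n.+1 - th n) @ \oo --> (0 : R) ->
  (\forall n \near \oo, cis (c * X n - th n) = 1) -> c = 0.
Proof.
move=> c1 Xs Xu thM th0 h; apply/eqP/negPn/negP => c0.
have /cvgr0Pnorm_le/(_ _ ltr01) h1 := th0.
have [N _ hN] := filterI h1 h; pose z n := c * X n - th n.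
have zc k : z (N + k)%N = z N.
  elim: k => [|k ih]; first by rewrite addn0.
  have [t1 e1] := hN (N + k)%N (leq_addr k N).
  have [_ e2] := hN (N + k).+1 (leqW (leq_addr k N)).
  rewrite addnS -ih; apply/eqP; rewrite -subr_eq0; apply/eqP; apply: cis_eq1; last first.
    by apply: (mulIf (x := cis (z (N + k)%N))); rewrite -?cisD ?subrK /z e1 ?e2 ?mul1r ?oner_eq0.
  have -> : z (N + k).+1 - z (N + k)%N =
      c * (X (N + k).+1 - X (N + k)%N) - (th (N + k).+1 - th (N + k)%N) by rewrite /z; ring.
  apply: le_lt_trans (ler_normB _ _) _; rewrite normrM.
  have /andP[x0 x1] := Xs (N + k)%N.
  have : `|c| * `|X (N + k).+1 - X (N + k)%N| <= 1 by rewrite (ger0_norm x0) mulr_ile1.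
  by have := pi_ge2 R; move: t1 => /=; lra.
(* The threshold exceeds by 1 / |c| the bound (|z N| + M) / |c| on |X| that follows from z being
   constant. *)
have [K _ hK] := Xu ((`|z N| + M + 1) / `|c|).
have := hK (N + K)%N (leq_addl N K) => /=; rewrite ler_pdivrMr ?normr_gt0//.
have /andP[_] := Xs 0%N => _.
have e : c * X (N + K)%N = z N + th (N + K)%N by rewrite -(zc K) /z subrK.
have : `|X (N + K)%N * c| <= `|z N| + M.
  by rewrite mulrC e; apply: le_trans (ler_normD _ _) _; rewrite lerD2l.
rewrite normrM; have := ler_norm (X (N + K)%N).
have := normr_ge0 c; move: `|c| (X (N + K)%N) => C x C0 xx h2 h3.
have : x * C <= `|x| * C by rewrite ler_wpM2r.
by lra.
Qed.
End Winding.

(** * Path components *)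

Section PathComponents.
Variable R : realType.

(** The retraction of the line onto [0, 1], written with absolute values so that continuity is
    immediate. Composed with it, a path becomes a map on the connected space [R]. *)
Definition clamp (t : R) : R := (1 + `|t| - `|t - 1|) / 2.

Lemma clamp_itv t : clamp t \in `[0, 1]%classic.
Proof.
apply/mem_set; rewrite /= in_itv /= /clamp.
have h1 := ler_normB t 1; have h2 := ler_normD (t - 1) 1.
rewrite subrK normr1 in h2; rewrite normr1 in h1.
by rewrite divr_ge0//= ?ler_pdivrMr//; lra.
Qed.

Definition to_unit_interval (t : R) : unit_interval R := exist _ (clamp t) (clamp_itv t).

Lemma clamp_cont : continuous clamp.
Proof.
move=> t; apply: cvgM; last exact: cvg_cst.
apply: cvgB; first (apply: cvgD; [exact: cvg_cst|exact: (cvg_norm cvg_id)]).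
by apply: cvg_norm; apply: cvgB; [exact: cvg_id|exact: cvg_cst].
Qed.

Lemma to_unit_interval_cont : continuous to_unit_interval.
Proof. by apply: continuous_comp_initial; exact: clamp_cont. Qed.

(** The classes of E are open, so the parameters at which the path is related to its origin form an
    open and closed set, nonempty because E x x holds locally. *)
Lemma path_related (X : topologicalType) (E : X -> X -> Prop) (x y : X) :
  (forall u, \forall v \near u, E u v) -> (forall u v, E u v -> E v u) ->
  (forall u v w, E u v -> E v w -> E u w) ->
  path_component R x y -> E x y.
Proof.
move=> El Es Et [p]; pose h t := p (to_unit_interval t).
have hc : continuous h.
  by move=> t; apply: continuous_comp; [exact: to_unit_interval_cont|exact: cts_fun].
have h0 : h 0 = x.
  rewrite -(path_zero (s := p)); congr (p _); apply: val_inj => /=.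
  by rewrite /clamp normr0 sub0r normrN normr1 addr0 subrr mul0r.
have h1 : h 1 = y.
  rewrite -(path_one (s := p)); congr (p _); apply: val_inj => /=.
  by rewrite /clamp subrr normr0 normr1 subr0 divff.
have hE t : \forall s \near t, E (h t) (h s) by exact: (hc t _ (El (h t))).
have opE : open [set t | E x (h t)].
  rewrite openE => t /= xt; apply: filterS (hE t) => s; exact: Et.
have opN : open (~` [set t | E x (h t)]).
  rewrite openE => t /= xt; apply: filterS (hE t) => s ts xs; apply: xt.
  by apply: Et xs _; exact: Es.
have xx : E x x by have := nbhs_singleton (hE 0); rewrite h0.
have cR : connected [set: R] by apply/connected_intervalP => a b _ _ c _.
rewrite -h1; suff -> : E x (h 1) = [set t | E x (h t)] 1.
  rewrite (cR [set t | E x (h t)])//.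
  - by exists 0; rewrite /= h0.
  - by exists [set t | E x (h t)]; rewrite ?setTI.
  - exists [set t | E x (h t)]; rewrite ?setTI//.
    by rewrite -(setCK [set t | E x (h t)]); exact: open_closedC.
by [].
Qed.

Lemma path_component_refl (X : topologicalType) (x : X) : path_component R x x.
Proof. by constructor; exact: (cst x : {path (unit_interval R) from x to x}). Qed.

(** An injection of the components into the integers would make ]0, 1[ countable, against its
    Lebesgue measure 1. *)
Lemma uncountable_path_components (X : topologicalType) (g : R -> X) :
  (forall a b, 0 < a < 1 -> 0 < b < 1 -> path_component R (g a) (g b) -> a = b) ->
  ~ countable (path_components R X).
Proof.
move=> gi /countable_injP[f fi].
have : countable (`]0, 1[%classic : set R).
  apply/countable_injP; exists (fun a => f (path_component R (g a))) => a b.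
  move=> /set_mem /=; rewrite in_itv /= => a01 /set_mem /=; rewrite in_itv /= => b01 fab.
  apply: gi => //; have := fi _ _ _ _ fab; rewrite !inE => -> //; first exact: path_component_refl.
  - by exists (g a).
  - by exists (g b).
move=> /countable_lebesgue_measure0; rewrite lebesgue_measure_itv /= lte_fin ltr01 => /eqP.
by rewrite oppr0 adde0 eqe oner_eq0.
Qed.

(** The part common to both spaces. [L S n] stands for the diagonal value at k_n and [X] for the
    phase; the Lipschitz bound makes [bounded_turn] hold between nearby points, hence along
    paths. *)
Lemma uncountable_by_turning (V : normedModType R[i]) (A : set V) (L : V -> nat -> R[i])
    (X : nat -> R) (g : R -> V) :
  (forall S, A S -> slow (L S)) -> (forall S, A S -> away (L S)) ->
  (forall S S' (d : R), A S -> A S' -> `|S - S'| <= d%:C -> forall n, nc (L S n - L S' n) <= d) ->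
  (forall n, 0 <= X n.+1 - X n <= 1) -> (forall B, \forall n \near \oo, B <= X n) ->
  (forall a, A (g a)) -> (forall a n, L (g a) n = cis (a * X n)) ->
  ~ countable (path_components R (set_type A)).
Proof.
move=> Ls La Ll Xs Xu Ag Lg.
apply: (@uncountable_path_components _ (fun a => SigSub (mem_set (Ag a)) : set_type A)) => a b.
move=> /andP[a0 a1] /andP[b0 b1] pab.
have AS (S : set_type A) : A (val S) by exact: set_mem (valP S).
have [th [M [thM th0 h]]] : bounded_turn (L (g a)) (L (g b)).
  apply: (path_related (E := fun S S' : set_type A => bounded_turn (L (val S)) (L (val S'))) _ _ _ pab).
  - move=> S; have [d d0 dS] := La _ (AS S).
    have c : continuous (val : set_type A -> V) by exact: initial_continuous.
    have d20 : 0 < (d / 2)%:C :> R[i] by rewrite ltcR divr_gt0.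
    have /cvgrPdist_le/(_ _ d20) := c S; apply: filterS => S' SS'.
    apply: bounded_turn_sym; apply: (bounded_turn_close d0 dS); [|exact/Ls/AS..].
    by apply: nearW => n; apply: Ll; [exact: AS..|rewrite distrC].
  - by move=> S S'; exact: bounded_turn_sym.
  - by move=> S S' S''; apply: bounded_turn_trans; exact/La/AS.
apply/eqP; rewrite -subr_eq0; apply/eqP; apply: (slow_turn_rigid _ Xs Xu thM th0).
  by rewrite ler_norml; apply/andP; split; lra.
apply: filterS h => n; rewrite !Lg !nc_cis !mulr1 => e.
by rewrite mulrBl -addrA -opprD cisD e -!cisD subrr cis0.
Qed.
End PathComponents.

Theorem corollary4p4 (R : realType) :
  ~ countable (path_components R (set_type (QC_invertible R))) /\
  ~ countable (path_components R (set_type (toeplitz_fredholm R))).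
Proof.
have gLE al n : mform (gL al) (kH R n) (kH R n) = cis (al * phase R n) by exact: mform_gL.
split.
  have gi al : exists f : Linf R, QC_invertible R f /\ (f : L0 R) = gL al.
    have gLo : (gL al : L0 R) \in inLp (@le1oo R).
      by apply/mem_set; exact: QC_Loo (gL_QC al).
    exists (MkLp gLo); split => //; split; first exact: gL_QC.
    by exists (gL (- al)); [exact: gL_QC|exact: gL_inv].
  have /choice[g gP] := gi.
  apply: (@uncountable_by_turning R (Linf R) (QC_invertible R) (fun f n => mform (f : L0 R) (kH R n) (kH R n)) (phase R) g).
  - by move=> f [fQ _]; exact/asym_eigen_slow/QC_eigen.
  - by move=> f [fQ [h hQ fh]]; exact: QC_inv_lower fQ hQ fh.
  - move=> f h d [fQ _] [hQ _] fh n; rewrite -mformB; [|exact: QC_Loo..].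
    have hL : Lp R +oo%E ((f : L0 R) - (h : L0 R)) by apply: LooD; [exact: QC_Loo|exact/LooN/QC_Loo].
    apply: mform_kH_le => //; apply: filterS (Loo_le hL) => t /le_trans; apply.
    by move: fh; rewrite -lecR.
  - exact: phase_step.
  - exact: phase_unbounded.
  - by move=> al; have [] := gP al.
  - by move=> al n; have [_ ->] := gP al.
(* The Toeplitz operator of the analytic symbol g_al is a multiplication, so its diagonal values are
   those of the symbol. *)
have gi al : exists S, toeplitz_fredholm R S /\ forall g, (H2_val (S g) : L0 R) = gL al * (H2_val g : L0 R).
  exact: analytic_toeplitz_fredholm (gL_Hoo al) (gL_Hoo (- al)) (gL_inv al) (gL_QC al).
have /choice[g gP] := gi.
apply: (@uncountable_by_turning R _ (toeplitz_fredholm R) (@diag R) (phase R) g).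
- by move=> S [/toeplitz_algebra_eigen/asym_eigen_slow].
- by move=> S [/toeplitz_algebra_eigen hS fS]; exact: fredholm_lower hS fS.
- move=> S S' d _ _ SS' n; apply: le_trans (diag_lip _ _ _) _.
  by move: SS'; rewrite -lecR.
- exact: phase_step.
- exact: phase_unbounded.
- by move=> al; have [] := gP al.
- by move=> al n; have [_ gE] := gP al; rewrite -gLE /diag /bform innerE gE.
Qed.
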